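(* Let $T>0$ and let $(u,F)\in[W^{1,\infty}([0,T]\times\mathbb R)]^2$ be a conservative solution with initial data $(u_0,F_0)\in\mathcal D$, $F_\infty=\|F_0\|_\infty>0$. Then the conservative solution (with initial data $(u_0,F_0)$, on $[0,T]\times\mathbb R$) is unique, and there exists a constant $C>0$, dependent on $T$, $F_\infty$ and $\sup_{t\in[0,T]}\big(\|u_x(t,\cdot)\|_\infty+\|F_x(t,\cdot)\|_\infty\big)$, such that the numerical solution $(u_{\Delta x},F_{\Delta x})$ with initial data $(u_0,F_0)$ satisfies, for every $\Delta x>0$, $$\sup_{t\in[0,T]}\big(\|(u_{\Delta x}-u)(t,\cdot)\|_\infty+\|(F_{\Delta x}-F)(t,\cdot)\|_\infty\big)\le C\left(\sqrt{\Delta x}+\Delta x\right).$$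
   Context: **The space $\mathcal D$.** $\mathcal D$ consists of pairs $(u,F)$ of real functions on $\mathbb R$ such that $u\in L^\infty(\mathbb R)$, $u_x\in L^2(\mathbb R)$ (so $u$ is identified with its continuous representative), $F\in L^\infty(\mathbb R)$, $F$ is monotonically increasing and left continuous, $\lim_{x\to-\infty}F(x)=0$, $\|F\|_\infty=F_\infty$, and $\int_a^b u_x^2(x)\,dx\le F(b^-)-F(a^+)$ for all $a<b$. Here $F_\infty$ denotes the total energy (the limit of $F$ at $+\infty$). To $(u,F)\in\mathcal D$ there corresponds a positive finite Radon measure $\mu$ with $F(x)=\mu((-\infty,x))$. **Conservative solution.** A pair $(u,F)$ is a conservative solution of the Hunter–Saxton system $u_t+uu_x=\frac12F-\frac14F_\infty$, $F_t+uF_x=0$ with initial data $(u_0,F_0)\in\mathcal D$ if $u|_{t=0}=u_0$, $F|_{t=0}=F_0$, $u\in C^{0,\frac12}([0,T]\times\mathbb R)$ for all $T\ge0$, $(u(t),F(t))\in\mathcal D$ and $\|F(t)\|_\infty=F_\infty$ for all $t\ge0$, and for all $\phi\in C_c^\infty([0,\infty)\times\mathbb R)$, with $\phi_0=\phi(0,\cdot)$, $$\int_0^\infty\!\!\int_{\mathbb R}\Big(\phi_t u+\tfrac12\phi_x u^2+\phi\big(\tfrac12F-\tfrac14F_\infty\big)\Big)\,dx\,dt+\int_{\mathbb R}\phi_0(x)u_0(x)\,dx=0,$$ $$\int_0^\infty\!\!\int_{\mathbb R}\big(\phi_t(t,x)+u(t,x)\phi_x(t,x)\big)\,d\mu(t)\,dt+\int_{\mathbb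 R}\phi_0(x)\,d\mu_0=0,$$ where $\mu(t)$ is the finite positive Radon measure with $F(t,x)=\mu(t)((-\infty,x))$, and $\mu_0$ the one associated with $F_0$. **Projection.** For $\Delta x>0$ put $x_j=j\Delta x$, $j\in\mathbb Z$. For $(u,F)\in\mathcal D$, $\mathbb P_{\Delta x}(u,F)=(\bar u,\bar F)$ is the pair of continuous functions with $\bar u(x_j)=u(x_j)$, $\bar F(x_j)=F(x_j)$ for all $j$, linear on each $[x_j,x_{j+1}]$. **Time step.** $\Delta t=\frac{1}{2\sqrt{F_\infty}}\sqrt{\Delta x}$, and $t^n=n\Delta t$, $n\in\mathbb N_0$. **Evolution.** Let $(v,G)\in\mathcal D$ (with total energy $F_\infty$) be continuous and linear on each $[x_j,x_{j+1}]$. For $0\le\tau\le\Delta t$ set $x_j(\tau)=x_j+v(x_j)\tau+\frac14\left(G(x_j)-\frac12F_\infty\right)\tau^2$; with the time step $\Delta t=\frac{1}{2\sqrt{F_\infty}}\sqrt{\Delta x}$ these points satisfy $x_j(\tau)+\frac12\Delta x<x_{j+1}(\tau)$. Then $T_\tau(v,G)=(\tilde v,\tilde G)$ is the pair of continuous functions, linear on each $[x_j(\tau),x_{j+1}(\tau)]$, with $\tilde v(x_j(\tau))=v(x_j)+\frac12\left(G(x_j)-\frac12F_\infty\right)\tau$ and $\tilde G(x_j(\tau))=G(x_j)$. **Numerical solution.** Given $(u_0,F_0)\in\mathcal D$, set $(U^0,F^0)=\mathbb P_{\Delta x}(u_0,F_0)$ and $(U^{n+1},F^{n+1})=\mathbb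 P_{\Delta x}T_{\Delta t}(U^n,F^n)$ for $n\ge0$. The numerical solution is $(u_{\Delta x},F_{\Delta x})(t,x)=\mathbb P_{\Delta x}T_\tau(U^n,F^n)(x)$ for $t=t^n+\tau$, $\tau\in[0,\Delta t)$.
   Formalization: Uniqueness is proved as: u agrees at every t in [0,T] and F at almost every t; for every t it fails, since F may be altered at a single time where u_x² < F_x. (u,F) in W^{1,∞} means the continuous representative on [0,T]×R. *)

(* Defs.v *)
From HB Require Import structures.
From mathcomp Require Import all_boot all_order all_algebra.
From mathcomp Require Import all_classical all_reals all_analysis.

Set Implicit Arguments.
Unset Strict Implicit.
Unset Printing Implicit Defensive.

Import Order.TTheory GRing.Theory Num.Theory.
Import numFieldNormedType.Exports.

Local Open Scope classical_set_scope.
Local Open Scope ring_scope.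

Section TestFunctions.
Context {R : realType} {V : normedModType R}.

(* On a finite-dimensional V (below, R and R * R) this is the usual class C^n:
   the derivatives along all directions amount to the partial derivatives. *)
Fixpoint class_C (n : nat) (f : V -> R) : Prop :=
  continuous f /\
  if n is m.+1 then
    forall v : V, (forall x, derivable f x v) /\ class_C m ('D_v f)
  else True.

Definition supp (f : V -> R) : set V := closure [set x | f x != 0].

Definition test_function (O : set V) (phi : V -> R) : Prop :=
  [/\ forall n, class_C n phi, compact (supp phi) & supp phi `<=` O].

End TestFunctions.

Section WeakDerivatives.
Context {R : realType}.
Local Notation mu := (@lebesgue_measure R).

Definition weak_derivative (f g : R -> R) : Prop :=
  [/\ locally_integrable setT f, locally_integrable setT g &
    forall phi : R -> R, test_function setT phi ->
      \int[mu]_x (f x * 'D_1 phi x) = - \int[mu]_x (g x * phi x)].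

(* A weak derivative of f when there is one; it is unique up to a null set. *)
Definition wderiv (f : R -> R) : R -> R :=
  xget (cst 0) [set g | weak_derivative f g].

Definition Linfty_norm (f : R -> R) : \bar R := 'N[mu]_+oo[EFin \o f].

Definition open_strip (T : R) : set (R * R) := `]0, T[ `*` setT.

Definition weak_partial (T : R) (v : R * R) (f g : R * R -> R) : Prop :=
  forall phi : R * R -> R, test_function (open_strip T) phi ->
    \int[(mu \x mu)%E]_(z in open_strip T) (f z * 'D_v phi z) =
    - \int[(mu \x mu)%E]_(z in open_strip T) (g z * phi z).

Definition Linfty_strip (T : R) (f : R * R -> R) : Prop :=
  f \_ (open_strip T) \in Lfun (mu \x mu)%E +oo%E.

(* Elements of W^{1,oo} have a continuous representative, and w is required to
   be that representative, on the closed strip. *)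
Definition W1infty (T : R) (w : R -> R -> R) : Prop :=
  let f := fun z : R * R => w z.1 z.2 in
  [/\ {within `[0, T] `*` setT, continuous f}, Linfty_strip T f,
      exists2 g, Linfty_strip T g & weak_partial T (1, 0) f g &
      exists2 g, Linfty_strip T g & weak_partial T (0, 1) f g].

(* sup over t in [0,T] of ||u_x(t,.)||_oo + ||F_x(t,.)||_oo *)
Definition slope_bound (T : R) (u F : R -> R -> R) : \bar R :=
  ereal_sup [set (Linfty_norm (wderiv (u t)) + Linfty_norm (wderiv (F t)))%E
            | t in `[0, T]].

End WeakDerivatives.

Section HunterSaxton.
Context {R : realType}.
Local Notation mu := (@lebesgue_measure R).

Definition inD (Finf : R) (u F : R -> R) : Prop :=
  [/\ continuous u /\ u \in Lfun mu +oo%E,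
      {homo F : x y / x <= y} /\ (forall x, F y @[y --> x^'-] --> F x),
      F x @[x --> -oo] --> 0,
      F \in Lfun mu +oo%E /\ Linfty_norm F = Finf%:E &
      exists ux : R -> R,
        [/\ weak_derivative u ux, ux \in Lfun mu 2%:E &
          forall a b, a < b ->
            (\int[mu]_(x in `[a, b]) (ux x ^+ 2)%:E <=
             (lim (F x @[x --> b^'-]) - lim (F x @[x --> a^'+]))%:E)%E]].

(* The norm on R * R is the max norm; K absorbs the difference with the
   Euclidean one. *)
Definition holder_half (T : R) (u : R -> R -> R) : Prop :=
  (exists M, forall t x, t \in `[0, T] -> `|u t x| <= M) /\
  (exists K, forall t s x y, t \in `[0, T] -> s \in `[0, T] ->
    `|u t x - u s y| <= K * Num.sqrt `|(t, x) - (s, y)|).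

(* Solutions are functions of (t, x) whose values at t < 0 are irrelevant, and
   elements of C_c^oo([0,oo) x R) are restrictions of elements of
   C_c^oo(R x R).  Joint measurability of F is what makes the time integrals
   meaningful: it yields measurability in t of the integrals against m t.
   Only u is continuous in time: for t > 0 the equations see F t for almost
   every t only. *)
Definition conservative_solution (Finf : R) (u0 F0 : R -> R)
    (u F : R -> R -> R) : Prop :=
  [/\ u 0 =1 u0 /\ F 0 =1 F0,
      forall T, 0 <= T -> holder_half T u,
      forall t, 0 <= t -> inD Finf (u t) (F t),
      measurable_fun ([set z | 0 <= z.1] : set (R * R)) (fun z => F z.1 z.2) &
      exists m : R -> {finite_measure set (measurableTypeR R) -> \bar R},
        (forall t x, 0 <= t -> m t `]-oo, x[%classic = (F t x)%:E) /\
        (forall phi : R * R -> R, test_function setT phi ->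
          \int[mu]_(t in `[0, +oo[) (\int[mu]_x
              ('D_(1, 0) phi (t, x) * u t x
               + 2^-1 * 'D_(0, 1) phi (t, x) * u t x ^+ 2
               + phi (t, x) * (2^-1 * F t x - 4^-1 * Finf)))
            + \int[mu]_x (phi (0, x) * u0 x) = 0 /\
          \int[mu]_(t in `[0, +oo[) (\int[m t]_x
              ('D_(1, 0) phi (t, x) + u t x * 'D_(0, 1) phi (t, x)))
            + \int[m 0]_x phi (0, x) = 0)].

End HunterSaxton.

Section NumericalScheme.
Context {R : realType}.
Implicit Types (X Y : int -> R) (p : (R -> R) * (R -> R)).

(* The continuous function with value Y j at X j and affine on each
   [X j, X (j + 1)], for X strictly increasing and unbounded in both
   directions (j is then unique). *)
Definition interp X Y (x : R) : R :=
  let j := xget 0 [set j : int | X j <= x < X (j + 1)] in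
  Y j + (x - X j) / (X (j + 1) - X j) * (Y (j + 1) - Y j).

Definition node (dx : R) (j : int) : R := j%:~R * dx.

Definition proj (dx : R) p : (R -> R) * (R -> R) :=
  (interp (node dx) (p.1 \o node dx), interp (node dx) (p.2 \o node dx)).

Definition time_step (Finf dx : R) : R :=
  (2 * Num.sqrt Finf)^-1 * Num.sqrt dx.

Definition moved_node (Finf dx tau : R) p (j : int) : R :=
  let x := node dx j in
  x + p.1 x * tau + 4^-1 * (p.2 x - 2^-1 * Finf) * tau ^+ 2.

Definition evolve (Finf dx tau : R) p : (R -> R) * (R -> R) :=
  let X := moved_node Finf dx tau p in
  (interp X (fun j => p.1 (node dx j)
                      + 2^-1 * (p.2 (node dx j) - 2^-1 * Finf) * tau),
   interp X (p.2 \o node dx)).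

Definition grid_solution (Finf dx : R) (u0 F0 : R -> R) (n : nat) :=
  iter n (fun p => proj dx (evolve Finf dx (time_step Finf dx) p))
    (proj dx (u0, F0)).

Definition numerical_solution (Finf dx : R) (u0 F0 : R -> R) (t : R) :
    (R -> R) * (R -> R) :=
  let dt := time_step Finf dx in
  let n := Num.truncn (t / dt) in
  proj dx (evolve Finf dx (t - n%:R * dt) (grid_solution Finf dx u0 F0 n)).

End NumericalScheme.

(* Main.v *)
(* Along the characteristics X(t,y) = y + u0(y) t + (F0(y) - Finf/2) t^2 / 4 a smooth
   solution satisfies u = u0 + (F0 - Finf/2) t / 2 and F = F0.  The point is that
   every conservative solution does, as soon as one of them is Lipschitz in x.

   Suppose that |u - V| <= D exp(lam t) on the characteristics, V being the velocity
   of X.  Curves at distance A = (2/lam) D exp(lam t) on either side of a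
   characteristic are then not crossed by the flow, so that the transport equation
   for the measure shows F(t, X - A) <= F0(y) <= F(t, X + A) for almost every t.  By
   the inequality 2 lam (u(b) - u(a)) <= (b - a) + lam^2 (F(b) - F(a)), which
   expresses (u_x)^2 <= F_x, the oscillation of u near X is O(A).  Averaging the
   equation for u over a bump of width eps that moves with X gives an improved bound
   |u - V| <= (D/2) exp(lam t) if lam is large and eps = D exp(lam t) / sqrt(lam).
   Iterating, u = V.  This is applied first to the Lipschitz solution, then to any
   other one, which is compared with it.

   The Lipschitz solution is thus a semigroup of exactly the form used by the scheme,
   which is stable because x - 2 lam u + lam^2 F stays nondecreasing for all lam.
   Each step multiplies the nodal error by 1 + O(dt) and adds the O(dx)
   interpolation error; since dt is of order sqrt(dx), this yields O(sqrt(dx) + dx). *)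
From HB Require Import structures.
Require Import Defs.
From mathcomp Require Import all_boot all_order all_algebra.
From mathcomp Require Import all_classical all_reals all_analysis.
From mathcomp Require Import measurable_realfun ess_sup_inf.
From mathcomp Require Import ring lra.
Import Order.TTheory GRing.Theory Num.Theory.
Import numFieldNormedType.Exports.
Local Open Scope classical_set_scope.
Local Open Scope ring_scope.

(** * Smooth functions *)

Section Smooth.
Context {R : realType}.
Implicit Types V : normedModType R.

(** A competing conservative solution is only Hölder continuous of exponent 1/2 and its energy may
    concentrate, so [x' = u] need not have unique solutions and Gronwall's inequality cannot be
    applied to its flow. It is therefore compared with explicit curves computed from the data, and
    its own flow enters only through one-sided barriers. The weight [exp(lam t)] pays for the
    improvement: a velocity deviation [D exp(lam t)] integrates to a displacement of order
    [(D / lam) exp(lam t)], so a large [lam] wins, provided that it is chosen before [D]. Test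
    functions see the energy only at almost every time. Hence bumps in time and Lebesgue points,
    null sets that must be freed of their dependence on the space point, and continuity in time
    wherever a statement at every time is wanted. The constant may depend on the slopes only through
    [slope_bound]. The class W^{1,oo} first yields some uncontrolled Lipschitz constant, which
    serves to show that the slope bound is finite and that [F] has a weak derivative; the Lipschitz
    estimates are then redone with the slope bound. *)

Definition smooth {V} (f : V -> R) := forall n, class_C n f.

Lemma class_CW {V} n (f : V -> R) : class_C n.+1 f -> class_C n f.
Proof.
elim: n f => [|n IH] f [fc fD]; split => // v.
by have [fv fC] := fD v; split => //; exact: IH.
Qed.

Lemma smooth_cont {V} (f : V -> R) : smooth f -> continuous f.
Proof. by move=> /(_ 0%N) []. Qed.

Lemma smooth_derivable {V} (f : V -> R) x v : smooth f -> derivable f x v.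
Proof. by move=> /(_ 1%N) [_ /(_ v)] []. Qed.

Lemma smooth_D {V} (f : V -> R) v : smooth f -> smooth ('D_v f).
Proof. by move=> fs n; have [_ /(_ v) []] := fs n.+1. Qed.

Lemma class_C_cst {V} n (c : R) : class_C n (cst c : V -> R).
Proof.
elim: n c => [|n IH] c; split => //; try by move=> x; exact: cvg_cst.
move=> v; split; first by move=> x; exact: derivable_cst.
rewrite (_ : 'D_v _ = cst 0)//; apply/funext => x; exact: derive_cst.
Qed.

Lemma class_CD {V} n (f g : V -> R) :
  class_C n f -> class_C n g -> class_C n (fun x => f x + g x).
Proof.
elim: n f g => [|n IH] f g [fc fD] [gc gD];
  split; try by move=> x; apply: cvgD; [exact: fc|exact: gc].
  by [].
move=> v; have [fv fDv] := fD v; have [gv gDv] := gD v; split.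
  by move=> x; exact: derivableD.
rewrite (_ : 'D_v _ = fun x => 'D_v f x + 'D_v g x); first exact: IH.
by apply/funext => x; exact: deriveD.
Qed.

Lemma class_CM {V} n (f g : V -> R) :
  class_C n f -> class_C n g -> class_C n (fun x => f x * g x).
Proof.
elim: n f g => [|n IH] f g [fc fD] [gc gD];
  split; try by move=> x; apply: cvgM; [exact: fc|exact: gc].
  by [].
move=> v; have [fv fDv] := fD v; have [gv gDv] := gD v; split.
  by move=> x; exact: derivableM.
rewrite (_ : 'D_v _ = fun x => f x * 'D_v g x + g x * 'D_v f x).
  by apply: class_CD; apply: IH => //; apply: class_CW; split.
by apply/funext => x; exact: deriveM.
Qed.

(** Restriction to a line reduces directional derivatives on any normed space to derivatives on [R],
    where the chain rule [is_derive1_comp] applies. *)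
Lemma derivable_line {V} (f : V -> R) x v :
  derivable f x v -> is_derive (0 : R) 1 (fun h : R => f (h *: v + x)) ('D_v f x).
Proof.
move=> fv.
have E : (fun h : R => h^-1 *: (((fun h : R => f (h *: v + x)) \o shift 0) (h *: 1)
   - f (0 *: v + x))) = (fun h : R => h^-1 *: ((f \o shift x) (h *: v) - f x)).
  by apply/funext => h /=; rewrite scale0r add0r addr0 [h *: 1]mulr1.
by split; rewrite /derivable /derive E.
Qed.

Lemma is_derive_line {V} (f : V -> R) x v (l : R) :
  is_derive (0 : R) 1 (fun h : R => f (h *: v + x)) l -> is_derive x v f l.
Proof.
have E : (fun h : R => h^-1 *: (((fun h : R => f (h *: v + x)) \o shift 0) (h *: 1)
   - f (0 *: v + x))) = (fun h : R => h^-1 *: ((f \o shift x) (h *: v) - f x)).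
  by apply/funext => h /=; rewrite scale0r add0r addr0 [h *: 1]mulr1.
by move=> [H1 H2]; split; [move: H1|move: H2]; rewrite /derivable /derive E.
Qed.

Lemma is_derive_comp {V} (g : R -> R) (f : V -> R) x v :
  derivable f x v -> derivable g (f x) 1 ->
  is_derive x v (g \o f) ('D_1 g (f x) * 'D_v f x).
Proof.
move=> fv gv; apply: is_derive_line.
have := @derivable_line _ f x v fv.
have : f (0 *: v + x) = f x by rewrite scale0r add0r.
move: ('D_v f x) => l; rewrite /comp.
pose F := fun h : R => f (h *: v + x).
rewrite -[f (0 *: v + x)]/(F 0) -/F -[fun h : R => g _]/(g \o F).
move: F => F E H.
have Hg : is_derive (F 0) 1 g ('D_1 g (f x)) by rewrite E; exact: derivableP.
exact: (@is_derive1_comp R g F 0 _ _ Hg H).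
Qed.

Lemma class_C_comp {V} n (g : R -> R) (f : V -> R) :
  class_C n g -> class_C n f -> class_C n (g \o f).
Proof.
elim: n g f => [|n IH] g f [gc gD] [fc fD];
  split; try by move=> x; apply: continuous_comp; [exact: fc|exact: gc].
  by [].
move=> v; have [fv fDv] := fD v; have [gv gDv] := gD 1.
have H x := @is_derive_comp _ g f x v (fv x) (gv (f x)).
split; first by move=> x; case: (H x).
rewrite (_ : 'D_v _ = fun x => ('D_1 g \o f) x * 'D_v f x).
  by apply: class_CM => //; apply: IH => //; apply: class_CW; split.
by apply/funext => x; case: (H x).
Qed.

Lemma smooth_cst {V} (c : R) : smooth (fun _ : V => c).
Proof. by move=> n; exact: class_C_cst. Qed.

Lemma smoothD {V} (f g : V -> R) :
  smooth f -> smooth g -> smooth (fun x => f x + g x).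
Proof. by move=> ? ? n; exact: class_CD. Qed.

Lemma smoothM {V} (f g : V -> R) :
  smooth f -> smooth g -> smooth (fun x => f x * g x).
Proof. by move=> ? ? n; exact: class_CM. Qed.

Lemma smoothN {V} (f : V -> R) : smooth f -> smooth (fun x => - f x).
Proof.
move=> fs; rewrite (_ : (fun _ => _) = fun x => -1 * f x).
  by apply: smoothM => //; exact: smooth_cst.
by apply/funext => x; rewrite mulN1r.
Qed.

Lemma smoothB {V} (f g : V -> R) :
  smooth f -> smooth g -> smooth (fun x => f x - g x).
Proof. by move=> ? ?; apply: smoothD => //; exact: smoothN. Qed.

Lemma smooth_comp {V} (g : R -> R) (f : V -> R) :
  smooth g -> smooth f -> smooth (fun x => g (f x)).
Proof. by move=> ? ? n; exact: class_C_comp. Qed.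

Lemma smooth_id : smooth (fun x : R => x).
Proof.
case=> [|n]; split=> //; try by move=> x; exact: cvg_id.
move=> v; split; first by move=> x; exact: derivable_id.
rewrite (_ : 'D_v _ = cst v); first exact: class_C_cst.
by apply/funext => x; exact: derive_id.
Qed.

Lemma is_derive_fst (z v : R * R) : is_derive z v fst v.1.
Proof.
apply: is_derive_line.
rewrite (_ : (fun _ => _) = (fun h : R => h * v.1 + z.1))//.
apply: is_derive_eq. by rewrite scaler0 add0r addr0 [_%:A]mulr1.
Qed.

Lemma is_derive_snd (z v : R * R) : is_derive z v snd v.2.
Proof.
apply: is_derive_line.
rewrite (_ : (fun _ => _) = (fun h : R => h * v.2 + z.2))//.
apply: is_derive_eq. by rewrite scaler0 add0r addr0 [_%:A]mulr1.
Qed.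

Lemma smooth_fst : smooth (fun z : R * R => z.1).
Proof.
case=> [|n]; split=> //; try by move=> x; exact: cvg_fst.
move=> v; split; first by move=> x; case: (is_derive_fst x v).
rewrite (_ : 'D_v _ = cst v.1); first exact: class_C_cst.
by apply/funext => x; case: (is_derive_fst x v).
Qed.

Lemma smooth_snd : smooth (fun z : R * R => z.2).
Proof.
case=> [|n]; split=> //; try by move=> x; exact: cvg_snd.
move=> v; split; first by move=> x; case: (is_derive_snd x v).
rewrite (_ : 'D_v _ = cst v.2); first exact: class_C_cst.
by apply/funext => x; case: (is_derive_snd x v).
Qed.

Lemma derive_scale (f : R -> R) (x v : R) : derivable f x 1 -> is_derive x v f (v * 'D_1 f x).
Proof.
move=> fx; have := @is_derive_comp _ f id x v (@derivable_id _ _ x v) fx.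
by rewrite derive_id mulrC.
Qed.

(** Induction on the order of differentiability, run on all members of a family at once: the
    derivative of one member may involve other members, as for [flat_exp], or the function itself,
    as for [expR] and inverses. *)
Lemma smooth_coind (I : Type) (f : I -> R -> R) (d : I -> R -> R) :
  (forall i (x : R), is_derive x 1 (f i) (d i x)) ->
  (forall n, (forall i, class_C n (f i)) -> forall i, class_C n (d i)) ->
  forall i, smooth (f i).
Proof.
move=> fd dC i n; elim: n i => [|n IH] i; split => //;
  try (by move=> x; apply: differentiable_continuous; apply/derivable1_diffP;
  case: (fd i x)).
have H v x : is_derive x v (f i) (v * d i x).
  by case: (fd i x) => + <-; exact: derive_scale.
move=> v; split; first by move=> x; case: (H v x).
rewrite (_ : 'D_v _ = fun x => v * d i x).
  by apply: class_CM; [exact: class_C_cst|exact: dC].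
by apply/funext => x; case: (H v x).
Qed.

Lemma smooth_expR : smooth (@expR R).
Proof.
apply: (@smooth_coind unit (fun _ => expR) (fun _ => expR)) => //.
Qed.

Lemma smoothV (f : R -> R) : smooth f -> (forall x, f x != 0) ->
  smooth (fun x => (f x)^-1).
Proof.
move=> fs f0.
have H (x : R) : is_derive x 1 (fun x => (f x)^-1) (- (f x) ^- 2 * 'D_1 f x).
  have /derivableP H := @smooth_derivable _ f x 1 fs.
  split; first exact: derivableV.
  by rewrite deriveV// -?exprVn//; exact: smooth_derivable.
apply: (@smooth_coind unit (fun _ x => (f x)^-1) (fun _ x => - ((f x)^-1 * (f x)^-1) * 'D_1 f x) _ _ tt).
  by move=> _ x; rewrite -expr2 exprVn.
move=> n /(_ tt) IH _; apply: class_CM; last exact: smooth_D.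
rewrite (_ : (fun _ => _) = fun x => -1 * ((f x)^-1 * (f x)^-1)).
  by apply: class_CM; [exact: class_C_cst|exact: class_CM].
by apply/funext => x; rewrite mulN1r.
Qed.

End Smooth.

(** * A smooth step *)

Section Step.
Context {R : realType}.

(** The functions [x^-n exp(-1/x)] extended by 0. Up to linear combinations the family contains all
    derivatives of its member [n = 0], the classical flat function. *)
Definition flat_exp (n : nat) (x : R) : R :=
  if 0 < x then x^-1 ^+ n * expR (- x^-1) else 0.

Lemma flat_exp_ge0 n x : 0 <= flat_exp n x.
Proof.
rewrite /flat_exp; case: ifPn => // x0.
by rewrite mulr_ge0 ?expR_ge0// exprn_ge0// invr_ge0 ltW.
Qed.

(** From [exp y >= (y / (n+1))^(n+1)] at [y = 1/x]. A bound linear in [x] suffices for the limit 0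
    at the origin, for every [n]. *)
Lemma flat_exp_le n x : 0 < x -> flat_exp n x <= n.+1%:R ^+ n.+1 * x.
Proof.
move=> x0; rewrite /flat_exp x0 expRN ler_pdivrMr ?expR_gt0//.
have -> : expR x^-1 = expR (x^-1 / n.+1%:R) ^+ n.+1.
  by rewrite -expRM_natl mulrC divfK.
apply: (@le_trans _ _ (n.+1%:R ^+ n.+1 * x * (x^-1 / n.+1%:R) ^+ n.+1)).
  have : (n.+1%:R ^+ n.+1 : R) != 0 by rewrite expf_neq0.
  rewrite expr_div_n; move: (_ ^+ n.+1 : R) => b b0.
  rewrite le_eqVlt; apply/orP; left; apply/eqP.
  by rewrite exprS; move: (x^-1 ^+ n) => c; field; rewrite b0 gt_eqF.
have x1 : 0 <= x^-1 / n.+1%:R by rewrite divr_ge0// invr_ge0 ltW.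
apply: ler_wpM2l; first by rewrite mulr_ge0 ?exprn_ge0 ?ltW.
rewrite lerXn2r ?nnegrE ?expR_ge0//.
by apply: le_trans (expR_ge1Dx _); rewrite lerDr.
Qed.

Lemma flat_exp_cvg0 n : flat_exp n x @[x --> 0] --> 0.
Proof.
apply/cvgr0Pnorm_le => e e0.
have k0 : 0 < n.+1%:R ^+ n.+1 :> R by rewrite exprn_gt0.
near=> x; rewrite ger0_norm ?flat_exp_ge0//.
have [x0|x0] := ltP 0 x; last by rewrite /flat_exp ltNge x0/= ltW.
apply: le_trans (flat_exp_le n _ x0) _; rewrite -ler_pdivlMl// mulrC.
apply: le_trans (ler_norm _) _; near: x.
exists (e / n.+1%:R ^+ n.+1); first by rewrite /= divr_gt0.
by move=> y; rewrite /= sub0r normrN => /ltW.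
Unshelve. all: by end_near. Qed.

Lemma is_derive_flat_exp n (x : R) :
  is_derive x 1 (flat_exp n) (flat_exp n.+2 x - n%:R * flat_exp n.+1 x).
Proof.
have [x0|x0|->] := ltgtP x 0.
- rewrite {2 3}/flat_exp !ifF ?mulr0 ?subr0 ?(lt_gtF x0)//.
  apply: (near_eq_is_derive _ (is_derive_cst (0 : R) x 1)).
  by near=> y; rewrite /flat_exp ifF//; apply: lt_gtF; near: y; exact: lt_nbhsl.
- rewrite {2 3}/flat_exp x0.
  apply: (@near_eq_is_derive _ _ _ (fun y : R => y^-1 ^+ n * expR (- y^-1))).
    by near=> y; rewrite /flat_exp ifT//; near: y; exact: lt_nbhsr.
  have x1 : x != 0 by rewrite gt_eqF.
  have dV : is_derive x 1 (fun y : R => y^-1) (- x ^- 2).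
    have := @is_deriveV R id x 1 1 x1 (is_derive_id x 1).
    by rewrite [_ *: _]mulr1.
  have dE : is_derive x 1 (fun y : R => expR (- y^-1)) (expR (- x^-1) * x ^- 2).
    apply: (@is_derive1_comp R expR (fun y => - y^-1)) => //.
    by rewrite -[x ^- 2]opprK; exact: is_deriveN.
  have dX := @is_deriveX R _ (fun y : R => y^-1) n x 1 _ dV.
  have -> : (fun y : R => y^-1 ^+ n * expR (- y^-1)) =
      (fun y : R => y^-1) ^+ n * (fun y => expR (- y^-1)).
    by apply/funext => y; rewrite mulrfctE exprfctE.
  apply: (is_derive_eq (is_deriveM dX dE)).
  rewrite -![_ *: _]/(_ * _) !exprfctE /=.
  case: n {dX} => [|n]; rewrite /= ?expr0 ?mul0r ?mulr0 ?subr0 ?addr0 !exprS ?expr0 ?mulr1.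
    by field.
  set e := expR _; set p := _ ^+ n; by field.
(* At the origin the difference quotient of [flat_exp n] is [flat_exp n.+1], which tends to 0. *)
- rewrite {2 3}/flat_exp ltxx mulr0 subr0.
  suff H : (fun h : R => h^-1 *: ((flat_exp n \o shift 0) (h *: 1) - flat_exp n 0))
      @ 0^' --> (0 : R).
    split; first by apply/cvg_ex; exists 0.
    exact: cvg_lim H.
  have -> : (fun h : R => h^-1 *: ((flat_exp n \o shift 0) (h *: 1) - flat_exp n 0))
      = flat_exp n.+1.
    apply/funext => h /=; rewrite addr0 [h%:A]mulr1 {2}/flat_exp ltxx subr0.
    rewrite /flat_exp; case: ifPn => _; last by rewrite scaler0.
    by rewrite -[_ *: _]/(_ * _) mulrA exprS.
  exact: cvg_within_filter (flat_exp_cvg0 n.+1).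
Unshelve. all: by end_near. Qed.

Lemma smooth_flat_exp n : smooth (flat_exp n).
Proof.
apply: (@smooth_coind R nat flat_exp
  (fun n x => flat_exp n.+2 x - n%:R * flat_exp n.+1 x)).
  by move=> i x; exact: is_derive_flat_exp.
move=> m IH i; apply: class_CD => //.
rewrite (_ : (fun _ => _) = fun x => - i%:R * flat_exp i.+1 x).
  by apply: class_CM => //; exact: class_C_cst.
by apply/funext => x; rewrite mulNr.
Qed.

Definition step_den (x : R) := flat_exp 0 x + flat_exp 0 (1 - x).

Lemma step_den_gt0 x : 0 < step_den x.
Proof.
have H y : 0 < y -> 0 < flat_exp 0 y.
  by move=> y0; rewrite /flat_exp y0 expr0 mul1r expR_gt0.
have [x0|x0] := ltP 0 x.
  by apply: ltr_pwDl; [exact: H|exact: flat_exp_ge0].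
by apply: ltr_wpDl; [exact: flat_exp_ge0|apply: H; lra].
Qed.

(* Locked, as are its derivatives: conversion must not unfold it. *)
Definition step : R -> R := locked (fun x => flat_exp 0 x * (step_den x)^-1).

Lemma stepE x : step x = flat_exp 0 x * (step_den x)^-1.
Proof. by rewrite /step -lock. Qed.

Lemma smooth_affine (a b : R) : smooth (fun x : R => a * x + b).
Proof.
apply: smoothD; last exact: smooth_cst.
by apply: smoothM; [exact: smooth_cst|exact: smooth_id].
Qed.

Lemma smooth_step : smooth step.
Proof.
rewrite (_ : step = fun x => flat_exp 0 x * (step_den x)^-1); last first.
  by apply/funext => x; exact: stepE.
apply: smoothM; first exact: smooth_flat_exp.
apply: smoothV; last by move=> x; rewrite gt_eqF// step_den_gt0.
apply: smoothD; first exact: smooth_flat_exp.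
apply: (@smooth_comp R _ (flat_exp 0) (fun x : R => 1 - x)).
  exact: smooth_flat_exp.
by apply: smoothB; [exact: smooth_cst|exact: smooth_id].
Qed.

Lemma step0 x : x <= 0 -> step x = 0.
Proof. by move=> x0; rewrite stepE {1}/flat_exp ltNge x0 /= mul0r. Qed.

Lemma step1 x : 1 <= x -> step x = 1.
Proof.
move=> x1; have -> : step x = flat_exp 0 x / flat_exp 0 x.
  rewrite stepE /step_den [flat_exp 0 (1 - x)]/flat_exp ifF ?addr0//.
  by apply/negbTE; rewrite -leNgt; lra.
by rewrite divff// /flat_exp ifT ?expr0 ?mul1r ?expR_eq0// ?gt_eqF ?expR_gt0//; lra.
Qed.

Lemma step_ge0 x : 0 <= step x.
Proof. by rewrite stepE mulr_ge0 ?flat_exp_ge0// invr_ge0 ltW// step_den_gt0. Qed.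

Lemma step_le1 x : step x <= 1.
Proof. by rewrite stepE ler_pdivrMr ?step_den_gt0// mul1r lerDl flat_exp_ge0. Qed.

Lemma flat_exp_homo : {homo flat_exp 0 : x y / x <= y}.
Proof.
move=> x y xy; rewrite /flat_exp; case: ifPn => x0; last first.
  by case: ifPn => // y0; rewrite expr0 mul1r expR_ge0.
by rewrite (lt_le_trans x0 xy) !expr0 !mul1r ler_expR lerN2 lef_pV2// posrE (lt_le_trans x0 xy).
Qed.

Lemma step_homo : {homo step : x y / x <= y}.
Proof.
move=> x y xy; rewrite !stepE ler_pdivrMr ?step_den_gt0// mulrAC.
rewrite ler_pdivlMr ?step_den_gt0// /step_den !mulrDr.
rewrite [flat_exp 0 x * flat_exp 0 y]mulrC lerD2l.
by apply: ler_pM; rewrite ?flat_exp_ge0 ?flat_exp_homo//; lra.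
Qed.

(** A smooth bump supported in [[0, 1]]. Being the derivative of a step from 0 to 1, it has integral
    1 without normalisation. *)
Definition hump : R -> R := locked ('D_1 step).

Lemma humpE : hump = 'D_1 step. Proof. by rewrite /hump -lock. Qed.

Lemma is_derive_step (x : R) : is_derive x 1 step (hump x).
Proof. rewrite humpE; apply: derivableP; exact: smooth_derivable smooth_step. Qed.

Lemma smooth_hump : smooth hump. Proof. rewrite humpE; exact: smooth_D smooth_step. Qed.

Lemma derive_homo_ge0 (f : R -> R) x : derivable f x 1 ->
  {homo f : x y / x <= y} -> 0 <= 'D_1 f x.
Proof.
move=> fx fh; apply: limr_ge; first exact: fx.
near=> h; rewrite -[_ *: _]/(_ * _) /= [h%:A]mulr1.
have [h0|h0|->] := ltgtP h 0; last by rewrite invr0 mul0r.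
  by rewrite nmulr_rge0 ?invr_lt0// subr_le0 fh// gerDr ltW.
by apply: mulr_ge0; [rewrite invr_ge0 ltW|rewrite subr_ge0 fh// lerDr ltW].
Unshelve. all: by end_near. Qed.

Lemma hump_ge0 x : 0 <= hump x.
Proof.
rewrite humpE; apply: derive_homo_ge0; first exact: smooth_derivable smooth_step.
exact: step_homo.
Qed.

Lemma hump_out x : x < 0 \/ 1 < x -> hump x = 0.
Proof.
move=> x01; rewrite humpE; suff : is_derive x 1 step 0 by case.
have [c Hc] : exists c, \near x, (cst c : R -> R) x = step x.
  case: x01 => x01.
    by exists 0; near=> y; rewrite step0// ltW//; near: y; exact: lt_nbhsl.
  by exists 1; near=> y; rewrite step1// ltW//; near: y; exact: lt_nbhsr.
exact: near_eq_is_derive Hc (is_derive_cst c x 1).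
Unshelve. all: by end_near. Qed.

Definition dhump : R -> R := locked ('D_1 hump).

Lemma dhumpE : dhump = 'D_1 hump. Proof. by rewrite /dhump -lock. Qed.

Lemma smooth_dhump : smooth dhump. Proof. rewrite dhumpE; exact: smooth_D smooth_hump. Qed.

Lemma is_derive_hump (x : R) : is_derive x 1 hump (dhump x).
Proof. rewrite dhumpE; apply: derivableP; exact: smooth_derivable smooth_hump. Qed.

Lemma dhump_out x : x < 0 \/ 1 < x -> dhump x = 0.
Proof.
move=> x01; rewrite dhumpE; suff : is_derive x 1 hump 0 by case.
have Hc : \near x, (cst 0 : R -> R) x = hump x.
  by case: x01 => x01; near=> y; rewrite hump_out//; [left|right]; near: y;
    [exact: lt_nbhsl|exact: lt_nbhsr].
exact: near_eq_is_derive Hc (is_derive_cst 0 x 1).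
Unshelve. all: by end_near. Qed.

Lemma hump_bounds : exists2 K : R, 0 < K & forall x, hump x <= K /\ `|dhump x| <= K.
Proof.
have [c _ Hc] : exists2 c, c \in `[0, 1]%R & forall t, t \in `[0, 1]%R -> hump t <= hump c.
  apply: EVT_max => //; apply: continuous_subspaceT.
  by move=> x; exact: smooth_cont smooth_hump _.
have [d _ Hd] : exists2 c, c \in `[0, 1]%R &
    forall t, t \in `[0, 1]%R -> `|dhump t| <= `|dhump c|.
  apply: (@EVT_max _ (fun x => `|dhump x|)) => //; apply: continuous_subspaceT.
  by move=> x; apply: continuous_comp; [exact: smooth_cont smooth_dhump _|exact: norm_continuous].
exists (hump c + `|dhump d| + 1); first by rewrite ltr_wpDl// addr_ge0// hump_ge0.
move=> x; have [x01|] := boolP (x \in `[0, 1]%R).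
  have := Hc _ x01; have := Hd _ x01; have := hump_ge0 c; have := normr_ge0 (dhump d).
  by move=> *; split; lra.
rewrite in_itv/= negb_and -!ltNge => /orP x01.
rewrite (hump_out _ x01) (dhump_out _ x01) normr0; have := hump_ge0 c.
by have := normr_ge0 (dhump d) => *; split; lra.
Qed.

End Step.

(** * Integrals of compactly supported functions and rescaled bumps *)

Section Integrals.
Context {R : realType}.
Local Notation mu := (@lebesgue_measure R).

Lemma Rintegral_supp (D : set R) (f : R -> R) :
  (forall x, ~ D x -> f x = 0) -> \int[mu]_x f x = \int[mu]_(x in D) f x.
Proof.
move=> f0; rewrite [RHS]Rintegral_mkcond; apply: eq_Rintegral => x _.
by rewrite patchE; case: ifPn => // /negP; rewrite inE => /f0.
Qed.

Lemma integrable_supp (D : set R) (f : R -> R) : measurable D ->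
  (forall x, ~ D x -> f x = 0) -> mu.-integrable D (EFin \o f) ->
  mu.-integrable setT (EFin \o f).
Proof.
move=> mD f0 If; have := (@integrable_mkcond _ (measurableTypeR R) R mu D (EFin \o f) mD).1 If; congr (mu.-integrable _ _).
apply/funext => x; rewrite patchE; case: ifPn => // /negP; rewrite inE => /f0 /= ->.
by [].
Qed.

Lemma bounded_integrable d (S : measurableType d) (m : {measure set S -> \bar R}) (D : set S)
    (f : S -> R) C : measurable D -> (m D < +oo)%E -> measurable_fun D f ->
  (forall x, `|f x| <= C) -> m.-integrable D (EFin \o f).
Proof.
move=> mD mDy mf fC; apply: measurable_bounded_integrable => //.
by exists C; split; [exact: num_real|move=> y Cy z _; exact: le_trans (fC z) (ltW Cy)].
Qed.

Lemma is_derive_continuous (f df : R -> R) :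
  (forall x : R, is_derive x 1 f (df x)) -> continuous f.
Proof.
by move=> dF x; apply: differentiable_continuous; apply/derivable1_diffP; case: (dF x).
Qed.

Lemma integrable_bounded_itv (a b C : R) (f : R -> R) :
  measurable_fun setT f -> (forall x, `|f x| <= C) ->
  mu.-integrable `[a, b] (EFin \o f).
Proof.
move=> mf fC; apply: (bounded_integrable _ _ _ _ _ C) => //.
  by rewrite /= lebesgue_measure_itv/= ; case: ifPn => // _; rewrite ltry.
exact: (@measurable_funS _ _ (measurableTypeR R) R setT).
Qed.

Lemma integrable_bounded_supp (a b C : R) (f : R -> R) :
  measurable_fun setT f -> (forall x, `|f x| <= C) ->
  (forall x, ~ `[a, b]%classic x -> f x = 0) ->
  mu.-integrable setT (EFin \o f).
Proof.
by move=> mf fC f0; apply: (@integrable_supp `[a, b]) => //; exact: integrable_bounded_itv mf fC.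
Qed.

Lemma le_Rintegral_supp (a b C : R) (f : R -> R) : a <= b ->
  measurable_fun setT f -> (forall x, `|f x| <= C) ->
  (forall x, ~ `[a, b]%classic x -> f x = 0) ->
  `|\int[mu]_x f x| <= C * (b - a).
Proof.
move=> ab mf fC f0.
have If := @integrable_bounded_itv a b C f mf fC.
rewrite (@Rintegral_supp `[a, b])//.
apply: le_trans (le_normr_Rintegral _ If) _ => //.
have -> : C * (b - a) = \int[mu]_(x in `[a, b]) C.
  rewrite Rintegral_cst//= lebesgue_measure_itv/=; congr (_ * _).
  rewrite lte_fin; case: ltP => //= ba.
  by apply/eqP; rewrite subr_eq0 eq_le ab ba.
apply: le_Rintegral => //; first exact: integrable_norm.
by apply: (@integrable_bounded_itv _ _ `|C| (cst C)) => //; move=> x /=.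
Qed.

Lemma FTC_supp (F f : R -> R) (a b : R) : a < b ->
  (forall x : R, is_derive x 1 F (f x)) -> continuous f ->
  (forall x, ~ `[a, b]%classic x -> f x = 0) ->
  \int[mu]_x f x = F b - F a.
Proof.
move=> ab dF cf f0; rewrite (@Rintegral_supp `[a, b])//.
have cF := is_derive_continuous _ _ dF.
rewrite /Rintegral (@continuous_FTC2 _ f F)//.
- exact: continuous_subspaceT.
- split; first by move=> x _; case: (dF x).
    by apply: cvg_at_right_filter; exact: cF.
  by apply: cvg_at_left_filter; exact: cF.
- by move=> x _; rewrite derive1E; case: (dF x).
Qed.

(** One-sided kernels, varying on [[c, c + e]] only. The argument is kept in the shape [a * x + b]
    of [is_derive_affine_comp]. *)
Definition step_at (e c x : R) := step (e^-1 * x - e^-1 * c).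
Definition hump_at (e c x : R) := e^-1 * hump (e^-1 * x - e^-1 * c).
Definition dhump_at (e c x : R) := e^-1 * (e^-1 * dhump (e^-1 * x - e^-1 * c)).

Lemma is_derive_affine_comp (f : R -> R) (df a b x : R) :
  is_derive (a * x + b) 1 f df -> is_derive x 1 (fun x => f (a * x + b)) (a * df).
Proof.
move=> H.
have A : is_derive x 1 (fun x => a * x + b) a.
  have -> : (fun x : R => a * x + b) = (a \*: (id : R -> R)) \+ cst b by apply/funext.
  apply: (is_derive_eq (is_deriveD (is_deriveZ _ (is_derive_id _ _)) (is_derive_cst _ _ _))).
  by rewrite addr0 [_%:A]mulr1.
by rewrite mulrC; apply: (@is_derive1_comp R f (fun x => a * x + b) x _ _ H A).
Qed.

Lemma is_derive_step_at (e c x : R) : is_derive x 1 (step_at e c) (hump_at e c x).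
Proof. exact: is_derive_affine_comp (is_derive_step _). Qed.

Lemma is_derive_hump_at (e c x : R) : is_derive x 1 (hump_at e c) (dhump_at e c x).
Proof.
have H : is_derive x 1 (fun x => hump (e^-1 * x - e^-1 * c)) (e^-1 * dhump (e^-1 * x - e^-1 * c)).
  exact: is_derive_affine_comp (is_derive_hump _).
exact: (is_derive_eq (is_deriveZ e^-1 H)).
Qed.

Lemma smooth_step_at (e c : R) : smooth (step_at e c).
Proof. exact: smooth_comp smooth_step (smooth_affine _ _). Qed.

Lemma smooth_hump_at (e c : R) : smooth (hump_at e c).
Proof.
by apply: smoothM; [exact: smooth_cst|exact: smooth_comp smooth_hump (smooth_affine _ _)].
Qed.

Lemma smooth_dhump_at (e c : R) : smooth (dhump_at e c).
Proof.
apply: smoothM; first exact: smooth_cst.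
by apply: smoothM; [exact: smooth_cst|exact: smooth_comp smooth_dhump (smooth_affine _ _)].
Qed.

Lemma hump_at_ge0 (e c x : R) : 0 < e -> 0 <= hump_at e c x.
Proof. by move=> e0; rewrite mulr_ge0 ?hump_ge0// invr_ge0 ltW. Qed.

Lemma at_out (e c x : R) : 0 < e -> ~ `[c, c + e]%classic x ->
  e^-1 * x - e^-1 * c < 0 \/ 1 < e^-1 * x - e^-1 * c.
Proof.
move=> e0 /negP; rewrite /= in_itv/= negb_and -!ltNge -mulrBr => /orP[xc|xc]; [left|right].
  by rewrite pmulr_rlt0 ?invr_gt0// subr_lt0.
by rewrite -(mulVf (lt0r_neq0 e0)) ltr_pM2l ?invr_gt0//; lra.
Qed.

Lemma hump_at_out (e c x : R) : 0 < e -> ~ `[c, c + e]%classic x -> hump_at e c x = 0.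
Proof. by move=> e0 /(@at_out e c x e0) H; rewrite /hump_at (hump_out _ H) mulr0. Qed.

Lemma dhump_at_out (e c x : R) : 0 < e -> ~ `[c, c + e]%classic x -> dhump_at e c x = 0.
Proof. by move=> e0 /(@at_out e c x e0) H; rewrite /dhump_at (dhump_out _ H) !mulr0. Qed.

Lemma step_at0 (e c x : R) : 0 < e -> x <= c -> step_at e c x = 0.
Proof. by move=> e0 xc; rewrite /step_at step0// -mulrBr pmulr_rle0 ?invr_gt0// subr_le0. Qed.

Lemma step_at1 (e c x : R) : 0 < e -> c + e <= x -> step_at e c x = 1.
Proof.
move=> e0 xc; rewrite /step_at step1// -mulrBr -(mulVf (lt0r_neq0 e0)).
by rewrite ler_pM2l ?invr_gt0//; lra.
Qed.

Lemma step_at_ge0 (e c x : R) : 0 <= step_at e c x.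
Proof. exact: step_ge0. Qed.

Lemma step_at_le1 (e c x : R) : step_at e c x <= 1.
Proof. exact: step_le1. Qed.

Lemma int_hump_at (e c : R) : 0 < e -> \int[mu]_x hump_at e c x = 1.
Proof.
move=> e0; rewrite (@FTC_supp _ _ c (c + e) _ (is_derive_step_at e c)).
- by rewrite step_at1// step_at0// subr0.
- by rewrite ltrDl.
- exact: smooth_cont (smooth_hump_at _ _).
- by move=> x; exact: hump_at_out.
Qed.

Lemma int_dhump_at (e c : R) : 0 < e -> \int[mu]_x dhump_at e c x = 0.
Proof.
move=> e0; rewrite (@FTC_supp _ _ (c - 1) (c + e + 1) _ (is_derive_hump_at e c)).
- by rewrite !hump_at_out ?subrr//= in_itv/= => /andP[]; lra.
- lra.
- exact: smooth_cont (smooth_dhump_at _ _).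
- move=> x H; apply: dhump_at_out => // H'; apply: H; move: H'.
  by rewrite /= !in_itv/= => /andP[? ?]; apply/andP; lra.
Qed.

(** One constant for all widths and positions: the width is later tuned to the size of the deviation
    being estimated. *)
Lemma hump_at_bound : exists2 K : R, 0 < K &
  forall e c x, 0 < e -> `|hump_at e c x| <= K * e^-1 /\ `|dhump_at e c x| <= K * e^-1 * e^-1.
Proof.
have [K K0 HK] := @hump_bounds R; exists K => // e c x e0.
have [H1 H2] := HK (e^-1 * x - e^-1 * c).
have i0 : 0 <= e^-1 by rewrite invr_ge0 ltW.
split; first by rewrite ger0_norm ?hump_at_ge0// /hump_at mulrC ler_wpM2r.
by rewrite /dhump_at !normrM (ger0_norm i0) mulrC [e^-1 * _]mulrC !ler_wpM2r.
Qed.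

End Integrals.

(** * Weak derivatives *)

Section WeakDer.
Context {R : realType}.
Local Notation mu := (@lebesgue_measure R).

Lemma ae_imp d (T : measurableType d) (m : {measure set T -> \bar R}) (P Q : T -> Prop) :
  {ae m, forall x, P x} -> (forall x, P x -> Q x) -> {ae m, forall x, Q x}.
Proof. by move=> aP PQ; exact: filterS aP. Qed.

Lemma ae_imp2 d (T : measurableType d) (m : {measure set T -> \bar R})
    (P1 P2 Q : T -> Prop) :
  {ae m, forall x, P1 x} -> {ae m, forall x, P2 x} ->
  (forall x, P1 x -> P2 x -> Q x) -> {ae m, forall x, Q x}.
Proof. by move=> a1 a2 PQ; exact: filterS2 a1 a2. Qed.

Lemma continuous_measurable (f : R -> R) : continuous f -> measurable_fun setT f.
Proof. exact: continuous_measurable_fun. Qed.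

Lemma smooth_measurable (f : R -> R) : smooth f -> measurable_fun setT f.
Proof. by move=> fs; apply: continuous_measurable; exact: smooth_cont. Qed.

Lemma itv_compact (a b : R) : compact `[a, b]%classic.
Proof. exact: segment_compact. Qed.

Lemma continuous_bounded_itv (f : R -> R) a b : continuous f ->
  exists2 C, 0 <= C & forall t, `[a, b]%classic t -> `|f t| <= C.
Proof.
move=> cf; have [C [_ HC]] := compact_bounded (continuous_compact
  (continuous_subspaceT cf) (@itv_compact a b)).
exists (`|C| + 1) => [|t tab]; first by rewrite addr_ge0.
by apply: (HC (`|C| + 1)); [rewrite (le_lt_trans (ler_norm _))// ltrDl|exists t].
Qed.

Lemma bounded_loc_integrable (f : R -> R) C : measurable_fun setT (f : measurableTypeR R -> R) ->
  (forall x, `|f x| <= C) -> locally_integrable setT f.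
Proof.
move=> mf fC; split; [exact: mf|exact: openT|move=> A _ cA].
have : mu.-integrable A (EFin \o f).
  apply: (bounded_integrable _ _ _ _ _ C) => //.
  - exact: compact_measurable.
  - exact: compact_finite_measure.
  - exact: (@measurable_funS _ _ (measurableTypeR R) R setT _ _ _ _ mf).
by move=> /integrableP[].
Qed.

Lemma derive_out_supp {V : normedModType R} (f : V -> R) x w : ~ supp f x -> 'D_w f x = 0.
Proof.
move=> H; suff : is_derive x w f 0 by case.
have oN : open (~` supp f) by rewrite openC; exact: closed_closure.
have Hc : \near x, (cst 0 : V -> R) x = f x.
  near=> y; have Hy : (~` supp f) y by near: y; apply: open_nbhs_nbhs; split.
  by apply/esym/eqP; apply: contra_notT Hy => H'; exact: subset_closure.
exact: near_eq_is_derive Hc (is_derive_cst 0 x w).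
Unshelve. all: by end_near. Qed.

Lemma loc_integrable_itv (g : R -> R) (a b : R) : locally_integrable setT g ->
  mu.-integrable `[a, b] (EFin \o g).
Proof.
move=> [mg _ gi]; apply/integrableP; split.
  by apply/measurable_EFinP; exact: (@measurable_funS _ _ (measurableTypeR R) R setT).
by apply: gi => //; exact: itv_compact.
Qed.

Lemma continuous_loc_integrable (f : R -> R) : continuous f -> locally_integrable setT f.
Proof.
move=> cf; split; [exact: continuous_measurable|exact: openT|move=> K _ cK].
have : mu.-integrable K (EFin \o f).
  by apply: continuous_compact_integrable => //; exact: continuous_subspaceT.
by move=> /integrableP[].
Qed.

Lemma loc_integrableM (g phi : R -> R) (a b C : R) : locally_integrable setT g ->
  measurable_fun setT phi -> (forall x, `|phi x| <= C) ->
  (forall x, ~ `[a, b]%classic x -> phi x = 0) ->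
  mu.-integrable setT (EFin \o (fun x => g x * phi x)).
Proof.
move=> gl mphi phiC phi0; apply: (@integrable_supp _ `[a, b]) => //.
  by move=> x /phi0 ->; rewrite mulr0.
have gi := @loc_integrable_itv g a b gl.
have Cg : mu.-integrable `[a, b] (EFin \o (fun x => C * g x)).
  exact: (@integrableZl _ (measurableTypeR R) R mu `[a, b] _ C (EFin \o g)).
apply: (le_integrable _ _ _ Cg) => //.
  apply/measurable_EFinP; apply: (@measurable_funS _ _ (measurableTypeR R) R setT) => //.
  by apply: measurable_funM => //; case: gl.
move=> x _ /=; rewrite lee_fin mulrC !normrM ler_wpM2r//.
by apply: le_trans (phiC x) _; exact: ler_norm.
Qed.

(** A smooth cutoff on [[a, b]] with ramps of width [h]. Its derivative is a difference of two unit
    bumps, so that testing a weak derivative against it compares averages at the two ends. *)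
Definition plateau (h a b x : R) := step_at h a x - step_at h (b - h) x.

Lemma smooth_plateau h a b : smooth (plateau h a b).
Proof. by apply: smoothB; exact: smooth_step_at. Qed.

Lemma plateau_ge0 h a b x : 0 < h -> a <= b - h -> 0 <= plateau h a b x.
Proof.
move=> h0 ab; rewrite subr_ge0; apply: step_homo.
by rewrite lerB// ler_wpM2l// invr_ge0 ltW.
Qed.

Lemma plateau_le1 h a b x : plateau h a b x <= 1.
Proof.
rewrite /plateau; have := step_at_le1 h a x; have := step_at_ge0 h (b - h) x.
by move=> *; lra.
Qed.

Lemma plateau_out h a b x : 0 < h -> a <= b - h -> ~ `[a, b]%classic x -> plateau h a b x = 0.
Proof.
move=> h0 ab /negP; rewrite /= in_itv/= negb_and -!ltNge => /orP[xa|xb]; rewrite /plateau.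
  by rewrite !step_at0 ?subrr//; lra.
by rewrite !step_at1 ?subrr//; lra.
Qed.

Lemma plateau_in h a b x : 0 < h -> a + h <= x <= b - h -> plateau h a b x = 1.
Proof.
by move=> h0 /andP[ax xb]; rewrite /plateau step_at1// step_at0// subr0.
Qed.

Lemma derive_plateau h a b x :
  'D_1 (plateau h a b) x = hump_at h a x - hump_at h (b - h) x.
Proof.
by have [_ ->] := is_deriveB (is_derive_step_at h a x) (is_derive_step_at h (b - h) x).
Qed.

Lemma supp_compact (f : R -> R) (a b : R) :
  (forall x, ~ `[a, b]%classic x -> f x = 0) -> compact (supp f) /\ supp f `<=` `[a, b]%classic.
Proof.
move=> f0; have fs : supp f `<=` `[a, b]%classic.
  rewrite [X in _ `<=` X](closure_id _).1; last exact: itv_closed.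
  by apply: closure_subset => x /= /eqP fx; apply: contrapT => /f0.
split => //; apply: (subclosed_compact _ (@itv_compact a b)) => //.
exact: closed_closure.
Qed.

Lemma test_plateau h a b : 0 < h -> a <= b - h -> test_function setT (plateau h a b).
Proof.
move=> h0 ab; have [|cp sp] := @supp_compact (plateau h a b) a b.
  by move=> x; exact: plateau_out.
by split => //; exact: smooth_plateau.
Qed.

Lemma hump_avg_le (f : R -> R) (h c L : R) : 0 < h ->
  mu.-integrable setT (EFin \o (fun x => f x * hump_at h c x)) ->
  (forall x, `[c, c + h]%classic x -> f x <= L) ->
  \int[mu]_x (f x * hump_at h c x) <= L.
Proof.
move=> h0 fi fL.
have [K K0 /(_ h c _ h0) HK] := @hump_at_bound R.
have hi : mu.-integrable setT (EFin \o (hump_at h c)).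
  apply: (@integrable_bounded_supp _ c (c + h) (K * h^-1)).
  - exact: smooth_measurable (smooth_hump_at _ _).
  - by move=> x; have [] := HK x.
  - by move=> x; exact: hump_at_out.
have -> : L = \int[mu]_x (L * hump_at h c x).
  by rewrite RintegralZl// int_hump_at// mulr1.
apply: le_Rintegral => //.
  exact: (@integrableZl _ (measurableTypeR R) R mu setT _ L (EFin \o hump_at h c)).
move=> x _; have [xc|xc] := pselect (`[c, c + h]%classic x).
  by rewrite ler_wpM2r// ?hump_at_ge0// fL.
by rewrite hump_at_out// !mulr0.
Qed.

Lemma loc_integrable_hump (f : R -> R) (h c : R) : 0 < h -> locally_integrable setT f ->
  mu.-integrable setT (EFin \o (fun x => f x * hump_at h c x)).
Proof.
move=> h0 lf; have [K K0 /(_ h c _ h0) HK] := @hump_at_bound R.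
apply: (@loc_integrableM f _ c (c + h) (K * h^-1)) => //.
- exact: smooth_measurable (smooth_hump_at _ _).
- by move=> x; have [] := HK x.
- by move=> x; exact: hump_at_out.
Qed.

Lemma hump_avg_ge (f : R -> R) (h c L : R) : 0 < h ->
  mu.-integrable setT (EFin \o (fun x => f x * hump_at h c x)) ->
  (forall x, `[c, c + h]%classic x -> L <= f x) ->
  L <= \int[mu]_x (f x * hump_at h c x).
Proof.
move=> h0 fi fL.
have H := @hump_avg_le (fun x => - f x) h c (- L) h0.
rewrite -[L]opprK lerNl -mulN1r -RintegralZl//.
under eq_Rintegral do rewrite mulN1r -mulNr.
apply: H; last by move=> x /fL; rewrite lerN2.
have := (@integrableZl _ (measurableTypeR R) R mu setT measurableT (-1) _ fi).
congr (mu.-integrable _ _); apply/funext => x /=.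
by rewrite -EFinM mulN1r mulNr.
Qed.

Lemma hump_avg (f : R -> R) (h c l e : R) : 0 < h ->
  mu.-integrable setT (EFin \o (fun x => f x * hump_at h c x)) ->
  (forall x, `[c, c + h]%classic x -> `|f x - l| <= e) ->
  `|\int[mu]_x (f x * hump_at h c x) - l| <= e.
Proof.
move=> h0 fi fL.
have H1 : l - e <= \int[mu]_x (f x * hump_at h c x).
  by apply: hump_avg_ge => // x /fL; rewrite ler_norml => /andP[] *; lra.
have H2 : \int[mu]_x (f x * hump_at h c x) <= l + e.
  by apply: hump_avg_le => // x /fL; rewrite ler_norml => /andP[] *; lra.
by move: H1 H2; set A := \int[mu]_x _ => *; rewrite ler_norml; apply/andP; split; lra.
Qed.

Lemma weak_plateau (f g : R -> R) h a b : 0 < h -> a <= b - h ->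
  continuous f -> weak_derivative f g ->
  \int[mu]_x (g x * plateau h a b x) =
  \int[mu]_x (f x * hump_at h (b - h) x) - \int[mu]_x (f x * hump_at h a x).
Proof.
move=> h0 ab cf [lf lg /(_ _ (@test_plateau h a b h0 ab)) fg].
rewrite -[LHS]opprK -fg -opprB; congr (- _).
under eq_Rintegral do rewrite derive_plateau mulrBr.
by rewrite RintegralB//; exact: loc_integrable_hump.
Qed.

(** Replacing [f1] by the minimum of [f1] and [f2] changes it on a null set only and makes the
    inequality hold pointwise. *)
Lemma ae_le_Rintegral d (T : measurableType d) (m : {measure set T -> \bar R})
    (D : set T) (f1 f2 : T -> R) : measurable D ->
  m.-integrable D (EFin \o f1) -> m.-integrable D (EFin \o f2) ->
  {ae m, forall x, D x -> f1 x <= f2 x} ->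
  \int[m]_(x in D) f1 x <= \int[m]_(x in D) f2 x.
Proof.
move=> mD i1 i2 f12.
have im : m.-integrable D (EFin \o (fun x => Num.min (f1 x) (f2 x))).
  apply: (le_integrable mD _ _ (integrableD mD (integrable_norm i1) (integrable_norm i2))).
    by apply/measurable_EFinP; apply: measurable_minr; apply/measurable_EFinP;
      [case/integrableP: i1|case/integrableP: i2].
  move=> x _ /=; rewrite lee_fin (le_trans _ (ler_norm _))//=.
  by rewrite /Num.min; case: ifPn => _; rewrite ?lerDl ?lerDr.
have -> : \int[m]_(x in D) f1 x = \int[m]_(x in D) Num.min (f1 x) (f2 x).
  rewrite /Rintegral; congr fine; apply: ae_eq_integral => //.
  - by case/integrableP: i1.
  - by case/integrableP: im.
  - by apply: filterS f12 => x H Dx; rewrite /= /Num.min; move: (H Dx); case: ltgtP => // ->.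
by apply: le_Rintegral => // x _; rewrite ge_min lexx orbT.
Qed.

(** Test with a plateau on [[a, b]]: its two edges average [f] near [a] and near [b]. The factor [s]
    gives both signs, and multiples such as [2 * lam] in [inD_energy]; [G >= 0] allows the plateau,
    at most 1, to be dropped from the integral of [G]. *)
Lemma weak_derivative_incr (f g G : R -> R) (s a b : R) : a < b ->
  continuous f -> weak_derivative f g ->
  mu.-integrable `[a, b] (EFin \o G) -> (forall x, 0 <= G x) ->
  {ae mu, forall x, s * g x <= G x} ->
  s * (f b - f a) <= \int[mu]_(x in `[a, b]) G x.
Proof.
move=> ab cf fg Gi G0 gG; have [lf lg _] := fg.
suff H e : 0 < e -> s * (f b - f a) <= \int[mu]_(x in `[a, b]) G x + `|s| * (e + e).
  apply/ler_addgt0Pr => d d0.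
  have s0 : 0 < `|s| + 1 by rewrite ltr_wpDl.
  apply: le_trans (H (d / (`|s| + 1) / 2) _) _; first by rewrite !divr_gt0.
  rewrite lerD2l -splitr mulrA ler_pdivrMr// mulrC ler_wpM2l ?(ltW d0)//.
  by rewrite lerDl.
move=> e0.
have /cvgrPdist_le /(_ _ e0) /nbhs_ballP[da /= da0 Ha] := cf a.
have /cvgrPdist_le /(_ _ e0) /nbhs_ballP[db /= db0 Hb] := cf b.
(* The edges must be shorter than the continuity radii at [a] and [b], and than [b - a] for the
   plateau to fit. *)
pose h := Num.min (Num.min da db) (b - a) / 4.
have h4 : 0 < h by rewrite divr_gt0// !lt_min da0 db0 subr_gt0.
have [hda hdb hab] : [/\ h < da, h < db & h < b - a].
  by split; rewrite ltr_pdivrMr// !gt_min; apply/orP; (try by [right; lra]); left;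
    apply/orP; [left|right]; lra.
have abh : a <= b - h by lra.
have Ea : `|\int[mu]_x (f x * hump_at h a x) - f a| <= e.
  apply: hump_avg => //; first exact: loc_integrable_hump.
  move=> x /=; rewrite in_itv/= => /andP[x1 x2]; rewrite distrC; apply: Ha.
  by rewrite /ball/= ltr_norml; apply/andP; split; lra.
have Eb : `|\int[mu]_x (f x * hump_at h (b - h) x) - f b| <= e.
  apply: hump_avg => //; first exact: loc_integrable_hump.
  move=> x /=; rewrite in_itv/= => /andP[x1 x2]; rewrite distrC; apply: Hb.
  by rewrite /ball/= ltr_norml; apply/andP; split; lra.
have W := @weak_plateau f g h a b h4 abh cf fg.
have ip : mu.-integrable setT (EFin \o (fun x => g x * plateau h a b x)).
  apply: (@loc_integrableM g _ a b 1) => //.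
  - exact: smooth_measurable (smooth_plateau _ _ _).
  - by move=> x; rewrite ger0_norm ?plateau_le1// plateau_ge0.
  - by move=> x; exact: plateau_out.
have S : s * \int[mu]_x (g x * plateau h a b x) <= \int[mu]_(x in `[a, b]) G x.
  rewrite (@Rintegral_supp _ `[a, b]); last first.
    by move=> x H; rewrite plateau_out// mulr0.
  have ip' := @integrableS _ (measurableTypeR R) R mu setT `[a, b] _ measurableT (measurable_itv _) (@subsetT _ _) ip.
  rewrite -RintegralZl//; apply: ae_le_Rintegral => //.
    exact: (@integrableZl _ (measurableTypeR R) R mu `[a, b] _ s (EFin \o _) ip').
  apply: ae_imp gG _ => x H _; rewrite mulrA.
  have := plateau_ge0 h a b x h4 abh; have := plateau_le1 h a b x.
  set p := plateau h a b x => p1 p0.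
  apply: le_trans (ler_wpM2r p0 H) _.
  by rewrite -{2}[G x]mulr1 ler_wpM2l.
apply: le_trans (lerD S (lexx _)); rewrite W -lerBlDl -mulrBr.
apply: le_trans (ler_norm _) _; rewrite normrM ler_wpM2l//.
set A := \int[mu]_x _ in Ea *; set B := \int[mu]_x _ in Eb *.
by move: Ea Eb; rewrite !ler_norml => /andP[? ?] /andP[? ?]; apply/andP; lra.
Qed.

End WeakDer.

(** * The space D *)

Section RealIntegrable.
Context d (T : measurableType d) {R : realType} (m : {measure set T -> \bar R}).
Implicit Types (D : set T) (f g : T -> R).

Lemma integrable_rD D f g : measurable D ->
  m.-integrable D (EFin \o f) -> m.-integrable D (EFin \o g) ->
  m.-integrable D (EFin \o (fun x => f x + g x)).
Proof.
move=> mD fi gi; have := integrableD mD fi gi.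
by congr (m.-integrable _ _); apply/funext => x; rewrite /= EFinD.
Qed.

Lemma integrable_rZ D f (k : R) : measurable D ->
  m.-integrable D (EFin \o f) -> m.-integrable D (EFin \o (fun x => k * f x)).
Proof.
move=> mD fi; have := integrableZl mD k fi.
by congr (m.-integrable _ _); apply/funext => x; rewrite /= EFinM.
Qed.

Lemma integrable_rB D f g : measurable D ->
  m.-integrable D (EFin \o f) -> m.-integrable D (EFin \o g) ->
  m.-integrable D (EFin \o (fun x => f x - g x)).
Proof.
move=> mD fi gi; have := integrableB mD fi gi.
by congr (m.-integrable _ _); apply/funext => x; rewrite /= EFinB.
Qed.

End RealIntegrable.

Section InD.
Context {R : realType}.
Local Notation mu := (@lebesgue_measure R).

Lemma mu_setT : mu [set: R] = +oo%E.
Proof. by have := @lebesgue_measure_itv R `]-oo, +oo[; rewrite set_itvE. Qed.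

Lemma Linfty_normP (f : R -> R) (M : R) :
  (Linfty_norm f <= M%:E)%E <-> {ae mu, forall x, `|f x| <= M}.
Proof.
rewrite /Linfty_norm unlock /= mu_setT ltry; split.
  by move=> /ess_supP H; apply: ae_imp H _ => x; rewrite /= lee_fin.
by move=> H; apply/ess_supP; apply: ae_imp H _ => x; rewrite /= lee_fin.
Qed.

Lemma Linfty_norm_ge0 (f : R -> R) : (0 <= Linfty_norm f)%E.
Proof. exact: Lnorm_ge0. Qed.

Lemma ae_dense (P : R -> Prop) (a b : R) : {ae mu, forall x, P x} -> a < b ->
  exists2 x, a < x < b & P x.
Proof.
move=> [N [mN N0 PN]] ab; apply: contrapT => H.
have : (mu `]a, b[%classic <= mu N)%E.
  apply: le_measure; rewrite ?inE//.
  move=> x /= xab; apply: PN => /= Px; apply: H; exists x => //.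
rewrite N0 lebesgue_measure_itv/= lte_fin ab leNgt => /negP; apply.
by rewrite lte_fin subr_gt0.
Qed.

Variables (Finf : R) (u F : R -> R).
Hypothesis uF : inD Finf u F.

Lemma inD_cont : continuous u. Proof. by case: uF => -[]. Qed.
Lemma inD_homo : {homo F : x y / x <= y}. Proof. by case: uF => _ []. Qed.
Lemma inD_left x : F y @[y --> x^'-] --> F x. Proof. by case: uF => _ []. Qed.

Lemma inD_small e : 0 < e -> exists N, F N < e.
Proof.
move=> e0; have [_ _ /cvgr_lt /(_ _ e0) [N [_ H]] _ _] := uF.
by exists (N - 1); apply: H; rewrite ltrBlDr ltrDl.
Qed.

Lemma inD_ge0 x : 0 <= F x.
Proof.
apply/ler_addgt0Pr => e e0; rewrite leNgt; apply/negP => Fx.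
have [_ _ /cvgr_gt /(_ _ _ ) H _ _] := uF.
have [N [_ HN]] := H (F x + e) Fx.
have := HN (Num.min (N - 1) x); rewrite gt_min ltrBlDr ltrDl ltr01 => /(_ isT).
have : F (Num.min (N - 1) x) <= F x by apply: inD_homo; rewrite ge_min lexx orbT.
by move=> *; lra.
Qed.

Lemma inD_norm : Linfty_norm F = Finf%:E.
Proof. by case: uF => _ _ _ []. Qed.

(** The essential bound holds at some point to the right of [x], and monotonicity carries it back to
    [x]. *)
Lemma inD_le x : F x <= Finf.
Proof.
have /Linfty_normP H : (Linfty_norm F <= Finf%:E)%E by rewrite inD_norm.
have [|y /andP[xy _] Fy] := @ae_dense _ x (x + 1) H; first by rewrite ltrDl.
by rewrite (le_trans _ Fy)// (le_trans _ (ler_norm _))// inD_homo// ltW.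
Qed.

Lemma inD_total_ge0 : 0 <= Finf.
Proof. exact: le_trans (inD_ge0 0) (inD_le 0). Qed.

Lemma inD_large e : 0 < e -> exists N, Finf - e < F N.
Proof.
move=> e0; apply: contrapT => H.
have : (Linfty_norm F <= (Finf - e)%:E)%E.
  apply/Linfty_normP; apply: aeW => x; rewrite ger0_norm ?inD_ge0//.
  by rewrite leNgt; apply/negP => Fx; apply: H; exists x.
by rewrite inD_norm lee_fin; lra.
Qed.

(* 2 lam u_x <= 1 + lam^2 u_x^2 turns the quadratic energy inequality into a
   family of linear ones. *)
Lemma inD_energy lam a b : a <= b ->
  2 * lam * (u b - u a) <= (b - a) + lam ^+ 2 * (F b - F a).
Proof.
rewrite le_eqVlt => /predU1P[->|ab]; first by rewrite !subrr !mulr0 addr0.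
have [_ _ _ _ [ux [wu u2 uE]]] := uF.
have i2 : mu.-integrable setT (EFin \o (fun x => ux x ^+ 2)).
  exact: Lfun2_integrable_sqr.
have i2' := @integrableS _ (measurableTypeR R) R mu setT `[a, b] _ measurableT (measurable_itv _) (@subsetT _ _) i2.
have i1 : mu.-integrable `[a, b] (EFin \o (cst 1)).
  by apply: (@integrable_bounded_itv _ _ _ 1) => // x; rewrite /= normr1.
have i3 : mu.-integrable `[a, b] (EFin \o (fun x => lam ^+ 2 * ux x ^+ 2)).
  exact: (@integrableZl _ (measurableTypeR R) R mu `[a, b] _ (lam ^+ 2) (EFin \o _) i2').
apply: le_trans (@weak_derivative_incr _ u ux (fun x => 1 + lam ^+ 2 * ux x ^+ 2)
  (2 * lam) a b ab inD_cont wu _ _ _) _.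
- exact: (@integrable_rD _ (measurableTypeR R) R mu `[a, b] (cst 1)).
- by move=> x; rewrite addr_ge0// mulr_ge0// sqr_ge0.
- apply: aeW => x; rewrite -subr_ge0.
  have -> : 1 + lam ^+ 2 * ux x ^+ 2 - 2 * lam * ux x = (1 - lam * ux x) ^+ 2 by ring.
  exact: sqr_ge0.
rewrite RintegralD// lerD//.
  by rewrite Rintegral_cst//= lebesgue_measure_itv/= lte_fin ab mul1r.
rewrite RintegralZl// ler_wpM2l ?sqr_ge0//.
have := uE _ _ ab.
have -> : (\int[mu]_(x in `[a, b]) (ux x ^+ 2)%:E = (\int[mu]_(x in `[a, b]) (ux x ^+ 2))%R%:E)%E.
  by rewrite /Rintegral fineK//; exact: integrable_fin_num i2'.
rewrite lee_fin => H; apply: le_trans H _.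
(* The inequality of [inD] involves [F(b^-) - F(a^+)]. Left continuity gives [F(b^-) = F b];
   monotonicity gives [F a <= F(a^+)], which is the favourable direction. *)
have -> : lim (F x @[x --> b^'-]) = F b by apply: cvg_lim => //; exact: inD_left.
rewrite lerD2l lerN2; apply: limr_ge.
  apply: (@nondecreasing_at_right_is_cvgr _ F a).
    by near=> x => y z _ _; exact: inD_homo.
  near=> x; exists (F a) => _ [y /= ya <-]; apply: inD_homo.
  by move: ya; rewrite in_itv/= => /andP[/ltW].
by near=> x; apply: inD_homo; near: x; exact: nbhs_right_ge.
Unshelve. all: by end_near. Qed.

End InD.
Arguments inD_cont {R Finf u F} uF.
Arguments inD_homo {R Finf u F} uF.
Arguments inD_left {R Finf u F} uF.
Arguments inD_small {R Finf u F} uF.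
Arguments inD_ge0 {R Finf u F} uF.
Arguments inD_le {R Finf u F} uF.
Arguments inD_large {R Finf u F} uF.
Arguments inD_total_ge0 {R Finf u F} uF.
Arguments inD_energy {R Finf u F} uF.

Section Lip.
Context {R : realType}.
Local Notation mu := (@lebesgue_measure R).

Lemma weak_derivative_lip (f g : R -> R) (M a b : R) : 0 <= M ->
  continuous f -> weak_derivative f g -> (Linfty_norm g <= M%:E)%E ->
  `|f b - f a| <= M * `|b - a|.
Proof.
move=> M0 cf fg /Linfty_normP gM.
wlog ab : a b / a < b.
  move=> H; have [ab|ba|->] := ltgtP a b; first exact: H.
    by rewrite distrC [`|b - a|]distrC; exact: H.
  by rewrite !subrr normr0 mulr0.
have iM : mu.-integrable `[a, b] (EFin \o (cst M)).
  by apply: (@integrable_bounded_itv _ _ _ `|M|) => // x.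
have E : \int[mu]_(x in `[a, b]) cst M x = M * (b - a).
  by rewrite Rintegral_cst//= lebesgue_measure_itv/= lte_fin ab.
rewrite (@gtr0_norm _ (b - a)) ?subr_gt0// -E ler_norml; apply/andP; split.
- rewrite lerNl -mulN1r; apply: (@weak_derivative_incr _ f g (cst M)) => //.
  by apply: ae_imp gM _ => x; rewrite mulN1r ler_norml => /andP[] *; rewrite lerNl.
- rewrite -[f b - f a]mul1r; apply: (@weak_derivative_incr _ f g (cst M)) => //.
  by apply: ae_imp gM _ => x; rewrite mul1r ler_norml => /andP[].
Qed.

End Lip.

(** * Averages at Lebesgue points; weak derivatives of Lipschitz functions *)

Section LebesguePoint.
Context {R : realType}.
Local Notation mu := (@lebesgue_measure R).

(** Meant for kernels of height [C] comparable to [1 / r], for which the error is of order [e]. *)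
Lemma lebesgue_pt_avg (B : R -> R) (s e : R) : locally_integrable setT B ->
  lebesgue_pt B s -> 0 < e ->
  exists2 d : R, 0 < d & forall (r C : R) (phi : R -> R), 0 < r < d ->
    measurable_fun setT phi -> (forall x, `|phi x| <= C) ->
    (forall x, ~ ball s r x -> phi x = 0) ->
    `|\int[mu]_x (B x * phi x) - B s * \int[mu]_x phi x| <= C * (e * r).
Proof.
move=> lB Bs e0.
have : \forall r \near (0:R)^'+, (davg B s r < (e / 2)%:E)%E.
  apply: (Bs [set y | (y < (e / 2)%:E)%E]); apply: open_nbhs_nbhs; split.
    exact: open_ereal_lt_ereal.
  by rewrite /= lte_fin divr_gt0.
move=> [d /= d0 Hd]; exists d => // r C phi /andP[r0 rd] mphi phiC phi0.
have phi0' x : ~ `[s - r, s + r]%classic x -> phi x = 0.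
  move=> H; apply: phi0; rewrite /ball/= => H'; apply: H.
  by move: H'; rewrite /= in_itv/= ltr_norml => /andP[? ?]; apply/andP; lra.
have C0 : 0 <= C by exact: le_trans (phiC s).
have i1 : mu.-integrable setT (EFin \o (fun x => B x * phi x)).
  exact: (@loc_integrableM _ B phi (s - r) (s + r) C).
have i2 : mu.-integrable setT (EFin \o phi).
  exact: (@integrable_bounded_supp _ (s - r) (s + r) C).
rewrite -RintegralZl// -RintegralB//; last exact: integrable_rZ.
have i3 : mu.-integrable setT (EFin \o (fun x => B x * phi x - B s * phi x)).
  by apply: integrable_rB => //; exact: integrable_rZ.
have mb : measurable (ball s r : set (measurableTypeR R)) by exact: measurable_ball.
rewrite (@Rintegral_supp _ (ball s r)); last first.
  by move=> x /phi0 ->; rewrite !mulr0 subrr.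
have i3' := @integrableS _ (measurableTypeR R) R mu setT (ball s r) _ measurableT mb (@subsetT _ _) i3.
apply: le_trans (le_normr_Rintegral mb i3') _.
have iB : mu.-integrable (ball s r) (EFin \o (fun x => `|B x - B s|)).
  apply: (@integrableS _ (measurableTypeR R) R mu `[s - r, s + r] (ball s r)) => //.
    by move=> x; rewrite /ball/= in_itv/= ltr_norml => /andP[? ?]; apply/andP; lra.
  apply: (@integrable_norm _ (measurableTypeR R) R mu _ (fun x => B x - B s)).
  apply: integrable_rB => //; first exact: loc_integrable_itv.
  by apply: (@integrable_bounded_itv _ _ _ `|B s|) => // x.
have Hd' : \int[mu]_(x in ball s r) `|B x - B s| <= e * r.
  have : (davg B s r < (e / 2)%:E)%E.
    by apply: Hd => //=; rewrite sub0r normrN gtr0_norm.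
  rewrite /davg /iavg (lebesgue_measure_ball _ (ltW r0)).
  rewrite [X in (_ * X)%E](_ : _ = (\int[mu]_(x in ball s r) `|B x - B s|)%R%:E); last first.
    by rewrite /Rintegral fineK//; exact: integrable_fin_num iB.
  rewrite inver mulrn_eq0/= gt_eqF// -EFinM lte_fin => H.
  have r2 : 0 < r *+ 2 by rewrite mulrn_wgt0.
  move: H; rewrite mulrC ltr_pdivrMr//; set I := Rintegral _ _ _ => H.
  rewrite (le_trans (ltW H))// le_eqVlt; apply/orP; left; apply/eqP.
  by rewrite -mulr_natr; field.
apply: le_trans (ler_wpM2l C0 Hd'); rewrite -RintegralZl//.
apply: le_Rintegral => //; [exact: integrable_norm|exact: integrable_rZ|].
move=> x _; rewrite -mulrBl normrM mulrC.
by rewrite ler_wpM2r.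
Qed.

Lemma lip_continuous (f : R -> R) (K : R) : 0 <= K ->
  (forall x y, `|f x - f y| <= K * `|x - y|) -> continuous f.
Proof.
move=> K0 fK x; apply/cvgrPdist_le => e e0; apply/nbhs_ballP.
have K1 : 0 < K + 1 by lra.
exists ((K + 1)^-1 * e); first by rewrite /= mulr_gt0// invr_gt0.
move=> y /ltW xy; apply: le_trans (fK _ _) _.
apply: (@le_trans _ _ ((K + 1) * `|x - y|)); first by rewrite ler_wpM2r// lerDl.
by rewrite -ler_pdivlMl.
Qed.

(** At a Lebesgue point of [g], test with a plateau of radius [r] and mass at least [r]: its two
    edges average [f] within [K * r] of [f s]. The constant is not sharp; its role is to show that
    [slope_bound] is finite. *)
Lemma weak_derivative_bound (f g : R -> R) (K : R) : 0 <= K ->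
  (forall x y, `|f x - f y| <= K * `|x - y|) -> weak_derivative f g ->
  (Linfty_norm g <= (4 * K + 1)%:E)%E.
Proof.
move=> K0 fK fg; have [lf lg _] := fg; apply/Linfty_normP.
have cf := @lip_continuous f K K0 fK.
apply: ae_imp (lebesgue_differentiation lg) _ => s gs.
have [d d0 Hd] := @lebesgue_pt_avg g s 1 lg gs ltr01.
pose r := d / 2.
have r0 : 0 < r by rewrite divr_gt0.
have rd : r < d by rewrite /r; lra.
have h0 : 0 < r / 2 by rewrite divr_gt0.
have ab : s - r <= s + r - r / 2 by lra.
pose phi := plateau (r / 2) (s - r) (s + r).
have mphi : measurable_fun setT phi by exact: smooth_measurable (smooth_plateau _ _ _).
have phi1 x : `|phi x| <= 1 by rewrite ger0_norm ?plateau_le1// plateau_ge0.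
have phi0 x : ~ ball s r x -> phi x = 0.
  rewrite /ball/= ltr_norml => /negP; rewrite negb_and -!leNgt => /orP[H|H].
    by rewrite /phi /plateau !step_at1 ?subrr//; lra.
  by rewrite /phi /plateau !step_at0 ?subrr//; lra.
have rd' : 0 < r < d by rewrite r0.
have := Hd r 1 phi rd' mphi phi1 phi0.
rewrite !mul1r (@weak_plateau _ f g _ _ _ h0 ab cf fg) => H.
have phi0' x : ~ `[s - r, s + r]%classic x -> phi x = 0 by exact: plateau_out.
have ip : mu.-integrable setT (EFin \o phi) by exact: (@integrable_bounded_supp _ (s - r) (s + r) 1).
(* The plateau equals 1 on [[s - r/2, s + r/2]], an interval of length [r]. *)
have Ip : r <= \int[mu]_x phi x.
  have E : \int[mu]_(x in `[s - r / 2, s + r / 2]) (cst 1 x) = r.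
    rewrite Rintegral_cst//= lebesgue_measure_itv/= lte_fin ifT; last by lra.
    by rewrite mul1r/= /r; lra.
  have ms : measurable (`[s - r / 2, s + r / 2]%classic : set (measurableTypeR R)) by [].
  rewrite -{1}E Rintegral_mkcond; apply: le_Rintegral => //.
    apply: (@integrable_bounded_supp _ (s - r) (s + r) 1).
    - exact/(measurable_restrictT _ _).1.
    - by move=> x; rewrite patchE; case: ifP => _; rewrite ?normr1 ?normr0.
    - move=> x Hx; rewrite patchE; case: ifPn => // /set_mem/= H'; exfalso; apply: Hx; move: H'.
      by rewrite /= !in_itv/= => /andP[? ?]; apply/andP; lra.
  move=> x _; rewrite patchE; case: ifPn => [/set_mem/=|_]; last exact: plateau_ge0.
  by rewrite in_itv/= => H'; rewrite /phi plateau_in//; apply/andP; lra.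
have Eb : `|\int[mu]_x (f x * hump_at (r / 2) (s + r - r / 2) x) - f s| <= K * r.
  apply: hump_avg => //; first exact: loc_integrable_hump.
  move=> x /=; rewrite in_itv/= => /andP[x1 x2]; apply: le_trans (fK _ _) _.
  by rewrite ler_wpM2l// ler_norml; apply/andP; split; lra.
have Ea : `|\int[mu]_x (f x * hump_at (r / 2) (s - r) x) - f s| <= K * r.
  apply: hump_avg => //; first exact: loc_integrable_hump.
  move=> x /=; rewrite in_itv/= => /andP[x1 x2]; apply: le_trans (fK _ _) _.
  by rewrite ler_wpM2l// ler_norml; apply/andP; split; lra.
move: H Ea Eb Ip; set A := \int[mu]_x _; set B := \int[mu]_x _; set I := \int[mu]_x _.
move=> H Ea Eb Ip.
have I0 : 0 < I by exact: lt_le_trans Ip.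
rewrite -(ler_pM2r I0) -{1}(gtr0_norm I0) -normrM.
have H1 : `|g s * I| <= K * r + K * r + r.
  move: H Ea Eb; rewrite !ler_norml => /andP[? ?] /andP[? ?] /andP[? ?].
  by apply/andP; split; lra.
apply: le_trans H1 _; apply: (@le_trans _ _ ((4 * K + 1) * r)).
  have : 0 <= K * r by rewrite mulr_ge0 ?(ltW r0).
  by lra.
by rewrite ler_wpM2l//; lra.
Qed.

End LebesguePoint.

(** * Measures with a Lipschitz distribution function *)

Section CDF.
Context {R : realType}.
Local Notation mu := (@lebesgue_measure R).
Variables (m : {finite_measure set (measurableTypeR R) -> \bar R}) (F : R -> R).
Hypothesis mF : forall x, m `]-oo, x[%classic = (F x)%:E.

Lemma cdf_itv (a b : R) : a <= b -> m `[a, b[%classic = (F b - F a)%:E.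
Proof.
move=> ab.
have := mF b.
have -> : `]-oo, b[%classic = `]-oo, a[%classic `|` `[a, b[%classic :> set R.
  by rewrite -(@itv_bndbnd_setU _ _ -oo%O (BLeft a) (BLeft b)).
rewrite measureU//=; last first.
  apply/seteqP; split => // x [/=]; rewrite !in_itv/= => xa /andP[ax _].
  by move: xa; rewrite ltNge ax.
rewrite mF => /(congr1 (fun z => z - (F a)%:E)%E).
by rewrite addeAC subee// add0e -EFinB => <-.
Qed.

Variable K : R.
Hypothesis K0 : 0 <= K.
Hypothesis FK : forall x y, `|F x - F y| <= K * `|x - y|.

(** On intervals [m] is at most [K + 1] times the length, and Lebesgue measure is an infimum over
    coverings by intervals. [K + 1] is used in place of [K] in order to divide by it. *)
Lemma cdf_lipschitz_null (N : set R) : measurable N -> mu N = 0 -> m N = 0.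
Proof.
move=> mN N0; apply/eqP; rewrite eq_le measure_ge0 andbT.
apply/lee_addgt0Pr => e e0; rewrite add0e.
have K1 : 0 < K + 1 by rewrite ltr_wpDl.
have /ereal_inf_lt[_ [A [mA NA] <-] lA] :
    (mu N < (e / (K + 1))%:E)%E by rewrite N0 lte_fin divr_gt0.
have wA k : (m (A k) <= (K + 1)%:E * wlength idfun (A k))%E.
  have /ocitvP[->|[[a b] /= ab ->]] := mA k.
    by rewrite measure0 wlength0 mule0.
  (* The coverings consist of intervals []a, b]], whereas [F] measures [[a, b[]; the right end is
     enlarged by an amount of mass at most [d]. *)
  rewrite (wlength_itv_bnd _ _ _ (ltW ab)) -EFinM; apply/lee_addgt0Pr => d d0.
  have dK : 0 < d / (K + 1) by rewrite divr_gt0.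
  apply: (@le_trans _ _ (m `[a, (b + d / (K + 1))[%classic)).
    apply: le_measure; rewrite ?inE//.
    move=> x /=; rewrite !in_itv/= => /andP[ax xb]; rewrite ltW//=.
    by rewrite (le_lt_trans xb)// ltrDl.
  rewrite cdf_itv; last by lra.
  rewrite -EFinD lee_fin (le_trans (ler_norm _))// (le_trans (FK _ _))//.
  rewrite ger0_norm; last by lra.
  apply: (@le_trans _ _ ((K + 1) * (b + d / (K + 1) - a))).
    by rewrite ler_wpM2r//; lra.
  by rewrite addrAC mulrDr [_ * (d / _)]mulrC divfK// gt_eqF.
have : (m N <= \sum_(k <oo) m (A k))%E.
  apply: measure_sigma_subadditive => //.
  by move=> k; apply: sub_sigma_algebra; exact: mA.
move=> /le_trans; apply.
apply: (@le_trans _ _ (\sum_(k <oo) (K + 1)%:E * wlength idfun (A k))%E).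
  by apply: lee_nneseries => // k _.
rewrite nneseriesZl; last by move=> k _; exact: wlength_ge0.
move/ltW: lA => /(@lee_wpmul2l _ (K + 1)%:E); rewrite lee_fin => /(_ (ltW K1)) /le_trans; apply.
by rewrite -EFinM mulrC divfK// gt_eqF.
Qed.

Lemma cdf_dominated : m `<< mu.
Proof.
move=> N N0 A mA AN; apply: cdf_lipschitz_null => //; exact: N0.
Qed.

Definition cdf_density (x : R) : R :=
  fine (Radon_Nikodym (charge_of_finite_measure m) mu x).

Lemma cdf_density_integrable : mu.-integrable setT (EFin \o cdf_density).
Proof.
have := @Radon_Nikodym_integrable _ _ R (charge_of_finite_measure m) mu cdf_dominated.
congr (mu.-integrable _ _); apply/funext => x /=; rewrite fineK//.
exact: (@Radon_Nikodym_fin_num _ _ R (charge_of_finite_measure m) mu x cdf_dominated).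
Qed.

Lemma cdf_density_int (phi : R -> R) : m.-integrable setT (EFin \o phi) ->
  \int[mu]_x (cdf_density x * phi x) = \int[m]_x phi x.
Proof.
move=> iphi.
have := Radon_Nikodym_change_of_variables cdf_dominated measurableT iphi.
rewrite /Rintegral => <-; congr fine; apply: eq_integral => x _ /=.
rewrite mulrC EFinM fineK//; exact: (@Radon_Nikodym_fin_num _ _ R (charge_of_finite_measure m) mu x cdf_dominated).
Qed.

(** Integration by parts through Fubini for the indicator of [x < y] times [dphi y]: integrating in
    [y] gives [- phi x], since [phi] vanishes far to the right, and integrating in [x] gives
    [F y * dphi y]. The strict inequality matches the open rays that define [F]. *)
Lemma cdf_int (phi dphi : R -> R) (a b C : R) : a < b ->
  (forall x : R, is_derive x 1 phi (dphi x)) -> continuous dphi ->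
  (forall x, ~ `[a, b]%classic x -> phi x = 0) ->
  (forall x, ~ `[a, b]%classic x -> dphi x = 0) ->
  (forall x, `|dphi x| <= C) ->
  \int[m]_x phi x = - \int[mu]_x (F x * dphi x).
Proof.
move=> ab dp cd p0 d0 dC.
pose T1 := measurableTypeR R.
pose f : T1 * T1 -> \bar R := fun z => (\1_([set z : T1 * T1 | z.1 < z.2]) z * dphi z.2)%:E.
have mlt : measurable ([set z : T1 * T1 | z.1 < z.2]).
  have := @measurable_fun_ltr _ (T1 * T1)%type R setT fst snd (@measurable_fst _ _ T1 T1) (@measurable_snd _ _ T1 T1).
  by move=> /(_ measurableT [set true]); rewrite setTI; apply.
have mind : measurable_fun setT (\1_([set z : T1 * T1 | z.1 < z.2]) : T1 * T1 -> R).
  exact: measurable_indic.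
have mf : measurable_fun setT f.
  apply/measurable_EFinP; apply: measurable_funM; first exact: measurable_indic.
  apply: (@measurableT_comp _ _ _ _ _ _ dphi) => //; exact: continuous_measurable.
have C0 : 0 <= C by exact: le_trans (dC 0).
have fC z : `|f z|%E = (\1_([set z : T1 * T1 | z.1 < z.2]) z * `|dphi z.2|)%:E.
  by rewrite /f /= normrM indicE; case: (_ \in _); rewrite ?normr1 ?normr0 ?mul0r.
have fi : (m \x mu)%E.-integrable setT f.
  apply/(integrable12ltyP _ _ mf).
  apply: (@le_lt_trans _ _ (\int[m]_(x in setT) (C * (b - a))%:E)%E).
    apply: ge0_le_integral => //.
    - by move=> x _; apply: integral_ge0.
    - apply: (@measurable_fun_fubini_tonelli_F _ _ _ _ _ mu (fun z => `|f z|%E)) => //.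
      exact: measurableT_comp.
    move=> x _; apply: (@le_trans _ _ (\int[mu]_y (C * \1_(`[a, b]%classic) y)%:E)%E).
      apply: ge0_le_integral => //.
      + by apply: measurableT_comp => //; apply: (measurable_fun_pair2 x mf).
      + by apply/measurable_EFinP; apply: measurable_funM => //; exact: measurable_indic.
      move=> y _; rewrite fC lee_fin !indicE.
      have [yab|yab] := pselect (`[a, b]%classic y); last first.
        by rewrite (d0 _ yab) normr0 mulr0 mulr_ge0.
      rewrite (mem_set yab) mulr1; case: (_ \in _); rewrite ?mul1r ?mul0r//.
    under eq_integral do rewrite EFinM.
    rewrite ge0_integralZl//; last first.
      by apply/measurable_EFinP; exact: measurable_indic.
    rewrite integral_indic// setIT /= lebesgue_measure_itv/= lte_fin ab.
    by rewrite -EFinB -EFinM.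
  rewrite integral_cst//; apply: lte_mul_pinfty => //.
    by rewrite lee_fin mulr_ge0// subr_ge0 ltW.
  by rewrite ltey_eq fin_num_measure.
have I1 (x : R) : \int[mu]_y (\1_([set z : T1 * T1 | z.1 < z.2]) (x, y) * dphi y) = - phi x.
  pose c := Num.max x b + 1.
  have xc : x < c by rewrite /c ltr_pwDr// le_max lexx.
  have bc : b < c by rewrite /c ltr_pwDr// le_max lexx orbT.
  rewrite (@Rintegral_supp _ `]x, c]); last first.
    move=> y /=; rewrite in_itv/= indicE => /negP; rewrite negb_and -leNgt -ltNge.
    case: (boolP (_ \in _)) => [/set_mem /= xy|]; last by rewrite mul0r.
    rewrite leNgt xy /= => cy; rewrite d0 ?mulr0//= in_itv/= => /andP[_].
    by rewrite leNgt (lt_trans bc cy).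
  transitivity (\int[mu]_(y in `]x, c]) dphi y).
    apply: eq_Rintegral => y /set_mem /=; rewrite in_itv/= => /andP[xy _].
    by rewrite indicE mem_set// mul1r.
  have md : measurable_fun setT dphi by exact: continuous_measurable.
  have mdS : measurable_fun (`]x, c]%classic : set T1) dphi.
    exact: (@measurable_funS _ _ T1 R setT).
  have idS : mu.-integrable `]x, c] (EFin \o dphi).
    apply: (@integrableS _ T1 R mu `[x, c]) => //.
      by move=> y /=; rewrite !in_itv/= => /andP[/ltW -> ->].
    exact: (@integrable_bounded_itv _ _ _ C).
  rewrite Rintegral_itv_obnd_cbnd//.
  have cF := is_derive_continuous _ _ dp.
  rewrite /Rintegral (@continuous_FTC2 _ dphi phi)//.
  - rewrite /= [phi c]p0 ?sub0r//= in_itv/= => /andP[_].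
    by rewrite leNgt bc.
  - exact: continuous_subspaceT.
  - split; first by move=> y _; case: (dp y).
      by apply: cvg_at_right_filter; exact: cF.
    by apply: cvg_at_left_filter; exact: cF.
  - by move=> y _; rewrite derive1E; case: (dp y).
have I2 (y : R) : (\int[m]_x f (x, y) = (F y * dphi y)%:E)%E.
  rewrite /f /=; under eq_integral do rewrite mulrC EFinM.
  rewrite integralZl//; last first.
    apply: (bounded_integrable _ T1 _ _ (fun x => \1_[set z : T1 * T1 | z.1 < z.2] (x, y)) 1) => //.
    - by rewrite ltey_eq fin_num_measure.
    - exact: (measurable_fun_pair1 y mind).
    - by move=> x; rewrite indicE; case: (_ \in _); rewrite ?normr1 ?normr0.
  rewrite [in RHS]mulrC [in RHS]EFinM -mF; congr (_ * _)%E.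
  rewrite -[in RHS](setIT `]-oo, y[%classic) -integral_indic//.
have := @Fubini _ _ T1 T1 R m mu f fi.
have -> : (\int[m]_x \int[mu]_y f (x, y) = \int[m]_x (- phi x)%:E)%E.
  apply: eq_integral => x _; rewrite -I1 /Rintegral fineK//.
  apply: integrable_fin_num => //.
  apply: (@integrable_bounded_supp _ a b C).
  - apply: measurable_funM; last exact: continuous_measurable.
    exact: (measurable_fun_pair2 x mind).
  - move=> y; rewrite indicE normrM; case: (_ \in _); rewrite ?normr1 ?normr0 ?mul1r ?mul0r//.
  - by move=> y H; rewrite (d0 _ H) mulr0.
under [X in _ = X]eq_integral do rewrite I2.
move=> /(congr1 fine); rewrite -/(Rintegral mu setT _) -/(Rintegral m setT _) => <-.
have ip : m.-integrable setT (EFin \o phi).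
  have cF := is_derive_continuous _ _ dp.
  have [N N0 HN] := @continuous_bounded_itv _ phi a b cF.
  apply: (bounded_integrable _ T1 _ _ phi N) => //.
  - by rewrite ltey_eq fin_num_measure.
  - exact: continuous_measurable.
  - by move=> x; have [/HN//|/p0->] := pselect (`[a, b]%classic x); rewrite normr0.
transitivity (- \int[m]_x (-1 * phi x)); first by rewrite RintegralZl// mulN1r opprK.
by congr (- _); apply: eq_Rintegral => x _; rewrite mulN1r.
Qed.

(** Membership in the space D provides a weak derivative of [u] only. For [F] it is the
    Radon-Nikodym density of the measure. Its existence ensures that [wderiv] applied to [F] is a
    true weak derivative and not the default [cst 0], through which [slope_bound] would say nothing
    about [F]. *)
Lemma cdf_weak_derivative : exists g, weak_derivative F g.
Proof.
have cF := @lip_continuous _ F K K0 FK.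
exists cdf_density; split.
- exact: continuous_loc_integrable.
- apply: open_integrable_locally; first exact: openT.
  exact: cdf_density_integrable.
move=> phi [sphi cphi _].
have sp : smooth phi by [].
have [N [_ HN]] := compact_bounded cphi.
pose M := `|N| + 1.
have M0 : 0 < M by rewrite ltr_wpDl.
have out x : ~ `[- M, M]%classic x -> ~ supp phi x.
  move=> H H'; apply: H; rewrite /= in_itv/= -ler_norml.
  by apply: HN => //; rewrite /M (le_lt_trans (ler_norm _))// ltrDl.
have p0 x : ~ `[- M, M]%classic x -> phi x = 0.
  move=> /out H; apply/eqP; apply: contra_notT H => H.
  exact: subset_closure.
have dp (x : R) : is_derive x 1 phi ('D_1 phi x).
  by apply: derivableP; exact: smooth_derivable.
have d0 x : ~ `[- M, M]%classic x -> 'D_1 phi x = 0 by move=> /out; exact: derive_out_supp.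
have cd : continuous ('D_1 phi) by apply: smooth_cont; exact: smooth_D.
have [C C0 HC] := @continuous_bounded_itv _ _ (- M) M cd.
have dC x : `|'D_1 phi x| <= C.
  by have [/HC//|/d0->] := pselect (`[- M, M]%classic x); rewrite normr0.
rewrite cdf_density_int; last first.
  have cp : continuous phi by exact: smooth_cont.
  have [N' N'0 HN'] := @continuous_bounded_itv _ _ (- M) M cp.
  apply: (bounded_integrable _ (measurableTypeR R) _ _ phi N') => //.
  - by rewrite ltey_eq fin_num_measure.
  - exact: continuous_measurable.
  - by move=> x; have [/HN'//|/p0->] := pselect (`[- M, M]%classic x); rewrite normr0.
rewrite (@cdf_int phi ('D_1 phi) (- M) M C) ?opprK//.
by rewrite gtrN.
Qed.

End CDF.

(** * Lipschitz continuity from W^{1,oo} *)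

Section Plane.
Context {R : realType}.
Local Notation mu := (@lebesgue_measure R).
Local Notation rT := (measurableTypeR R).
Local Notation mu2 := (mu \x mu)%E.

Lemma smooth_fst_comp (p : R -> R) : smooth p -> smooth (fun z : R * R => p z.1).
Proof. by move=> sp; apply: smooth_comp => //; exact: smooth_fst. Qed.

Lemma smooth_snd_comp (p : R -> R) : smooth p -> smooth (fun z : R * R => p z.2).
Proof. by move=> sp; apply: smooth_comp => //; exact: smooth_snd. Qed.

Lemma derive_smooth_comp (p : R -> R) (q : R * R -> R) (z v : R * R) :
  smooth p -> smooth q ->
  is_derive z v (fun z => p (q z)) ('D_1 p (q z) * 'D_v q z).
Proof. by move=> sp sq; apply: is_derive_comp; exact: smooth_derivable. Qed.

Lemma derive_smoothM (p q : R * R -> R) (z v : R * R) :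
  smooth p -> smooth q ->
  'D_v (fun z => p z * q z) z = p z * 'D_v q z + q z * 'D_v p z.
Proof. by move=> sp sq; apply: deriveM; exact: smooth_derivable. Qed.

Lemma supp2_compact (f : R * R -> R) (a b c d : R) :
  (forall z, ~ (`[a, b] `*` `[c, d])%classic z -> f z = 0) ->
  compact (supp f) /\ supp f `<=` `[a, b] `*` `[c, d].
Proof.
move=> f0; pose A := (`[a, b] `*` `[c, d])%classic : set (R * R).
have cA : compact A by apply: compact_setX; exact: itv_compact.
have fs : supp f `<=` A.
  rewrite [X in _ `<=` X](closure_id _).1; last first.
    by apply: compact_closed => //; exact: norm_hausdorff.
  by apply: closure_subset => z /= /eqP fz; apply: contrapT => /f0.
by split => //; apply: (subclosed_compact _ cA) => //; exact: closed_closure.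
Qed.

Lemma prod_integral (p q : R -> R) :
  (forall x, 0 <= p x) -> (forall x, 0 <= q x) ->
  mu.-integrable setT (EFin \o p) -> mu.-integrable setT (EFin \o q) ->
  (\int[mu2]_z (p z.1 * q z.2)%:E = (\int[mu]_x p x * \int[mu]_x q x)%R%:E)%E.
Proof.
move=> p0 q0 ip iq.
have mp : measurable_fun setT (p : rT -> R) by apply/measurable_EFinP; case/integrableP: ip.
have mq : measurable_fun setT (q : rT -> R) by apply/measurable_EFinP; case/integrableP: iq.
have Iq : (\int[mu]_x (q x)%:E = (\int[mu]_x q x)%R%:E)%E.
  by rewrite /Rintegral fineK//; exact: integrable_fin_num iq.
have Ip : (\int[mu]_x (p x)%:E = (\int[mu]_x p x)%R%:E)%E.
  by rewrite /Rintegral fineK//; exact: integrable_fin_num ip.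
rewrite (fubini_tonelli1 (fun z : rT * rT => (p z.1 * q z.2)%:E))//=; last first.
- by move=> z; rewrite lee_fin mulr_ge0.
- by apply/measurable_EFinP; apply: measurable_funM; apply: measurableT_comp.
rewrite /fubini_F/=.
transitivity (\int[mu]_x ((\int[mu]_x q x)%R%:E * (p x)%:E)%E)%E.
  apply: eq_integral => x _; under eq_integral do rewrite EFinM.
  rewrite ge0_integralZl//=.
  - by rewrite Iq muleC.
  - by apply/measurable_EFinP.
  - by move=> y _; rewrite lee_fin.
  - by rewrite lee_fin.
rewrite ge0_integralZl//=; last 3 first.
- by apply/measurable_EFinP.
- by move=> x _; rewrite lee_fin.
- by rewrite lee_fin Rintegral_ge0.
by rewrite Ip -EFinM mulrC.
Qed.

Lemma prod_integrable (p q : R -> R) :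
  (forall x, 0 <= p x) -> (forall x, 0 <= q x) ->
  mu.-integrable setT (EFin \o p) -> mu.-integrable setT (EFin \o q) ->
  mu2.-integrable setT (EFin \o (fun z : rT * rT => p z.1 * q z.2)).
Proof.
move=> p0 q0 ip iq.
have mp : measurable_fun setT (p : rT -> R) by apply/measurable_EFinP; case/integrableP: ip.
have mq : measurable_fun setT (q : rT -> R) by apply/measurable_EFinP; case/integrableP: iq.
apply/integrableP; split.
  by apply/measurable_EFinP; apply: measurable_funM; apply: measurableT_comp.
under eq_integral => z _ do rewrite /= ger0_norm ?mulr_ge0//.
by rewrite prod_integral// ltry.
Qed.

Lemma hump_integrable (h c : R) : 0 < h -> mu.-integrable setT (EFin \o (hump_at h c)).
Proof.
move=> h0; have [K K0 /(_ h c _ h0) HK] := @hump_at_bound R.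
apply: (@integrable_bounded_supp _ c (c + h) (K * h^-1)).
- exact: smooth_measurable (smooth_hump_at _ _).
- by move=> x; have [] := HK x.
- by move=> x; exact: hump_at_out.
Qed.

Lemma plateau_integrable (h a b : R) : 0 < h -> a <= b - h ->
  mu.-integrable setT (EFin \o (plateau h a b)).
Proof.
move=> h0 ab; apply: (@integrable_bounded_supp _ a b 1).
- exact: smooth_measurable (smooth_plateau _ _ _).
- by move=> x; rewrite ger0_norm ?plateau_ge0// plateau_le1.
- by move=> x; exact: plateau_out.
Qed.

Lemma int_plateau (h a b : R) : 0 < h -> a <= b - h ->
  \int[mu]_x plateau h a b x <= b - a.
Proof.
move=> h0 ab; apply: le_trans (ler_norm _) _; rewrite -[b - a]mul1r.
apply: le_Rintegral_supp; first by lra.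
- exact: smooth_measurable (smooth_plateau _ _ _).
- by move=> x; rewrite ger0_norm ?plateau_ge0// plateau_le1.
- by move=> x; exact: plateau_out.
Qed.

Variables (T : R) (w : R -> R -> R).
Hypothesis T0 : 0 < T.
Hypothesis wW : W1infty T w.
Local Notation f := (fun z : R * R => w z.1 z.2).

Lemma W1infty_cont t x e : 0 <= t <= T -> 0 < e ->
  exists2 d, 0 < d & forall s y, 0 <= s <= T -> `|s - t| < d -> `|y - x| < d ->
    `|w s y - w t x| <= e.
Proof.
move=> tT e0; have [/subspace_continuousP cw _ _ _] := wW.
have A : ((`[0, T] `*` setT)%classic : set (R * R)) (t, x) by split => //=; rewrite in_itv.
have := cw _ A; move=> /cvgrPdist_le /(_ _ e0); rewrite near_withinE.
move=> /nbhs_ballP [d /= d0 Hd]; exists d => // s y sT st yx.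
rewrite distrC; apply: (Hd (s, y)); last by split => //=; rewrite in_itv.
by split; rewrite /ball/= distrC.
Qed.

Lemma open_strip_measurable : measurable (open_strip T : set (rT * rT)).
Proof. by apply: measurableX => //; exact: measurable_itv. Qed.

Lemma strip_measurable (g : rT * rT -> R) : Linfty_strip T g -> measurable_fun (open_strip T) g.
Proof.
rewrite /Linfty_strip => /sub_Lfun_mfun; rewrite inE => mg.
by apply/(measurable_restrictT _ open_strip_measurable).
Qed.

Lemma strip_bound (g : rT * rT -> R) : Linfty_strip T g ->
  exists2 K, 0 <= K & {ae mu2, forall z, open_strip T z -> `|g z| <= K}.
Proof.
rewrite /Linfty_strip => /sub_Lfun_finLfun; rewrite inE /= /finite_norm.
rewrite unlock /=; case: ifPn => [m0|]; last first.
  rewrite -leNgt measure_le0 => /eqP m0 _; exists 0 => //.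
  by exists setT; split => //; exact: measurableT.
set S := ess_sup _ _ => Sy.
have S0 : (0 <= S)%E by apply: ess_sup_gee => //; apply: aeW => z /=; rewrite lee_fin.
exists (fine S); first exact: fine_ge0.
have : (S <= (fine S)%:E)%E by rewrite fineK// ge0_fin_numE.
move=> /ess_supP H; apply: ae_imp H _ => z /=; rewrite lee_fin patchE => + zT.
by rewrite mem_set.
Qed.

Lemma W1infty_hump t x h k l e : 0 < t -> t + h < T -> 0 < h -> 0 < k -> 0 <= e ->
  (forall s y, t <= s <= t + h -> `[x, x + k]%classic y -> `|w s y - l| <= e) ->
  `|\int[mu2]_(z in open_strip T) (f z * (hump_at h t z.1 * hump_at k x z.2)) - l| <= e /\
  mu2.-integrable (open_strip T) (EFin \o (fun z => f z * (hump_at h t z.1 * hump_at k x z.2))).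
Proof.
move=> t0 tT h0 k0 e0 we.
pose J := fun z : rT * rT => hump_at h t z.1 * hump_at k x z.2.
have J0 z : 0 <= J z by rewrite mulr_ge0 ?hump_at_ge0.
have mS := open_strip_measurable.
have iJT : mu2.-integrable setT (EFin \o J).
  by apply: prod_integrable; [move=> y; exact: hump_at_ge0|move=> y; exact: hump_at_ge0
    |exact: hump_integrable|exact: hump_integrable].
have iJ : mu2.-integrable (open_strip T) (EFin \o J).
  exact: (@integrableS _ (rT * rT)%type R mu2 setT).
have IJ : \int[mu2]_(z in open_strip T) J z = 1.
  rewrite Rintegral_mkcond; transitivity (\int[mu2]_z J z).
    apply: eq_Rintegral => z _; rewrite patchE; case: ifPn => // /negP; rewrite inE => zT.
    rewrite /J hump_at_out ?mul0r//= in_itv/= => /andP[tz zt]; apply: zT.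
    by split => //=; rewrite in_itv/= (lt_le_trans t0 tz) (le_lt_trans zt tT).
  rewrite /Rintegral prod_integral/=; first by rewrite !int_hump_at// mulr1.
  - by move=> y; exact: hump_at_ge0.
  - by move=> y; exact: hump_at_ge0.
  - exact: hump_integrable.
  - exact: hump_integrable.
have Jw z : J z != 0 -> `|f z - l| <= e.
  move=> Jz; apply: we.
    apply: contraNT Jz => H; rewrite /J hump_at_out ?mul0r//= in_itv/=.
    exact/negP.
  by apply: contrapT => H; move/eqP: Jz; apply; rewrite /J [hump_at k x _]hump_at_out ?mulr0.
have mf : measurable_fun (open_strip T) (f : rT * rT -> R).
  by apply: strip_measurable; case: wW.
have ifJ : mu2.-integrable (open_strip T) (EFin \o (fun z => f z * J z)).
  have := integrable_rZ _ (rT * rT)%type mu2 (open_strip T) J (`|l| + e) mS iJ.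
  apply: le_integrable => //.
    apply/measurable_EFinP; apply: measurable_funM => //.
    by apply/measurable_EFinP; case/integrableP: iJ.
  move=> z _; change (`|f z * J z|%:E <= `|(`|l| + e) * J z|%:E)%E.
  rewrite lee_fin (normrM (f z)) (normrM (_ + e)).
  have [->|/Jw H] := eqVneq (J z) 0; first by rewrite normr0 !mulr0.
  rewrite ler_wpM2r// (@ger0_norm _ (_ + e)) ?addr_ge0//.
  have -> : w z.1 z.2 = l + (w z.1 z.2 - l) by ring.
  by rewrite (le_trans (ler_normD _ _))// lerD2l.
split; last exact: ifJ.
have -> : l = \int[mu2]_(z in open_strip T) (l * J z).
  by rewrite RintegralZl// IJ mulr1.
rewrite -RintegralB//; last exact: integrable_rZ.
have iD : mu2.-integrable (open_strip T) (EFin \o (fun z => f z * J z - l * J z)).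
  by apply: integrable_rB => //; exact: integrable_rZ.
apply: le_trans (le_normr_Rintegral mS iD) _.
have -> : e = \int[mu2]_(z in open_strip T) (e * J z).
  by rewrite RintegralZl// IJ mulr1.
apply: le_Rintegral => //; [exact: integrable_norm|exact: integrable_rZ|].
move=> z _; rewrite -mulrBl normrM (ger0_norm (J0 z)).
have [->|/Jw H] := eqVneq (J z) 0; first by rewrite !mulr0.
by rewrite ler_wpM2r.
Qed.

Lemma derive_tensor (p q : R -> R) z : smooth p -> smooth q ->
  'D_(0, 1) (fun z : R * R => p z.1 * q z.2) z = p z.1 * 'D_1 q z.2.
Proof.
move=> sp sq.
rewrite (@derive_smoothM (fun z => p z.1) (fun z => q z.2)); last 2 first.
- exact: smooth_fst_comp.
- exact: smooth_snd_comp.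
have [_ ->] := @derive_smooth_comp p fst z (0, 1) sp smooth_fst.
have [_ ->] := @derive_smooth_comp q snd z (0, 1) sq smooth_snd.
have [_ ->] := is_derive_fst z (0, 1); have [_ ->] := is_derive_snd z (0, 1).
by rewrite /= !mulr0 addr0 mulr1.
Qed.

Lemma dist_perturb (a b a' b' e c : R) : `|a - a'| <= e -> `|b - b'| <= e ->
  `|a - b| <= c -> `|a' - b'| <= c + (e + e).
Proof.
move=> ha hb hc; have -> : a' - b' = a - b - (a - a') + (b - b') by ring.
apply: le_trans (ler_normD _ _) _; rewrite addrA; apply: lerD => //.
by apply: le_trans (ler_normB _ _) _; exact: lerD.
Qed.

(** Test with a bump in time times a plateau on [[x, y]]: one side of the weak identity becomes a
    difference of averages of [w] near [(t, x)] and [(t, y)], the other is at most [K * (y - x)].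
    The support must lie in the open strip, hence [0 < t < T]. *)
Lemma W1infty_lip_open : exists2 K, 0 <= K & forall t x y, 0 < t < T ->
  `|w t x - w t y| <= K * `|x - y|.
Proof.
have [cw fL _ [g gL fg]] := wW.
have [K K0 gK] := strip_bound _ gL; exists K => // t x y /andP[t0 tT].
wlog xy : x y / x < y.
  move=> H; have [xy|xy|->] := ltgtP x y; first exact: H.
    by rewrite distrC [`|x - y|]distrC; exact: H.
  by rewrite !subrr normr0 mulr0.
have t0T : 0 <= t <= T by rewrite !ltW.
suff H e : 0 < e -> `|w t x - w t y| <= K * `|x - y| + (e + e).
  apply/ler_addgt0Pr => e e0; have := H (e / 2); rewrite -splitr; apply.
  by rewrite divr_gt0.
move=> e0.
have [dx dx0 Hx] := @W1infty_cont t x e t0T e0.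
have [dy dy0 Hy] := @W1infty_cont t y e t0T e0.
pose h := Num.min (Num.min dx dy) (Num.min (y - x) (T - t)) / 4.
have h0 : 0 < h by rewrite divr_gt0// !lt_min dx0 dy0 !subr_gt0 xy tT.
have [h1 h2 h3 h4] : [/\ 4 * h <= dx, 4 * h <= dy, 4 * h <= y - x & 4 * h <= T - t].
  by rewrite /h mulrC divfK// !ge_min !lexx /= ?orbT.
have hxy : x <= y - h by lra.
have thT : t + h < T by lra.
have sW s : t <= s <= t + h -> 0 <= s <= T /\ `|s - t| < 4 * h.
  move=> /andP[s1 s2]; have sh : s - t <= h by rewrite lerBlDl.
  rewrite (le_trans (ltW t0) s1) (le_trans s2 (ltW thT)) ger0_norm ?subr_ge0//.
  by split => //; apply: le_lt_trans sh _; rewrite ltr_pMl// ltr1n.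
have [Ex ix] : `|\int[mu2]_(z in open_strip T) (f z * (hump_at h t z.1 * hump_at h x z.2)) - w t x| <= e /\
  mu2.-integrable (open_strip T) (EFin \o (fun z => f z * (hump_at h t z.1 * hump_at h x z.2))).
  apply: W1infty_hump => //; first exact: ltW.
  move=> s z /sW[sT st]; rewrite /= in_itv/= => /andP[? ?]; apply: Hx => //.
    exact: lt_le_trans st _.
  by rewrite ltr_norml; apply/andP; lra.
have [Ey iy] : `|\int[mu2]_(z in open_strip T) (f z * (hump_at h t z.1 * hump_at h (y - h) z.2)) - w t y| <= e /\
  mu2.-integrable (open_strip T) (EFin \o (fun z => f z * (hump_at h t z.1 * hump_at h (y - h) z.2))).
  apply: W1infty_hump => //; first exact: ltW.
  move=> s z /sW[sT st]; rewrite /= in_itv/= => /andP[? ?]; apply: Hy => //.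
    exact: lt_le_trans st _.
  by rewrite ltr_norml; apply/andP; lra.
pose phi := fun z : R * R => hump_at h t z.1 * plateau h x y z.2.
have phi0 z : ~ (`[t, t + h] `*` `[x, y])%classic z -> phi z = 0.
  move=> H; rewrite /phi; have [z1|z1] := pselect (`[t, t + h]%classic z.1).
    have [z2|z2] := pselect (`[x, y]%classic z.2); first by exfalso; apply: H.
    by rewrite plateau_out// mulr0.
  by rewrite hump_at_out// mul0r.
have tphi : test_function (open_strip T) phi.
  have [cp sp] := supp2_compact _ _ _ _ _ phi0; split => //.
    by apply: smoothM; [apply: smooth_fst_comp; exact: smooth_hump_at|
      apply: smooth_snd_comp; exact: smooth_plateau].
  apply: (subset_trans sp) => z [/=]; rewrite !in_itv/= => /andP[? ?] _.
  by split => //=; rewrite in_itv/= (lt_le_trans t0)// (le_lt_trans _ thT).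
have := fg phi tphi.
have -> : \int[mu2]_(z in open_strip T) (f z * 'D_(0, 1) phi z) =
  \int[mu2]_(z in open_strip T) (f z * (hump_at h t z.1 * hump_at h x z.2)) -
  \int[mu2]_(z in open_strip T) (f z * (hump_at h t z.1 * hump_at h (y - h) z.2)).
  rewrite -RintegralB//; last exact: open_strip_measurable.
  apply: eq_Rintegral => z _; rewrite derive_tensor; last 2 first.
  - exact: smooth_hump_at.
  - exact: smooth_plateau.
  by rewrite derive_plateau; ring.
have phige0 z : 0 <= phi z by rewrite mulr_ge0 ?hump_at_ge0// plateau_ge0.
have Eg : `|\int[mu2]_(z in open_strip T) (g z * phi z)| <= K * (y - x).
  have mphi : measurable_fun (open_strip T) (phi : rT * rT -> R).
    apply: (@measurable_funS _ _ (rT * rT)%type R setT) => //.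
    apply: measurable_funM; apply: measurableT_comp => //; apply: smooth_measurable.
      exact: smooth_hump_at.
    exact: smooth_plateau.
  have mg : measurable_fun (open_strip T) (g : rT * rT -> R) by exact: strip_measurable.
  have mS := open_strip_measurable.
  have H1 : (`|\int[mu2]_(z in open_strip T) (g z * phi z)%:E| <= (K * (y - x))%:E)%E.
    apply: le_trans (le_abse_integral mu2 mS _) _.
      by apply/measurable_EFinP; exact: measurable_funM.
    apply: (@le_trans _ _ (\int[mu2]_(z in open_strip T) (K * phi z)%:E)%E).
      apply: ae_ge0_le_integral => //.
      - apply: measurableT_comp => //; apply/measurable_EFinP; exact: measurable_funM.
      - by move=> z _; rewrite lee_fin mulr_ge0.
      - by apply/measurable_EFinP; exact: measurable_funM.
      - apply: ae_imp gK _ => z H zT /=.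
        by rewrite lee_fin normrM (ger0_norm (phige0 z)) ler_wpM2r// H.
    under eq_integral do rewrite EFinM.
    rewrite ge0_integralZl//; last 2 first.
    - by apply/measurable_EFinP.
    - by move=> z _; rewrite lee_fin.
    rewrite EFinM lee_wpmul2l ?lee_fin//.
    apply: (@le_trans _ _ (\int[mu2]_z (phi z)%:E)%E).
      apply: ge0_subset_integral => //.
      - apply/measurable_EFinP; apply: measurable_funM; apply: measurableT_comp => //; apply: smooth_measurable.
          exact: smooth_hump_at.
        exact: smooth_plateau.
      - by move=> z _; rewrite lee_fin.
    rewrite (@prod_integral (hump_at h t) (plateau h x y)).
    - by rewrite lee_fin int_hump_at// mul1r int_plateau.
    - by move=> s; exact: hump_at_ge0.
    - by move=> s; exact: plateau_ge0.
    - exact: hump_integrable.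
    - exact: plateau_integrable.
  have Kyx : 0 <= K * (y - x) by rewrite mulr_ge0// subr_ge0 ltW.
  (* Infinite values are sent to 0 by [fine], so the bound also holds in those two cases. *)
  rewrite /Rintegral; move: H1; case: (integral _ _ _) => [r| |] H1.
  - by rewrite -lee_fin.
  - by have := Kyx; rewrite -(@normr0 _ R).
  - by have := Kyx; rewrite -(@normr0 _ R).
move: Ex Ey Eg; set A := Rintegral _ _ _; set B := Rintegral _ _ _; set C := Rintegral _ _ _.
move=> Ex Ey Eg EC; apply: (dist_perturb _ _ _ _ _ _ Ex Ey).
by rewrite EC normrN (@ltr0_norm _ (x - y)) ?subr_lt0// opprB.
Qed.

(** The end times are reached by continuity of [w] on the closed strip, with the same constant. *)
Lemma W1infty_lip : exists2 K, 0 <= K & forall t x y, 0 <= t <= T ->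
  `|w t x - w t y| <= K * `|x - y|.
Proof.
have [K K0 HK] := W1infty_lip_open; exists K => // t x y tT.
apply/ler_addgt0Pr => e e0.
have e2 : 0 < e / 2 by rewrite divr_gt0.
have [dx dx0 Hx] := @W1infty_cont t x (e / 2) tT e2.
have [dy dy0 Hy] := @W1infty_cont t y (e / 2) tT e2.
pose h := Num.min (Num.min dx dy) T / 4.
have h0 : 0 < h by rewrite divr_gt0// !lt_min dx0 dy0 T0.
have [h1 h2 h3] : [/\ 4 * h <= dx, 4 * h <= dy & 4 * h <= T].
  by rewrite /h mulrC divfK// !ge_min !lexx /= ?orbT.
have [s sT st] : exists2 s, 0 < s < T & `|s - t| <= h.
  move: tT => /andP[? ?]; have [tT2|tT2] := ltP t (T / 2).
    by exists (t + h); [apply/andP; lra|rewrite addrAC subrr add0r gtr0_norm].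
  by exists (t - h); [apply/andP; lra|rewrite addrAC subrr add0r normrN gtr0_norm].
have sT' : 0 <= s <= T by case/andP: sT => ? ?; rewrite !ltW.
have := Hx s x sT'; have := Hy s y sT'; rewrite !subrr !normr0.
move=> /(_ _ dy0) H1 /(_ _ dx0) H2.
have {}H1 : `|w s y - w t y| <= e / 2 by apply: H1; lra.
have {}H2 : `|w s x - w t x| <= e / 2 by apply: H2; lra.
rewrite [e](splitr e); exact: dist_perturb H2 H1 (HK s x y sT).
Qed.

End Plane.

(** * Measurability in time of integrals against a family of measures *)

Section Kernel.
Context {R : realType}.
Local Notation rT := (measurableTypeR R).
Variables (l : rT -> {measure set rT -> \bar R}) (C : R).
Hypothesis lray : forall x, measurable_fun setT (fun t : rT => l t `]-oo, x[%classic).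
Hypothesis lC : forall t, l t setT = C%:E.

Lemma l_fin t A : measurable A -> l t A \is a fin_num.
Proof.
move=> mA; rewrite ge0_fin_numE ?measure_ge0//.
apply: (@le_lt_trans _ _ (l t setT)); first by apply: le_measure; rewrite ?inE.
by rewrite lC ltry.
Qed.

Lemma measurable_total : measurable_fun setT (fun t : rT => l t setT).
Proof. by rewrite (_ : (fun t => _) = cst C%:E)//; apply/funext. Qed.

(** Dynkin's theorem on the rays []-oo, x[], which are stable under intersection and generate the
    Borel sets. The complement step uses that the total mass is the constant [C]. *)
Lemma measurable_l U : measurable U -> measurable_fun setT (fun t : rT => l t U).
Proof.
have E : @measurable _ rT = <<s @RGenInftyO.G R>> by exact: RGenInftyO.measurableE.
rewrite {1}E; move: U.
apply: (@dynkin_induction _ rT (@RGenInftyO.G R) (fun U => measurable_fun setT (fun t : rT => l t U))) => //.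
- move=> _ _ [x ->] [y ->]; exists (Num.min x y); apply/seteqP.
  by split => z /=; rewrite !in_itv/= lt_min => /andP.
- exact: measurable_total.
- by move=> _ [x ->]; exact: lray.
- move=> S mS iS.
  rewrite (_ : (fun t => _) = (fun t => l t setT - l t S)%E).
    by apply: emeasurable_funB => //; exact: measurable_total.
  apply/funext => t; rewrite -(setTD S) measureD ?setTI//.
  by rewrite ltey_eq l_fin.
- move=> S mS tS iS.
  rewrite (_ : (fun t => _) = (fun t => \sum_(0 <= i <oo) l t (S i))%E).
    by apply: ge0_emeasurable_sum => // i _ t _ _; exact: measure_ge0.
  by apply/funext => t; rewrite measure_bigcup//; apply: eq_eseriesl => i; rewrite in_setT.
Qed.

Definition lker (t : rT) : {measure set rT -> \bar R} := l t.

HB.instance Definition _ := isKernel.Build _ _ rT rT R lker measurable_l.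

Let lker_uub : measure_fam_uub lker.
Proof.
by exists (C + 1) => t; rewrite lC lte_fin ltrDl.
Qed.

HB.instance Definition _ := Kernel_isFinite.Build _ _ rT rT R lker lker_uub.

(** Adding [B] makes the integrand nonnegative; [B] times the total mass is subtracted
    afterwards. *)
Lemma measurable_kernel_Rintegral (k : rT * rT -> R) (B : R) :
  measurable_fun setT k -> (forall z, `|k z| <= B) ->
  measurable_fun setT (fun t : rT => \int[l t]_x k (t, x)).
Proof.
move=> mk kB.
have mB : measurable_fun setT (fun z : rT * rT => k z + B) by exact: measurable_funD.
have B0 z : 0 <= k z + B.
  by have := kB z; rewrite ler_norml => /andP[]; rewrite -subr_ge0 opprK.
have H : measurable_fun setT (fun t : rT => (\int[l t]_x (k (t, x) + B)%:E)%E).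
  apply: (measurable_fun_integral_finite_kernel (fun z => (k z + B)%:E) lker).
    by move=> z; rewrite lee_fin.
  exact/measurable_EFinP.
have ik t : (l t).-integrable setT (EFin \o (fun x => k (t, x))).
  apply: (bounded_integrable _ _ _ _ _ B) => //; first by rewrite lC ltry.
  exact: (measurable_fun_pair2 t mk).
have iB t : (l t).-integrable setT (EFin \o cst B).
  by apply: (bounded_integrable _ _ _ _ _ `|B|) => //; rewrite lC ltry.
rewrite (_ : (fun t => _) = (fun t => fine (\int[l t]_x (k (t, x) + B)%:E)%E - B * fine (l t setT))).
  apply: measurable_funB; first exact: measurableT_comp.
  by apply: measurable_funM => //; apply: measurableT_comp => //; exact: measurable_total.
apply/funext => t.
rewrite -[fine (integral _ _ _)]/(Rintegral _ _ _) RintegralD// Rintegral_cst//.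
by rewrite addrK.
Qed.

End Kernel.

(** * Characteristics of conservative solutions *)

Section Caratheodory.
Context {R : realType}.
Local Notation rT := (measurableTypeR R).

(** Carathéodory functions: rounding [x] down to the grid of mesh [1 / (n + 1)] gives a function
    made of countably many measurable pieces, and continuity in [x] lets the mesh tend to 0. *)
Lemma measurable_separately_continuous (f : R -> R -> R) :
  (forall x, measurable_fun setT (fun t : rT => f t x)) -> (forall t, continuous (f t)) ->
  measurable_fun setT (fun z : rT * rT => f z.1 z.2).
Proof.
move=> mf cf.
pose g (n : nat) (x : R) : R := (Num.floor (x * n.+1%:R))%:~R / n.+1%:R.
apply: (@measurable_fun_cvg _ (rT * rT)%type R setT (fun n (z : rT * rT) => f z.1 (g n z.2))).
  move=> n _ Y mY; rewrite setTI.
  rewrite (_ : _ @^-1` _ = \bigcup_(k : int)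
    ([set t : rT | Y (f t (k%:~R / n.+1%:R))] `*` [set x : rT | Num.floor (x * n.+1%:R) = k])).
    apply: countable_bigcupT_measurable => // k; apply: measurableX.
      have := mf (k%:~R / n.+1%:R) measurableT Y mY; by rewrite setTI.
    rewrite (_ : [set _ | _] = `[k%:~R / n.+1%:R, (k + 1)%:~R / n.+1%:R[%classic); first exact: measurable_itv.
    apply/seteqP; split => x /=; rewrite in_itv/= ler_pdivrMr// ltr_pdivlMr//.
      by move=> <-; exact: floor_itv.
    by move=> H; exact/floor_def.
  apply/seteqP; split => [z Yz|z [k _ [/= Yk kz]]]; last by rewrite /= /g kz.
  by exists (Num.floor (z.2 * n.+1%:R)).
move=> [t x] _ /=; apply: (cvg_comp (fun n => g n x) (f t)); last exact: cf.
apply/cvgrPdist_le => e e0; near=> n.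
have n0 : 0 < n.+1%:R :> R by [].
have gx : g n x <= x by rewrite ler_pdivrMr// floor_le.
rewrite ger0_norm ?subr_ge0//.
have : x < g n x + n.+1%:R^-1.
  by rewrite -[X in _ + X]mul1r -mulrDl ltr_pdivlMr// -[1]/(1%:~R) -intrD lt_succ_floor.
have : n.+1%:R^-1 <= e by apply: ltW; near: n; exact: (near_infty_natSinv_lt (PosNum e0)).
by move=> H1 H2; rewrite lerBlDl (le_trans (ltW H2))// lerD2l.
Unshelve. all: by end_near. Qed.

Lemma continuous2_measurable (g : R * R -> R) : continuous g ->
  measurable_fun setT (g : rT * rT -> R).
Proof.
move=> cg; rewrite (_ : g = fun z => g (z.1, z.2)); last by apply/funext => -[].
apply: (measurable_separately_continuous (fun t x => g (t, x))).
  move=> x; apply: continuous_measurable => t.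
  apply: (@continuous_comp _ _ _ (fun t : R => (t, x)) g); last exact: cg.
  move=> A [[B C] /= [tB xC] BCA]; apply: filterS tB => s Bs.
  by apply: BCA; split => //=; exact: nbhs_singleton.
move=> t x; apply: (@continuous_comp _ _ _ (fun x : R => (t, x)) g); last exact: cg.
move=> A [[B C] /= [tB xC] BCA]; apply: filterS xC => s Cs.
by apply: BCA; split => //=; exact: nbhs_singleton.
Qed.

End Caratheodory.

(** The bridge from the weak formulation, which yields inequalities averaged against bumps in time,
    to inequalities at almost every time: apply the former at Lebesgue points with shrinking
    bumps. *)
Lemma ae_hump_avg {R : realType} (B : R -> R) (B0 T : R) :
  locally_integrable setT B ->
  (forall s h, 0 <= s -> 0 < h <= 1 -> s + h <= T ->
    B0 <= \int[@lebesgue_measure R]_t (B t * hump_at h s t)) ->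
  {ae @lebesgue_measure R, forall t, 0 < t < T -> B0 <= B t}.
Proof.
move=> lB HB.
apply: ae_imp (lebesgue_differentiation lB) _ => t Bt /andP[t0 tT].
have [Kh Kh0 HK] := @hump_at_bound R.
apply/ler_addgt0Pr => e e0.
(* A bump of width [h] has height at most [Kh / h] and sits in the open ball of radius [2 * h]; this
   tolerance makes the total error exactly [e]. *)
have e1 : 0 < e / (2 * Kh) by rewrite divr_gt0// mulr_gt0.
have [d d0 Hd] := @lebesgue_pt_avg _ B t _ lB Bt e1.
pose h := Num.min (Num.min d (T - t)) 1 / 3.
have h0 : 0 < h by rewrite divr_gt0// !lt_min d0 subr_gt0 tT ltr01.
have [h1 h2 h3] : [/\ 3 * h <= d, 3 * h <= T - t & 3 * h <= 1].
  by rewrite /h mulrC divfK// !ge_min !lexx /= ?orbT.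
have hh : 0 < h <= 1 by apply/andP; lra.
have hT : t + h <= T by lra.
have := HB t h (ltW t0) hh hT.
have rd : 0 < 2 * h < d by apply/andP; lra.
have mh : measurable_fun setT (hump_at h t) by exact: smooth_measurable (smooth_hump_at _ _).
have hb x : `|hump_at h t x| <= Kh * h^-1 by have [] := HK h t x h0.
have ho x : ~ ball t (2 * h) x -> hump_at h t x = 0.
  move=> H; apply: hump_at_out => //= H'; apply: H; move: H'.
  by rewrite in_itv/= /ball/= ltr_norml => /andP[? ?]; apply/andP; lra.
have := Hd (2 * h) _ (hump_at h t) rd mh hb ho.
rewrite int_hump_at// mulr1.
have -> : Kh * h^-1 * (e / (2 * Kh) * (2 * h)) = e by field; rewrite !gt_eqF.
move: (Rintegral _ _ _) => I; rewrite ler_norml => /andP[_ H1] H2.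
by rewrite (le_trans H2)// -lerBlDl.
Qed.

Lemma test_bounded {R : realType} (phi : R * R -> R) (w : R * R) (a b c d : R) : smooth phi ->
  (forall z, ~ (`[a, b] `*` `[c, d])%classic z -> phi z = 0) ->
  [/\ measurable_fun setT ('D_w phi : measurableTypeR R * measurableTypeR R -> R),
    forall z, ~ (`[a, b] `*` `[c, d])%classic z -> 'D_w phi z = 0 &
    exists2 C, 0 <= C & forall z, `|'D_w phi z| <= C].
Proof.
move=> sp p0; have [cp ss] := @supp2_compact _ phi a b c d p0.
have cD : continuous ('D_w phi) by apply: smooth_cont; exact: smooth_D.
have D0 z : ~ (`[a, b] `*` `[c, d])%classic z -> 'D_w phi z = 0.
  by move=> H; apply: derive_out_supp => /ss.
split => //.
  exact: continuous2_measurable.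
have cA : compact ((`[a, b] `*` `[c, d])%classic : set (R * R)).
  by apply: compact_setX; exact: itv_compact.
have [C0 [_ HC]] := compact_bounded (continuous_compact (continuous_subspaceT cD) cA).
exists (`|C0| + 1); first by rewrite addr_ge0.
move=> z; have [zab|zab] := pselect ((`[a, b] `*` `[c, d])%classic z).
  by apply: (HC (`|C0| + 1)); [rewrite (le_lt_trans (ler_norm _))// ltrDl|exists z].
by rewrite D0// normr0 addr_ge0.
Qed.

Lemma smooth_line {R : realType} (c d : R) : smooth (fun t : R => c + d * t).
Proof.
apply: smoothD; first exact: smooth_cst.
by apply: smoothM; [exact: smooth_cst|exact: smooth_id].
Qed.

Lemma derive_line {R : realType} (c d t : R) : 'D_1 (fun t : R => c + d * t) t = d.
Proof.
have H : is_derive t 1 (fun t : R => c + d * t) (0 + d *: 1).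
  by apply: is_deriveD; apply: is_deriveZ; exact: is_derive_id.
by have [_ ->] := H; rewrite add0r [_ *: _]mulr1.
Qed.

Lemma measurable_Rintegral2 {R : realType} (k : R * R -> R) :
  measurable_fun setT (k : measurableTypeR R * measurableTypeR R -> R) ->
  measurable_fun setT (fun t : measurableTypeR R => \int[@lebesgue_measure R]_x k (t, x)).
Proof.
move=> mk; have mE : measurable_fun setT (EFin \o (k : measurableTypeR R * measurableTypeR R -> R)).
  exact/measurable_EFinP.
pose kE : measurableTypeR R * measurableTypeR R -> \bar R := EFin \o k.
pose I (g : measurableTypeR R * measurableTypeR R -> \bar R) := fubini_F (@lebesgue_measure R) g.
rewrite (_ : (fun t => _) = fine \o (fun t => (I kE^\+ t - I kE^\- t)%E)); last first.
  apply/funext => t; rewrite /Rintegral [X in fine X]integralE; congr (fine (_ - _)%E).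
    by apply: eq_integral => x _; rewrite !funeposE.
  by apply: eq_integral => x _; rewrite !funenegE.
apply: measurableT_comp => //; apply: emeasurable_funB.
  apply: measurable_fun_fubini_tonelli_F => //; exact: measurable_funepos.
apply: measurable_fun_fubini_tonelli_F => //; exact: measurable_funeneg.
Qed.

Lemma FTC_smooth {R : realType} (f : R -> R) a b : smooth f -> a < b ->
  \int[@lebesgue_measure R]_(x in `[a, b]) 'D_1 f x = f b - f a.
Proof.
move=> sf ab; rewrite /Rintegral (@continuous_FTC2 _ ('D_1 f) f)//.
- by apply: continuous_subspaceT; apply: smooth_cont; exact: smooth_D.
- split; first by move=> x _; exact: smooth_derivable sf.
    by apply: cvg_at_right_filter; exact: smooth_cont.
  by apply: cvg_at_left_filter; exact: smooth_cont.
- by move=> x _; rewrite derive1E.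
Qed.

Lemma hump_at_shift {R : realType} (e c x : R) : hump_at e 0 (x - c) = hump_at e c x.
Proof. by rewrite /hump_at mulr0 subr0 mulrBr. Qed.

Lemma dhump_at_shift {R : realType} (e c x : R) : dhump_at e 0 (x - c) = dhump_at e c x.
Proof. by rewrite /dhump_at mulr0 subr0 mulrBr. Qed.

Lemma Rintegral_half {R : realType} (f : R -> R) b : (forall x, b < x -> f x = 0) ->
  \int[@lebesgue_measure R]_(x in `[0, +oo[) f x = \int[@lebesgue_measure R]_(x in `[0, b]) f x.
Proof.
move=> f0; rewrite Rintegral_mkcond [RHS]Rintegral_mkcond; congr (Rintegral _ _ _).
apply/funext => x; rewrite /patch !mem_setE !in_itv/= andbT.
by case: (leP 0 x) => //= _; case: (leP x b) => // /f0.
Qed.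

(** One explicit family for the characteristics, the barriers at exponential distance from them, and
    the majorants of the momentum. There are two exponential terms because the flux error grows with
    both rates [2 * lam] and [lam]. *)
Definition exp_poly {R : realType} (y a b A l A' l' t : R) : R :=
  y + a * t + b * t ^+ 2 + A * expR (l * t) + A' * expR (l' * t).

Lemma smooth_exp_poly {R : realType} (y a b A l A' l' : R) : smooth (exp_poly y a b A l A' l').
Proof.
have sl k : smooth (fun t : R => k * t) by apply: smoothM; [exact: smooth_cst|exact: smooth_id].
have se B k : smooth (fun t : R => B * expR (k * t)).
  by apply: smoothM; [exact: smooth_cst|apply: smooth_comp; [exact: smooth_expR|exact: sl]].
rewrite (_ : exp_poly _ _ _ _ _ _ _ = fun t : R => y + a * t + b * (t * t) + A * expR (l * t)
   + A' * expR (l' * t)); last by apply/funext => t; rewrite /exp_poly expr2.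
apply: smoothD => //; apply: smoothD => //; apply: smoothD.
  by apply: smoothD => //; exact: smooth_cst.
by apply: smoothM; [exact: smooth_cst|apply: smoothM; exact: smooth_id].
Qed.

Lemma derive_exp_poly {R : realType} (y a b A l A' l' t : R) :
  'D_1 (exp_poly y a b A l A' l') t =
  a + 2 * b * t + A * l * expR (l * t) + A' * l' * expR (l' * t).
Proof.
have dl (k : R) : is_derive t 1 (fun t : R => k * t) k.
  by apply: is_derive_eq (is_deriveZ k (is_derive_id t 1)) _; rewrite [_ *: _]mulr1.
have de (B k : R) : is_derive t 1 (fun t : R => B * expR (k * t)) (B * k * expR (k * t)).
  apply: is_derive_eq (is_deriveZ B (@is_derive1_comp _ expR (fun t => k * t) _ _ _ (is_derive_expR (k * t)) (dl k))) _.
  by rewrite [_ *: _]mulrA mulrAC.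
have dq : is_derive t 1 (fun t : R => b * t ^+ 2) (2 * b * t).
  rewrite (_ : (fun _ => _) = fun t => b * (t * t)); last by apply/funext => s; rewrite expr2.
  apply: is_derive_eq (is_deriveZ b (is_deriveM (is_derive_id t (1:R)) (is_derive_id t (1:R)))) _.
  by rewrite (_ : t%:A = t); [rewrite [_ *: _]mulrDr -mulrDl -mulr2n mulr_natl|exact: mulr1].
have dy : is_derive t 1 (fun t : R => y + a * t) (0 + a) by exact: is_deriveD.
have [_ ->] : is_derive t 1 (exp_poly y a b A l A' l')
    (0 + a + 2 * b * t + A * l * expR (l * t) + A' * l' * expR (l' * t)).
  by do 3!apply: is_deriveD.
by rewrite add0r.
Qed.

Section Characteristics.
Context {R : realType}.
Variables (Finf : R) (u0 F0 : R -> R).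

Definition char_x (t y : R) : R := y + u0 y * t + 4^-1 * (F0 y - 2^-1 * Finf) * t ^+ 2.
Definition char_v (t y : R) : R := u0 y + 2^-1 * (F0 y - 2^-1 * Finf) * t.

Lemma char_xE y A l t :
  exp_poly y (u0 y) (4^-1 * (F0 y - 2^-1 * Finf)) A l 0 0 t = char_x t y + A * expR (l * t).
Proof. by rewrite /exp_poly mul0r addr0. Qed.

Lemma derive_char_x y A l t :
  'D_1 (exp_poly y (u0 y) (4^-1 * (F0 y - 2^-1 * Finf)) A l 0 0) t =
  char_v t y + A * l * expR (l * t).
Proof. by rewrite derive_exp_poly /char_v !mul0r addr0; congr (_ + _); field. Qed.

Lemma char_x0 y : char_x 0 y = y.
Proof. by rewrite /char_x expr0n /= !mulr0 !addr0. Qed.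

Lemma char_v0 y : char_v 0 y = u0 y.
Proof. by rewrite /char_v mulr0 addr0. Qed.

End Characteristics.

Lemma ae_le0_cont {R : realType} (f : R -> R) (T : R) : 0 < T -> continuous f ->
  {ae @lebesgue_measure R, forall t, 0 < t < T -> f t <= 0} -> forall t, 0 <= t <= T -> f t <= 0.
Proof.
move=> T0 cf Hf t /andP[t0 tT]; rewrite leNgt; apply/negP => ft.
have /(_ _ _ ft) H := @cvgr_gt _ _ _ _ _ _ (cf t).
have [d d0 Hd] := (nbhs_ballP _ _).1 H; have {}d0 : 0 < d by [].
have ab : Num.max 0 (t - d) < Num.min T (t + d).
  have H1 : 0 < t + d by rewrite (le_lt_trans t0)// ltrDl.
  have H2 : t - d < T by rewrite ltrBlDr (le_lt_trans tT)// ltrDl.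
  have H3 : t - d < t + d by rewrite ltrBlDr -addrA ltrDl addr_gt0.
  by rewrite gt_max !lt_min T0 H1 H2 H3.
have [s /andP[s1 s2] Ps] := ae_dense _ _ _ Hf ab.
move: s1 s2; rewrite gt_max lt_min => /andP[s0 s1] /andP[sT s2].
have := Ps; rewrite s0 sT => /(_ isT); apply/negP; rewrite -ltNge; apply: Hd.
by rewrite /ball/= ltr_norml; apply/andP; split; lra.
Qed.

(** The closing arithmetic of [core_v_ae] with the exponentials abstracted: [w1] and [w2] are the
    bump averages at times [t] and 0, [v1] and [u] the velocities that they approximate, and the
    last two hypotheses are the momentum bounds for the signs 1 and -1. *)
Lemma core_balance {R : realType} (al ga a1 a2 be t T w1 w2 v1 u g A L eps : R) :
  0 <= a1 -> 0 <= a2 -> be * t <= be * T -> 0 <= al -> 0 <= ga ->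
  `|w1 - v1| <= L * (eps + 4 * A) -> `|w2 - u| <= L * eps ->
  1 * w1 - ((1 * g + be) * t + a1 + a2) <= 1 * w2 - (al + ga) ->
  -1 * w1 - ((-1 * g + be) * t + a1 + a2) <= -1 * w2 - (al + ga) ->
  `|v1 - (u + g * t)| <= 2 * (L * eps) + be * T + 4 * (L * A) + a1 + a2.
Proof.
rewrite !mul1r !mulN1r ![(_ + be) * t]mulrDl (mulrDr L) (mulrCA L) mulNr !ler_norml.
move: (be * t) (be * T) (g * t) (L * eps) (L * A) => b1 b2 c p q.
by move=> ? ? ? ? ? /andP[? ?] /andP[? ?] ? ?; apply/andP; split; lra.
Qed.

(** Used with [n = 1] for the acceleration, of factor 1/2, and with [n = 3] for the displacement, of
    factor 1/4. *)
Lemma centered_bound {R : realType} (f F : R) n : 0 <= f -> f <= F ->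
  `|n.+1%:R^-1 * (f - 2^-1 * F)| <= F.
Proof.
move=> f0 fF; rewrite normrM ger0_norm ?invr_ge0//.
have h : `|f - 2^-1 * F| <= F by rewrite ler_norml; apply/andP; split; lra.
by apply: le_trans h; rewrite ler_piMl// invf_le1 ?ler1n.
Qed.

Lemma derive_cutoff {R : realType} (a : R -> R) (g : R * R -> R) t x w : smooth a -> smooth g ->
  'D_w (fun z : R * R => a z.1 * g z) (t, x) = a t * 'D_w g (t, x) + g (t, x) * ('D_1 a t * w.1).
Proof.
move=> sa sg; rewrite (@derive_smoothM _ (fun z => a z.1) g)//; last exact: smooth_fst_comp.
have [_ ->] := @derive_smooth_comp _ a fst (t, x) w sa smooth_fst.
by have [_ ->] := is_derive_fst (t, x) w.
Qed.

Lemma derive_moving {R : realType} (f c : R -> R) t x w : smooth f -> smooth c ->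
  'D_w (fun z : R * R => f (z.2 - c z.1)) (t, x) = 'D_1 f (x - c t) * (w.2 - 'D_1 c t * w.1).
Proof.
move=> sf sc; have sq : smooth (fun z : R * R => z.2 - c z.1).
  by apply: smoothB; [exact: smooth_snd|exact: smooth_fst_comp].
have [_ ->] := @derive_smooth_comp _ f _ (t, x) w sf sq; congr (_ * _).
rewrite deriveB; [|exact: smooth_derivable smooth_snd|exact: smooth_derivable (smooth_fst_comp c sc)].
have [_ ->] := is_derive_snd (t, x) w.
have [_ ->] := @derive_smooth_comp _ c fst (t, x) w sc smooth_fst.
by have [_ ->] := is_derive_fst (t, x) w.
Qed.

(** * Consequences of the weak equations for one conservative solution *)

Section Solution.
Context {R : realType}.
Local Notation mu := (@lebesgue_measure R).
Local Notation rT := (measurableTypeR R).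
Variables (Finf : R) (u0 F0 : R -> R) (v G : R -> R -> R).
Variable m : R -> {finite_measure set (measurableTypeR R) -> \bar R}.
Hypothesis v0 : v 0 =1 u0.
Hypothesis G0 : G 0 =1 F0.
Hypothesis vH : forall T, 0 <= T -> holder_half T v.
Hypothesis vD : forall t, 0 <= t -> inD Finf (v t) (G t).
Hypothesis mG : measurable_fun ([set z | 0 <= z.1] : set (R * R)) (fun z => G z.1 z.2).
Hypothesis mE : forall t x, 0 <= t -> m t `]-oo, x[%classic = (G t x)%:E.
Hypothesis weakm : forall phi : R * R -> R, test_function setT phi ->
  \int[mu]_(t in `[0, +oo[) (\int[m t]_x
    ('D_(1, 0) phi (t, x) + v t x * 'D_(0, 1) phi (t, x)))
  + \int[m 0]_x phi (0, x) = 0.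
Hypothesis weakv : forall phi : R * R -> R, test_function setT phi ->
  \int[mu]_(t in `[0, +oo[) (\int[mu]_x
    ('D_(1, 0) phi (t, x) * v t x + 2^-1 * 'D_(0, 1) phi (t, x) * v t x ^+ 2
     + phi (t, x) * (2^-1 * G t x - 4^-1 * Finf)))
  + \int[mu]_x (phi (0, x) * u0 x) = 0.

Lemma sol_bound T : 0 <= T -> exists2 B, 0 < B & forall t x, 0 <= t <= T -> `|v t x| <= B.
Proof.
move=> T0; have [[B HB] _] := vH _ T0; exists (`|B| + 1); first by rewrite ltr_wpDl.
move=> t x tT; apply: (@le_trans _ _ B); first by apply: HB; rewrite in_itv.
by rewrite (le_trans (ler_norm B))// lerDl.
Qed.

Lemma sol_cont t x e : 0 <= t -> 0 < e ->
  exists2 d, 0 < d & forall s y, 0 <= s -> `|s - t| < d -> `|y - x| < d ->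
    `|v s y - v t x| <= e.
Proof.
move=> t0 e0; have t1 : 0 <= t + 1 by rewrite addr_ge0.
have [_ [K HK]] := vH _ t1.
have K0 : 0 < `|K| + 1 by rewrite ltr_wpDl.
pose d := Num.min 1 ((e / (`|K| + 1)) ^+ 2).
have d0 : 0 < d by rewrite lt_min ltr01 exprn_gt0// divr_gt0.
exists d => // s y s0 st yx.
have st1 : `|s - t| < 1 by rewrite (lt_le_trans st)// ge_min lexx.
have tin : t \in `[0, t + 1]%R by rewrite in_itv/= t0 lerDl ler01.
have sin : s \in `[0, t + 1]%R.
  by rewrite in_itv/= s0/=; move: st1; rewrite ltr_norml => /andP[]; lra.
apply: le_trans (HK s t y x sin tin) _.
have nd : `|(s, y) - (t, x)| <= (e / (`|K| + 1)) ^+ 2.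
  apply: (@le_trans _ _ d); last by rewrite ge_min lexx orbT.
  by rewrite -[`|_ - _|]/(Num.max `|s - t| `|y - x|) ge_max !ltW.
apply: (@le_trans _ _ ((`|K| + 1) * (e / (`|K| + 1)))); last first.
  by rewrite mulrC divfK// gt_eqF.
apply: (@le_trans _ _ ((`|K| + 1) * Num.sqrt `|(s, y) - (t, x)|)).
  by rewrite ler_wpM2r// (le_trans (ler_norm K))// lerDl.
rewrite ler_wpM2l ?(ltW K0)// -[leRHS]ger0_norm ?divr_ge0 ?(ltW e0) ?(ltW K0)//.
by rewrite -sqrtr_sqr ler_sqrt// sqr_ge0.
Qed.

Lemma sol_cont_x t : 0 <= t -> continuous (v t).
Proof. by move=> t0; exact: inD_cont (vD _ t0). Qed.

Lemma mass_total t : 0 <= t -> m t setT = Finf%:E.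
Proof.
move=> t0; have D := vD _ t0.
have H : (m t `]-oo, (n%:R : R)[%classic) @[n --> \oo] --> m t setT.
  have -> : [set: rT] = \bigcup_n `]-oo, (n%:R : R)[%classic.
    apply/seteqP; split => // x _; exists (Num.bound `|x|) => //.
    by rewrite /= in_itv/=; exact: le_lt_trans (ler_norm x) (archi_boundP (normr_ge0 x)).
  apply: nondecreasing_cvg_mu => //.
  - exact: bigcup_measurable.
  - move=> n k nk; apply/subsetPset => x /=; rewrite !in_itv/= => /lt_le_trans; apply.
    by rewrite ler_nat.
apply: (cvg_unique _ H) => //.
apply: (@cvg_trans _ ((G t n%:R)%:E @[n --> \oo])).
  by apply: near_eq_cvg; near=> n; rewrite mE.
apply: cvg_EFin; first by near=> n.
apply/cvgrPdist_le => e e0; have [N HN] := inD_large D _ e0.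
near=> n; rewrite ger0_norm ?subr_ge0 ?(inD_le D)//=.
suff : G t N <= G t n%:R by lra.
apply: (inD_homo D); apply: le_trans (ler_norm N) _; apply: ltW.
by near: n; exact: nbhs_infty_gtr.
Unshelve. all: by end_near. Qed.

(** Values at negative times are arbitrary. Freezing time at 0 gives families defined on the whole
    line, measurable in time, that agree with the solution for [t >= 0]. *)
Definition mext (t : rT) : {measure set rT -> \bar R} := m (Num.max t 0).
Definition vext (t x : R) : R := v (Num.max t 0) x.

Lemma max0_lip (s t : R) : `|Num.max s 0 - Num.max t 0| <= `|s - t|.
Proof.
have : - `|s - t| <= s - t <= `|s - t| by rewrite -ler_norml.
move=> /andP[]; have := normr_ge0 (s - t); move: (`|s - t|) => d ? ? ?.
rewrite /Num.max; case: ltP => s0; case: ltP => t0; rewrite ler_norml; apply/andP; split; lra.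
Qed.

Lemma max0_ge0 (t : R) : 0 <= Num.max t 0. Proof. by rewrite le_max lexx orbT. Qed.

Lemma max0_id (t : R) : 0 <= t -> Num.max t 0 = t. Proof. by move=> ?; apply/max_idPl. Qed.

Lemma mext_ray x : measurable_fun setT (fun t : rT => mext t `]-oo, x[%classic).
Proof.
rewrite (_ : (fun t => _) = fun t => (G (Num.max t 0) x)%:E); last first.
  by apply/funext => t; apply: mE; exact: max0_ge0.
apply/measurable_EFinP.
have h : measurable_fun setT (fun t : R => (Num.max t 0, x)).
  by apply: measurable_fun_pair => //; exact: measurable_maxr.
apply: (measurable_comp _ _ mG h).
  rewrite (_ : [set z | _] = fst @^-1` `[0, +oo[%classic).
    by rewrite -[X in measurable X]setTI; apply: measurable_fst => //; exact: measurable_itv.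
  by apply/seteqP; split => z /=; rewrite in_itv/= andbT.
by move=> _ [t _ <-] /=; exact: max0_ge0.
Qed.

Lemma mext_total t : mext t setT = Finf%:E.
Proof. by apply: mass_total; exact: max0_ge0. Qed.

Lemma measurable_vext : measurable_fun setT (fun z : rT * rT => vext z.1 z.2).
Proof.
apply: measurable_separately_continuous; last first.
  by move=> t; apply: sol_cont_x; exact: max0_ge0.
move=> x; apply: continuous_measurable => t; apply/cvgrPdist_le => e e0.
have [d d0 Hd] := @sol_cont (Num.max t 0) x e (max0_ge0 t) e0.
apply/nbhs_ballP; exists d => // s st; rewrite distrC; apply: Hd.
- exact: max0_ge0.
- apply: le_lt_trans st; rewrite [leRHS]distrC.
  exact: max0_lip.
- by rewrite subrr normr0.
Qed.

(** * Transport of the energy between two barrier curves *)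

Section Mono.
Variables (T rho : R) (p1 p2 : R -> R).
Hypothesis T0 : 0 < T.
Hypothesis rho0 : 0 < rho.
Hypothesis sp1 : smooth p1.
Hypothesis sp2 : smooth p2.
Hypothesis vp1 : forall t x, 0 <= t <= T -> p1 t <= x <= p1 t + rho -> 'D_1 p1 t <= v t x.
Hypothesis vp2 : forall t x, 0 <= t <= T -> p2 t - rho <= x <= p2 t -> v t x <= 'D_1 p2 t.

(** A smoothed indicator of the region between [p1] and [p2], with ramps of width [rho] inside it.
    [vp1] and [vp2] compare the velocities of flow and edge exactly on these ramps. *)
Definition window (z : R * R) := step_at rho 0 (z.2 - p1 z.1) * step_at rho 0 (p2 z.1 - z.2).

Lemma window_ge0 z : 0 <= window z.
Proof. by rewrite mulr_ge0// step_at_ge0. Qed.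

Lemma window_le1 z : window z <= 1.
Proof. by rewrite mulr_ile1// ?step_at_ge0// step_at_le1. Qed.

Lemma smooth_window : smooth window.
Proof.
apply: smoothM; apply: smooth_comp; try exact: smooth_step_at; apply: smoothB;
  try exact: smooth_snd; exact: smooth_fst_comp.
Qed.

Lemma window_out z : ~ `[p1 z.1, p2 z.1]%classic z.2 -> window z = 0.
Proof.
move=> /negP; rewrite /= in_itv/= negb_and -!ltNge => /orP[H|H]; rewrite /window.
  by rewrite step_at0 ?mul0r// subr_le0 ltW.
by rewrite [X in _ * X]step_at0 ?mulr0// subr_le0 ltW.
Qed.

(* The edges of the window move inwards relative to the flow. *)
Lemma window_transport t x : 0 <= t <= T ->
  0 <= 'D_(1, 0) window (t, x) + v t x * 'D_(0, 1) window (t, x).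
Proof.
move=> tT.
have D w : 'D_w window (t, x) =
  step_at rho 0 (x - p1 t) * (hump_at rho 0 (p2 t - x) * ('D_1 p2 t * w.1 - w.2)) +
  step_at rho 0 (p2 t - x) * (hump_at rho 0 (x - p1 t) * (w.2 - 'D_1 p1 t * w.1)).
  have ss := @smooth_step_at R rho 0.
  have sn : smooth (fun y => step_at rho 0 (- y)).
    by apply: smooth_comp => //; apply: smoothN; exact: smooth_id.
  have Dh y : 'D_1 (step_at rho 0) y = hump_at rho 0 y by case: (is_derive_step_at rho 0 y).
  have Dn y : 'D_1 (fun y => step_at rho 0 (- y)) y = - hump_at rho 0 (- y).
    have [_ ->] := @is_derive_comp R _ (step_at rho 0) (fun y : R => - y) y 1
      (smooth_derivable _ _ _ (smoothN _ smooth_id)) (smooth_derivable _ _ _ ss).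
    by rewrite Dh deriveN// derive_id mulrN1.
  rewrite (_ : window = fun z => step_at rho 0 (z.2 - p1 z.1) * step_at rho 0 (- (z.2 - p2 z.1))); last first.
    by apply/funext => z; rewrite /window opprB.
  have sm f c : smooth f -> smooth c -> smooth (fun z : R * R => f (z.2 - c z.1)).
    by move=> ? ?; apply: smooth_comp => //; apply: smoothB; [exact: smooth_snd|exact: smooth_fst_comp].
  rewrite derive_smoothM; [|exact: sm|exact: (sm (fun y => step_at rho 0 (- y)))].
  rewrite (@derive_moving _ (fun y => step_at rho 0 (- y)))// derive_moving// Dh Dn /= opprB.
  by rewrite mulNr -mulrN opprB.
have alg (s1 h2 d2 s2 h1 d1 w : R) :
  s1 * (h2 * (d2 * 1 - 0)) + s2 * (h1 * (0 - d1 * 1)) +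
  w * (s1 * (h2 * (d2 * 0 - 1)) + s2 * (h1 * (1 - d1 * 0))) =
  s1 * (h2 * (d2 - w)) + s2 * (h1 * (w - d1)) by ring.
rewrite !D alg.
apply: addr_ge0; apply: mulr_ge0; rewrite ?step_at_ge0//.
  have [H|H] := pselect (`[0, 0 + rho]%classic (p2 t - x)); last first.
    by rewrite hump_at_out// mul0r.
  rewrite mulr_ge0 ?hump_at_ge0// subr_ge0 vp2//.
  by move: H; rewrite /= in_itv/= => /andP[? ?]; apply/andP; split; lra.
have [H|H] := pselect (`[0, 0 + rho]%classic (x - p1 t)); last first.
  by rewrite hump_at_out// mul0r.
rewrite mulr_ge0 ?hump_at_ge0// subr_ge0 vp1//.
by move: H; rewrite /= in_itv/= => /andP[? ?]; apply/andP; split; lra.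
Qed.

Lemma mass_integrable t (k : R -> R) (C : R) : measurable_fun setT (k : rT -> R) ->
  (forall x, `|k x| <= C) -> (m t).-integrable setT (EFin \o k).
Proof.
by move=> mk kC; apply: (bounded_integrable _ _ _ _ _ C) => //; rewrite ltey_eq fin_num_measure.
Qed.

Lemma le_mass_Rintegral t (k : R -> R) (C : R) : 0 <= t -> measurable_fun setT (k : rT -> R) ->
  (forall x, `|k x| <= C) -> `|\int[m t]_x k x| <= C * Finf.
Proof.
move=> t0 mk kC; have ik := @mass_integrable t k C mk kC.
apply: le_trans (le_normr_Rintegral measurableT ik) _.
have C0 : 0 <= C by exact: le_trans (kC 0).
have iC : (m t).-integrable setT (EFin \o cst C).
  by apply: (@mass_integrable t _ C) => // x; rewrite ger0_norm.
have -> : C * Finf = \int[m t]_x cst C x.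
  by rewrite Rintegral_cst//= mass_total.
by apply: le_Rintegral => //; exact: integrable_norm.
Qed.

Definition window_mass (t : R) : R := \int[mext t]_x window (t, x).

Lemma measurable_window : measurable_fun setT (window : rT * rT -> R).
Proof. by apply: continuous2_measurable; exact: smooth_cont smooth_window. Qed.

Lemma window_norm_le1 z : `|window z| <= 1.
Proof. by rewrite ger0_norm ?window_ge0// window_le1. Qed.

Lemma measurable_window_mass : measurable_fun setT window_mass.
Proof.
exact: (@measurable_kernel_Rintegral _ mext Finf mext_ray mext_total window 1
  measurable_window window_norm_le1).
Qed.

Lemma window_mass_bound t : `|window_mass t| <= Finf.
Proof.
rewrite -[Finf]mul1r; apply: le_mass_Rintegral.
- exact: max0_ge0.
- exact: (measurable_fun_pair2 t measurable_window).
- by move=> x; exact: window_norm_le1.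
Qed.

Lemma window_mass_avg s h : 0 <= s -> 0 < h <= 1 -> s + h <= T ->
  window_mass 0 <= \int[mu]_t (window_mass t * hump_at h s t).
Proof.
move=> s0 /andP[h0 h1] shT.
(* Since [h <= 1], the rising ramp of [a] ends before time 0: on [t >= 0] one sees [a 0 = 1] and the
   derivative [- hump_at h s], which produces the average in time. *)
pose a := plateau h (- 2) (s + h).
pose phi := fun z : R * R => a z.1 * window z.
have sa : smooth a by exact: smooth_plateau.
have sphi : smooth phi by apply: smoothM; [exact: smooth_fst_comp|exact: smooth_window].
have ab : - 2 <= s + h - h by lra.
have [P1 _ HP1] := @continuous_bounded_itv _ _ (- 2) (s + h) (smooth_cont _ sp1).
have [P2 _ HP2] := @continuous_bounded_itv _ _ (- 2) (s + h) (smooth_cont _ sp2).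
have phi0 z : ~ (`[- 2, s + h] `*` `[- P1, P2])%classic z -> phi z = 0.
  move=> H; rewrite /phi.
  have [z1|z1] := pselect (`[- 2, s + h]%classic z.1); last by rewrite /a plateau_out// mul0r.
  rewrite window_out ?mulr0// => z2; apply: H; split => //.
  have := HP1 _ z1; have := HP2 _ z1; rewrite !ler_norml => /andP[_ ?] /andP[? _].
  by move: z2; rewrite /= !in_itv/= => /andP[? ?]; apply/andP; split; lra.
have tphi : test_function setT phi by split => //; have [] := @supp2_compact _ _ _ _ _ _ phi0.
have [mD1 D10 [C1 C10 HC1]] := @test_bounded _ phi (1, 0) _ _ _ _ sphi phi0.
have [mD2 D20 [C2 C20 HC2]] := @test_bounded _ phi (0, 1) _ _ _ _ sphi phi0.
have D1 t x : 'D_(1, 0) phi (t, x) =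
    a t * 'D_(1, 0) window (t, x) + window (t, x) * 'D_1 a t.
  by rewrite derive_cutoff//= ?mulr1//; exact: smooth_window.
have D2 t x : 'D_(0, 1) phi (t, x) = a t * 'D_(0, 1) window (t, x).
  by rewrite derive_cutoff//= ?mulr0 ?addr0//; exact: smooth_window.
have Da t : 0 <= t -> 'D_1 a t = - hump_at h s t.
  move=> t0; rewrite /a derive_plateau addrK hump_at_out ?sub0r//=.
  by rewrite in_itv/= => /andP[_]; lra.
have [Vb Vb0 HV] := @sol_bound T (ltW T0).
pose k := fun z : rT * rT => 'D_(1, 0) phi z + vext z.1 z.2 * 'D_(0, 1) phi z.
have mk : measurable_fun setT k.
  exact: (measurable_funD mD1 (measurable_funM measurable_vext mD2)).
have kC z : `|k z| <= C1 + Vb * C2.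
  apply: le_trans (ler_normD _ _) _; apply: lerD; first exact: HC1.
  rewrite normrM; have [z1|z1] := pselect ((`[- 2, s + h] `*` `[- P1, P2])%classic z).
    apply: ler_pM => //; apply: HV; rewrite max0_ge0/= ge_max (ltW T0) andbT.
    by move: z1 => [/=]; rewrite in_itv/= => /andP[_ z1] _; exact: le_trans z1 shT.
  by rewrite D20// normr0 mulr0 mulr_ge0// ltW.
have kge t x : 0 <= t -> - hump_at h s t * window (t, x) <= k (t, x).
  move=> t0; rewrite /k D1 D2 Da//= /vext max0_id//.
  have [tT|tT] := leP t T.
    have := @window_transport t x; rewrite t0 tT => /(_ isT).
    have := @plateau_ge0 R h (- 2) (s + h) t h0 ab; rewrite -/a.
    move=> at0 W; have := mulr_ge0 at0 W.
    have alg (A w H X Y V : R) :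
      A * X + w * - H + V * (A * Y) - - H * w = A * (X + V * Y) by ring.
    by rewrite -(alg _ (window (t, x)) (hump_at h s t)) subr_ge0.
  have -> : a t = 0.
    by apply: plateau_out => //=; rewrite in_itv/= => /andP[_]; lra.
  by rewrite !mul0r mulr0 add0r addr0 mulrC.
pose K t := \int[mext t]_x k (t, x).
have mK : measurable_fun setT K.
  exact: (@measurable_kernel_Rintegral _ mext Finf mext_ray mext_total k _ mk kC).
have kt t : measurable_fun setT (fun x : rT => k (t, x)) by exact: (measurable_fun_pair2 t mk).
have KC t : `|K t| <= (C1 + Vb * C2) * Finf.
  by apply: le_mass_Rintegral => //; exact: max0_ge0.
have K0 t : ~ `[- 2, s + h]%classic t -> K t = 0.
  move=> tH; rewrite /K; have -> : (fun x => k (t, x)) = cst 0.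
    by apply/funext => x; rewrite /k D10 ?D20 ?mulr0 ?addr0//; move=> -[].
  by rewrite Rintegral_cst// mul0r.
have iK : mu.-integrable setT (EFin \o K) by exact: (@integrable_bounded_supp _ (- 2) (s + h) ((C1 + Vb * C2) * Finf)).
have mwt t : measurable_fun setT (fun x : rT => window (t, x)).
  exact: (measurable_fun_pair2 t measurable_window).
have Kge t : 0 <= t -> - (window_mass t * hump_at h s t) <= K t.
  move=> t0; rewrite mulrC -mulNr.
  have iw : (mext t).-integrable setT (EFin \o (fun x => window (t, x))).
    by apply: (@mass_integrable _ _ 1) => // x; exact: window_norm_le1.
  rewrite /window_mass -RintegralZl//; apply: le_Rintegral => //.
  - exact: integrable_rZ.
  - by apply: (@mass_integrable _ _ (C1 + Vb * C2)).
  - by move=> x _; exact: kge.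
have := @weakm phi tphi.
have -> : \int[m 0]_x phi (0, x) = window_mass 0.
  rewrite /window_mass /mext max0_id//; apply: eq_Rintegral => x _.
  by rewrite /phi /= /a plateau_in ?mul1r//; apply/andP; lra.
have -> : \int[mu]_(t in `[0, +oo[) (\int[m t]_x
    ('D_(1, 0) phi (t, x) + v t x * 'D_(0, 1) phi (t, x))) = \int[mu]_(t in `[0, +oo[) K t.
  apply: eq_Rintegral => t /set_mem; rewrite /= in_itv/= andbT => t0.
  by rewrite /K /k /mext /vext /= max0_id.
move=> E.
have iB : mu.-integrable setT (EFin \o (fun t => window_mass t * hump_at h s t)).
  have [Kh Kh0 /(_ h s _ h0) HK] := @hump_at_bound R.
  apply: (@integrable_bounded_supp _ s (s + h) (Finf * (Kh * h^-1))).
  - apply: measurable_funM; first exact: measurable_window_mass.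
    exact: smooth_measurable (smooth_hump_at _ _).
  - by move=> t; rewrite normrM ler_pM// ?window_mass_bound//; have [] := HK t.
  - by move=> t tH; rewrite hump_at_out// mulr0.
have sub : mu.-integrable `[0, +oo[ (EFin \o (fun t => window_mass t * hump_at h s t)).
  exact: (@integrableS _ rT R mu setT).
rewrite (@Rintegral_supp _ `[0, +oo[); last first.
  move=> t /=; rewrite in_itv/= andbT => /negP; rewrite -ltNge => t0.
  by rewrite hump_at_out ?mulr0//= in_itv/= => /andP[]; lra.
have -> : window_mass 0 = - \int[mu]_(t in `[0, +oo[) K t.
  by apply/eqP; rewrite -addr_eq0 addrC E.
rewrite lerNl -mulN1r -RintegralZl//; apply: le_Rintegral => //.
- exact: integrable_rZ.
- exact: (@integrableS _ rT R mu setT).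
- by move=> t; rewrite /= in_itv/= andbT mulN1r => /Kge.
Qed.

Lemma mono_ae : {ae mu, forall t, 0 < t < T -> window_mass 0 <= window_mass t}.
Proof.
have lB := bounded_loc_integrable _ _ measurable_window_mass window_mass_bound.
apply: ae_hump_avg lB _; exact: window_mass_avg.
Qed.

Lemma window_mass_lower (q1 q2 : R) : p1 0 + rho <= q1 -> q2 <= p2 0 - rho ->
  G 0 q2 - G 0 q1 <= window_mass 0.
Proof.
move=> pq1 pq2; have D := vD _ (lexx 0).
have [q21|q12] := leP q2 q1.
  apply: (@le_trans _ _ 0); first by rewrite subr_le0 (inD_homo D).
  by rewrite /window_mass Rintegral_ge0// => x _; exact: window_ge0.
have mI : measurable (`[q1, q2[%classic : set rT) by exact: measurable_itv.
have -> : G 0 q2 - G 0 q1 = \int[m 0]_x (\1_(`[q1, q2[%classic) x).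
  have E := @cdf_itv _ (m 0) (G 0) (fun x => mE 0 x (lexx 0)) q1 q2 (ltW q12).
  by rewrite /Rintegral integral_indic// setIT [X in fine X]E.
have m00 : Num.max 0 0 = 0 :> R by rewrite max0_id.
rewrite /window_mass /mext m00; apply: le_Rintegral => //.
- apply: (@mass_integrable _ _ 1); first exact: measurable_indic.
  by move=> x; rewrite indicE; case: (_ \in _); rewrite ?normr1 ?normr0.
- apply: (@mass_integrable _ _ 1); first exact: (measurable_fun_pair2 (0 : rT) measurable_window).
  by move=> x; exact: window_norm_le1.
- move=> x _; rewrite indicE; case: (boolP (_ \in _)) => [/set_mem|_]; last exact: window_ge0.
  rewrite /= in_itv/= => /andP[? ?].
  by rewrite /window /= !step_at1 ?mulr1//; lra.
Qed.

Lemma window_mass_upper t (A : set R) : 0 <= t -> measurable A ->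
  (forall x, p1 t < x < p2 t -> A x) -> window_mass t <= fine (m t A).
Proof.
move=> t0 mA pA.
have -> : fine (m t A) = \int[m t]_x (\1_A x).
  by rewrite /Rintegral integral_indic// setIT.
rewrite /window_mass /mext max0_id//; apply: le_Rintegral => //.
- apply: (@mass_integrable _ _ 1); first exact: (measurable_fun_pair2 t measurable_window).
  by move=> x; exact: window_norm_le1.
- apply: (@mass_integrable _ _ 1); first exact: measurable_indic.
  by move=> x; rewrite indicE; case: (_ \in _); rewrite ?normr1 ?normr0.
- move=> x _; rewrite indicE; case: (boolP (_ \in _)) => [_|/negP H]; first exact: window_le1.
  have [x1|x1] := leP x (p1 t); first by rewrite /window step_at0 ?mul0r//= subr_le0.
  have [x2|x2] := leP (p2 t) x; first by rewrite /window [X in _ * X]step_at0 ?mulr0//= subr_le0.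
  by case: H; apply/mem_set/pA; rewrite x1.
Qed.

End Mono.

Section Comparison.
Variables (T rho : R) (p : R -> R).
Hypothesis T0 : 0 < T.
Hypothesis rho0 : 0 < rho.
Hypothesis sp : smooth p.

(* The second edge of the window escapes to infinity with speed at least |v|. *)
Lemma mono_up :
  (forall t x, 0 <= t <= T -> p t - rho <= x <= p t -> v t x <= 'D_1 p t) ->
  {ae mu, forall t, 0 < t < T -> G 0 (p 0 - rho) <= G t (p t)}.
Proof.
move=> vp; have [V V0 HV] := @sol_bound T (ltW T0).
pose q (n : nat) := fun t : R => - n%:R + (- V) * t.
have H n : {ae mu, forall t, 0 < t < T ->
    window_mass rho (q n) p 0 <= window_mass rho (q n) p t}.
  apply: (@mono_ae) => //; first exact: smooth_line.
  move=> t x tT _; rewrite derive_line.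
  by have := HV t x tT; rewrite ler_norml => /andP[].
apply: ae_imp (ae_foralln H) _ => t Ht tT.
have t0 : 0 <= t by case/andP: tT => /ltW.
apply/ler_addgt0Pr => e e0.
have [N HN] := inD_small (vD _ (lexx 0)) _ e0.
pose n := Num.bound `|rho - N|.
have qn : q n 0 + rho <= N.
  rewrite /q mulr0 addr0; have : `|rho - N| < n%:R by exact: archi_boundP.
  by rewrite ltr_norml => /andP[_ ?]; lra.
have L := @window_mass_lower rho (q n) p rho0 (smooth_line _ _) sp N
  (p 0 - rho) qn (lexx _).
have U : window_mass rho (q n) p t <= G t (p t).
  apply: le_trans (@window_mass_upper rho (q n) p rho0 (smooth_line _ _) sp t
    `]-oo, p t[%classic t0 _ _) _.
  - exact: measurable_itv.
  - by move=> x /andP[_]; rewrite /= in_itv.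
  - by rewrite mE.
have := Ht n tT; lra.
Qed.

(** Mirror image of [mono_up], with a window to the right of [p]. Its mass is at most
    [Finf - G t (p t)]; the total mass being the same at all times turns this into an upper bound
    for [G]. *)
Lemma mono_down :
  (forall t x, 0 <= t <= T -> p t <= x <= p t + rho -> 'D_1 p t <= v t x) ->
  {ae mu, forall t, 0 < t < T -> G t (p t) <= G 0 (p 0 + rho)}.
Proof.
move=> vp; have [V V0 HV] := @sol_bound T (ltW T0).
pose q (n : nat) := fun t : R => n%:R + V * t.
have H n : {ae mu, forall t, 0 < t < T ->
    window_mass rho p (q n) 0 <= window_mass rho p (q n) t}.
  apply: (@mono_ae) => //; first exact: smooth_line.
  move=> t x tT _; rewrite derive_line.
  by have := HV t x tT; rewrite ler_norml => /andP[].
apply: ae_imp (ae_foralln H) _ => t Ht tT.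
have t0 : 0 <= t by case/andP: tT => /ltW.
apply/ler_addgt0Pr => e e0.
have [N HN] := inD_large (vD _ (lexx 0)) _ e0.
pose n := Num.bound `|N + rho|.
have qn : N <= q n 0 - rho.
  rewrite /q mulr0 addr0; have : `|N + rho| < n%:R by exact: archi_boundP.
  by rewrite ltr_norml => /andP[_ ?]; lra.
have L := @window_mass_lower rho p (q n) rho0 sp (smooth_line _ _)
  (p 0 + rho) N (lexx _) qn.
have U : window_mass rho p (q n) t <= Finf - G t (p t).
  have mI : measurable (`]-oo, p t[%classic : set rT) by exact: measurable_itv.
  apply: le_trans (@window_mass_upper rho p (q n) rho0 sp (smooth_line _ _) t
    (setT `\` `]-oo, p t[%classic) t0 _ _) _.
  - by apply: measurableD.
  - by move=> x /andP[px _]; split => //=; rewrite in_itv/=; apply/negP; rewrite -leNgt ltW.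
  - rewrite measureD ?setTI//; last by rewrite ltey_eq fin_num_measure.
    have E1 := @mass_total t t0.
    by rewrite [X in fine (X - _)%E]E1 [X in fine (_ - X)%E]mE.
have := Ht n tT; lra.
Qed.

End Comparison.

Definition Gext (t x : R) : R := G (Num.max t 0) x.

Lemma measurable_Gext : measurable_fun setT (fun z : rT * rT => Gext z.1 z.2).
Proof.
have h : measurable_fun setT (fun z : R * R => (Num.max z.1 0, z.2)).
  apply: measurable_fun_pair; last exact: measurable_snd.
  by apply: measurable_maxr => //; exact: measurable_fst.
apply: (measurable_comp _ _ mG h).
  rewrite (_ : [set z | _] = fst @^-1` `[0, +oo[%classic).
    by rewrite -[X in measurable X]setTI; apply: measurable_fst => //; exact: measurable_itv.
  by apply/seteqP; split => z /=; rewrite in_itv/= andbT.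
by move=> _ [t _ <-] /=; exact: max0_ge0.
Qed.

(** * Averages of the velocity over a moving bump *)

Section Momentum.
Variables (T eps : R) (c : R -> R).
Hypothesis T0 : 0 < T.
Hypothesis eps0 : 0 < eps.
Hypothesis sc : smooth c.

Definition vavg t := \int[mu]_x (vext t x * hump_at eps (c t) x).

(* Completing the square in u b_t + u^2 b_x / 2, with b the bump moving along c;
   the bump has constant mass, so the terms in c' alone integrate to 0. *)
Definition flux t := \int[mu]_x
  (2^-1 * (v t x - 'D_1 c t) ^+ 2 * dhump_at eps (c t) x
   + (2^-1 * G t x - 4^-1 * Finf) * hump_at eps (c t) x).

Definition bumpc (z : R * R) := hump_at eps 0 (z.2 - c z.1).

Lemma smooth_bumpc : smooth bumpc.
Proof.
apply: smooth_comp; first exact: smooth_hump_at.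
by apply: smoothB; [exact: smooth_snd|exact: smooth_fst_comp].
Qed.

Lemma derive_bumpc t x w : 'D_w bumpc (t, x) = dhump_at eps (c t) x * (w.2 - 'D_1 c t * w.1).
Proof.
rewrite derive_moving//; last exact: smooth_hump_at.
by have [_ ->] := is_derive_hump_at eps 0 (x - c t); rewrite dhump_at_shift.
Qed.

Lemma measurable_vavg : measurable_fun setT (vavg : rT -> R).
Proof.
rewrite (_ : vavg = fun t => \int[mu]_x ((fun z => vext z.1 z.2 * bumpc z) (t, x))); last first.
  by apply/funext => t; apply: eq_Rintegral => x _; rewrite /bumpc /= hump_at_shift.
apply: (@measurable_Rintegral2 R (fun z => vext z.1 z.2 * bumpc z)).
apply: measurable_funM.
  exact: (measurable_vext).
by apply: continuous2_measurable; exact: smooth_cont smooth_bumpc.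
Qed.

Lemma vavg_bound S : 0 <= S -> exists2 C, 0 <= C & forall t, t <= S -> `|vavg t| <= C.
Proof.
move=> S0; have [V V0 HV] := @sol_bound S S0.
have [K K0 /(_ eps _ _ eps0) HK] := @hump_at_bound R.
exists (V * (K * eps^-1) * (eps)) => [|t tS].
  by rewrite !mulr_ge0 ?invr_ge0 ?(ltW V0) ?(ltW K0) ?(ltW eps0).
have E : c t + eps - c t = eps by rewrite addrAC subrr add0r.
rewrite -[X in _ * X]E; apply: le_Rintegral_supp.
- by rewrite lerDl ltW.
- apply: measurable_funM; last exact: smooth_measurable (smooth_hump_at _ _).
  by apply: continuous_measurable; apply: inD_cont (vD _ (max0_ge0 t)).
- move=> x; rewrite normrM ler_pM//; last by have [] := HK (c t) x.
  by apply: HV; rewrite max0_ge0/= ge_max tS.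
- by move=> x H; rewrite hump_at_out// mulr0.
Qed.

Variables (sigma : R) (E : R -> R).
Hypothesis sE : smooth E.
Hypothesis HE : {ae mu, forall t, 0 < t < T -> sigma * flux t <= 'D_1 E t}.

(** Test with the cutoff [a] in time times the bump moving along [c], which gives [flux] with weight
    [a]. That term is bounded by [a] times the derivative of [E], and the latter is integrated by
    parts through the derivative of [a * E], whose integral is [- E 0]. *)
Lemma momentum_avg s h : 0 <= s -> 0 < h <= 1 -> s + h <= T ->
  E 0 - sigma * vavg 0 <= \int[mu]_t ((E t - sigma * vavg t) * hump_at h s t).
Proof.
move=> s0 /andP[h0 h1] shT.
pose a := plateau h (- 2) (s + h).
pose phi := fun z : R * R => a z.1 * bumpc z.
have sa : smooth a by exact: smooth_plateau.
have sphi : smooth phi by apply: smoothM; [exact: smooth_fst_comp|exact: smooth_bumpc].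
have ab : - 2 <= s + h - h by lra.
have [C C0 HC] := @continuous_bounded_itv _ c (- 2) (s + h) (smooth_cont _ sc).
have phi0 z : ~ (`[- 2, s + h] `*` `[- C, C + eps])%classic z -> phi z = 0.
  move=> H; rewrite /phi.
  have [z1|z1] := pselect (`[- 2, s + h]%classic z.1); last by rewrite /a plateau_out// mul0r.
  rewrite /bumpc hump_at_shift hump_at_out ?mulr0// => z2; apply: H; split => //.
  have := HC _ z1; rewrite ler_norml => /andP[? ?].
  by move: z2; rewrite /= !in_itv/= => /andP[? ?]; apply/andP; split; lra.
have tphi : test_function setT phi by split => //; have [] := @supp2_compact _ _ _ _ _ _ phi0.
have [mD1 D10 [C1 C10 HC1]] := @test_bounded _ phi (1, 0) _ _ _ _ sphi phi0.
have [mD2 D20 [C2 C20 HC2]] := @test_bounded _ phi (0, 1) _ _ _ _ sphi phi0.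
have D1 t x : 'D_(1, 0) phi (t, x) =
    a t * (dhump_at eps (c t) x * - 'D_1 c t) + hump_at eps (c t) x * 'D_1 a t.
  rewrite derive_cutoff//; last exact: smooth_bumpc.
  by rewrite derive_bumpc /bumpc hump_at_shift /= !mulr1 sub0r.
have D2 t x : 'D_(0, 1) phi (t, x) = a t * dhump_at eps (c t) x.
  rewrite derive_cutoff//; last exact: smooth_bumpc.
  by rewrite derive_bumpc /= !mulr0 subr0 mulr1 addr0.
have Da t : 0 <= t -> 'D_1 a t = - hump_at h s t.
  move=> t0; rewrite /a derive_plateau addrK hump_at_out ?sub0r//=.
  by rewrite in_itv/= => /andP[_]; lra.
have [V V0 HV] := @sol_bound T (ltW T0).
have [Kh Kh0 HKh] := @hump_at_bound R.
have Fi := inD_total_ge0 (vD 0 (lexx 0)).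
pose k := fun z : rT * rT => 'D_(1, 0) phi z * vext z.1 z.2
  + 2^-1 * 'D_(0, 1) phi z * vext z.1 z.2 ^+ 2
  + phi z * (2^-1 * Gext z.1 z.2 - 4^-1 * Finf).
have mv := measurable_vext.
have mk : measurable_fun setT k.
  apply: measurable_funD; first apply: measurable_funD.
  - exact: (measurable_funM mD1 mv).
  - apply: measurable_funM; last exact: (measurable_funX 2 mv).
    by apply: measurable_funM; [exact: measurable_cst|exact: mD2].
  - apply: measurable_funM; first by apply: continuous2_measurable; exact: smooth_cont.
    apply: measurable_funB => //; apply: measurable_funM => //; exact: measurable_Gext.
have k0 z : ~ (`[- 2, s + h] `*` `[- C, C + eps])%classic z -> k z = 0.
  by move=> H; rewrite /k D10// D20// phi0// !(mul0r, mulr0, addr0).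
have GF t x : `|2^-1 * Gext t x - 4^-1 * Finf| <= Finf.
  have D := vD _ (max0_ge0 t).
  rewrite (_ : _ - _ = 2^-1 * (Gext t x - 2^-1 * Finf)); last by field.
  exact: (centered_bound _ _ 1 (inD_ge0 D x) (inD_le D x)).
have phiB z : `|phi z| <= Kh * eps^-1.
  rewrite /phi normrM -[leRHS]mul1r; apply: ler_pM => //.
    by rewrite ger0_norm ?plateau_ge0// plateau_le1.
  by have [] := HKh eps 0 (z.2 - c z.1) eps0.
have kC z : `|k z| <= C1 * V + 2^-1 * C2 * V ^+ 2 + Kh * eps^-1 * Finf.
  have [z1|z1] := pselect ((`[- 2, s + h] `*` `[- C, C + eps])%classic z); last first.
    rewrite k0// normr0 !addr_ge0// ?mulr_ge0 ?exprn_ge0 ?invr_ge0 ?(ltW eps0) ?(ltW V0) ?(ltW Kh0)//.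
  have vV : `|vext z.1 z.2| <= V.
    apply: HV; rewrite max0_ge0/= ge_max (ltW T0) andbT.
    by move: z1 => [/=]; rewrite in_itv/= => /andP[_ z1] _; exact: le_trans z1 shT.
  apply: le_trans (ler_normD _ _) _; apply: lerD; last by rewrite normrM ler_pM.
  apply: le_trans (ler_normD _ _) _; apply: lerD; first by rewrite normrM ler_pM.
  rewrite normrM normrM normrX; apply: ler_pM => //.
    by rewrite ger0_norm// ler_wpM2l.
  by rewrite lerXn2r// nnegrE// ltW.
pose K t := \int[mu]_x k (t, x).
have mK : measurable_fun setT (K : rT -> R) by exact: measurable_Rintegral2.
have kt t : measurable_fun setT (fun x : rT => k (t, x)) by exact: (measurable_fun_pair2 t mk).
have CC : - C <= C + eps by have := C0; have := eps0; lra.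
have KC t : `|K t| <= (C1 * V + 2^-1 * C2 * V ^+ 2 + Kh * eps^-1 * Finf) * (C + eps - - C).
  apply: le_Rintegral_supp => //; first exact: kt.
  by move=> x H; apply: k0 => -[_]; exact: H.
have K0 t : ~ `[- 2, s + h]%classic t -> K t = 0.
  move=> tH; rewrite /K; have -> : (fun x => k (t, x)) = cst 0.
    by apply/funext => x; rewrite k0// => -[].
  by rewrite Rintegral_cst// mul0r.
have iK : mu.-integrable setT (EFin \o K) by apply: integrable_bounded_supp mK KC K0.
have KE t : 0 <= t -> K t = - hump_at h s t * vavg t + a t * flux t.
  move=> t0; have mh := smooth_measurable _ (smooth_hump_at eps (c t)).
  have mdh := smooth_measurable _ (smooth_dhump_at eps (c t)).
  have mvt : measurable_fun setT (v t) by apply: continuous_measurable; exact: inD_cont (vD _ t0).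
  have [Vt Vt0 HVt] := @sol_bound t t0.
  have i1 : mu.-integrable setT (EFin \o (fun x => v t x * hump_at eps (c t) x)).
    apply: (@integrable_bounded_supp _ (c t) (c t + eps) (Vt * (Kh * eps^-1))).
    - exact: measurable_funM.
    - move=> x; rewrite normrM ler_pM//; first by apply: HVt; rewrite t0 lexx.
      by have [] := HKh eps (c t) x eps0.
    - by move=> x xc; rewrite hump_at_out// mulr0.
  have i3 : mu.-integrable setT (EFin \o dhump_at eps (c t)).
    apply: (@integrable_bounded_supp _ (c t) (c t + eps) (Kh * eps^-1 * eps^-1)) => //.
    - by move=> x; have [] := HKh eps (c t) x eps0.
    - by move=> x; exact: dhump_at_out.
  pose f2 x := 2^-1 * (v t x - 'D_1 c t) ^+ 2 * dhump_at eps (c t) x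
    + (2^-1 * G t x - 4^-1 * Finf) * hump_at eps (c t) x.
  have mGt : measurable_fun setT (G t : rT -> R).
    have := measurable_fun_pair2 (t : rT) measurable_Gext.
    by rewrite (_ : (fun y => _) = G t)//; apply/funext => x; rewrite /Gext /= max0_id.
  have i2 : mu.-integrable setT (EFin \o f2).
    apply: (@integrable_bounded_supp _ (c t) (c t + eps)
      (2^-1 * (Vt + `|'D_1 c t|) ^+ 2 * (Kh * eps^-1 * eps^-1) + Finf * (Kh * eps^-1))).
    - apply: measurable_funD; apply: measurable_funM => //.
        apply: measurable_funM; first exact: measurable_cst.
        by apply: measurable_funX; apply: measurable_funB.
      apply: measurable_funB => //; apply: measurable_funM => //.
    - move=> x; apply: le_trans (ler_normD _ _) _; apply: lerD; rewrite normrM; apply: ler_pM => //.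
      + rewrite normrM normrX ger0_norm// ler_wpM2l// lerXn2r ?nnegrE ?addr_ge0// ?(ltW Vt0)//.
        apply: le_trans (ler_normB _ _) _; rewrite lerD2r; apply: HVt; by rewrite t0 lexx.
      + by have [] := HKh eps (c t) x eps0.
      + by have := GF t x; rewrite /Gext max0_id.
      + by have [] := HKh eps (c t) x eps0.
    - by move=> x H; rewrite /f2 hump_at_out// dhump_at_out// !mulr0 addr0.
  (* Completing the square costs this multiple of [dhump_at], whose integral is 0. *)
  pose q := a t * (2^-1 * 'D_1 c t ^+ 2).
  have -> : K t = \int[mu]_x (- hump_at h s t * (v t x * hump_at eps (c t) x)
      + (a t * f2 x - q * dhump_at eps (c t) x)).
    apply: eq_Rintegral => x _; rewrite /k D1 D2 /= /vext /Gext max0_id// Da// /phi /bumpc /=.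
    rewrite hump_at_shift /q /f2.
    move: (a t) (hump_at h s t) ('D_1 c t) (hump_at _ _ _) (dhump_at _ _ _) (v t x) (G t x).
    by move=> *; field.
  rewrite RintegralD//; [|exact: integrable_rZ|by apply: integrable_rB => //; exact: integrable_rZ].
  rewrite RintegralB//; [|exact: integrable_rZ|exact: integrable_rZ].
  have -> : \int[mu]_x (q * dhump_at eps (c t) x) = 0.
    by rewrite RintegralZl// int_dhump_at// mulr0.
  rewrite !RintegralZl// subr0; congr (_ * _ + _).
  by apply: eq_Rintegral => x _; rewrite /vext max0_id.
have b0 : 0 < s + h by rewrite ltr_wpDl.
have a0 : a 0 = 1.
  apply: plateau_in => //; rewrite addrK s0 andbT addrC subr_le0.
  by rewrite (le_trans h1)// ler1n.
have := weakv phi tphi.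
have -> : \int[mu]_x (phi (0, x) * u0 x) = vavg 0.
  apply: eq_Rintegral => x _; rewrite /vext max0_id// v0 mulrC; congr (_ * _).
  by rewrite /phi /= a0 mul1r /bumpc hump_at_shift.
rewrite (_ : Rintegral _ _ _ = \int[mu]_(t in `[0, s + h]) K t); last first.
  transitivity (\int[mu]_(t in `[0, +oo[) K t).
    apply: eq_Rintegral => t /set_mem; rewrite /= in_itv/= andbT => t0.
    by rewrite /K /k /vext /Gext /= max0_id.
  apply: Rintegral_half => t bt; apply: K0 => /=; rewrite in_itv/= => /andP[_].
  by rewrite leNgt bt.
move=> EK; have {}EK : vavg 0 = - \int[mu]_(t in `[0, s + h]) K t.
  by apply/eqP; rewrite -addr_eq0 addrC EK.
have saE : smooth (fun t => a t * E t) by exact: smoothM.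
have FT : \int[mu]_(t in `[0, s + h]) 'D_1 (fun t => a t * E t) t = - E 0.
  have a1 : a (s + h) = 0.
    rewrite /a /plateau !step_at1 ?subrr//; first by rewrite subrK.
    by rewrite lerD2r (le_trans _ s0)// oppr_le0.
  by rewrite FTC_smooth// a0 a1 mul0r mul1r sub0r.
have DaE t : 'D_1 (fun t => a t * E t) t = a t * 'D_1 E t + E t * 'D_1 a t.
  by rewrite (@deriveM _ _ a E) //; exact: smooth_derivable.
pose B t := E t - sigma * vavg t.
have [CE CE0 HCE] := @continuous_bounded_itv _ E s (s + h) (smooth_cont _ sE).
have [CV CV0 HCV] := @vavg_bound T (ltW T0).
have mB : measurable_fun setT (B : rT -> R).
  apply: measurable_funB; first exact: smooth_measurable.
  by apply: measurable_funM => //; exact: measurable_vavg.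
have BH : mu.-integrable setT (EFin \o (fun t => B t * hump_at h s t)).
  apply: (@integrable_bounded_supp _ s (s + h) ((CE + `|sigma| * CV) * (Kh * h^-1))).
  - by apply: measurable_funM => //; exact: smooth_measurable (smooth_hump_at _ _).
  - move=> t; have [ts|ts] := pselect (`[s, s + h]%classic t); last first.
      rewrite hump_at_out// mulr0 normr0 !mulr_ge0// ?addr_ge0 ?mulr_ge0 ?invr_ge0//; exact: ltW.
    rewrite normrM; apply: ler_pM => //; last by have [] := HKh h s t h0.
    apply: le_trans (ler_normB _ _) _; apply: lerD; first exact: HCE.
    rewrite normrM ler_wpM2l// HCV//; move: ts; rewrite /= in_itv/= => /andP[_ ts].
    exact: le_trans ts shT.
  - by move=> t ts; rewrite hump_at_out// mulr0.
rewrite (@Rintegral_supp _ `[0, s + h] (fun t => B t * hump_at h s t))//; last first.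
  move=> t /= H; rewrite hump_at_out ?mulr0//= => H'; apply: H; move: H'; rewrite !in_itv/= => /andP[H1 H2].
  by rewrite H2 (le_trans s0 H1).
have mI : measurable (`[0, s + h]%classic : set rT) by exact: measurable_itv.
have iK' : mu.-integrable `[0, s + h] (EFin \o K) by exact: (@integrableS _ rT R mu setT).
have iB' : mu.-integrable `[0, s + h] (EFin \o (fun t => B t * hump_at h s t)).
  exact: (@integrableS _ rT R mu setT).
have iD : mu.-integrable `[0, s + h] (EFin \o ('D_1 (fun t => a t * E t))).
  apply: continuous_compact_integrable; first exact: itv_compact.
  by apply: continuous_subspaceT; apply: smooth_cont; exact: smooth_D.
have LE : \int[mu]_(t in `[0, s + h]) (sigma * K t) <=
    \int[mu]_(t in `[0, s + h]) ('D_1 (fun t => a t * E t) t + B t * hump_at h s t).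
  apply: ae_le_Rintegral => //; [exact: integrable_rZ|exact: integrable_rD|].
  (* [HE] is stated for [0 < t], while the integral is over a closed interval. *)
  have N0 : {ae mu, forall t : R, t != 0}.
    exists [set 0]; split => //; first exact: lebesgue_measure_set1.
    by move=> t /= /negP; rewrite negbK => /eqP.
  apply: ae_imp2 HE N0 _ => t Ht tN; rewrite /= in_itv/= => /andP[t0 tb].
  rewrite KE// DaE Da// /B.
  have : sigma * (a t * flux t) <= a t * 'D_1 E t.
    rewrite mulrCA; have [tT|tT] := ltP t T.
      by apply: ler_wpM2l; [exact: plateau_ge0|apply: Ht; rewrite tT lt0r tN t0].
    suff -> : a t = 0 by rewrite !mul0r.
    have H1 := le_trans shT tT.
    rewrite /a /plateau !step_at1 ?subrr//; first by rewrite subrK.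
    by rewrite (le_trans _ H1)// lerD2r (le_trans _ s0)// oppr_le0.
  move: (hump_at _ _ _) (a t) (flux t) (vavg t) (E t) ('D_1 E t) => H A F V' E' D'.
  move=> Hq; rewrite -subr_ge0 [X in 0 <= X](_ : _ = A * D' - sigma * (A * F)) ?subr_ge0//.
  by ring.
move: LE; rewrite RintegralZl// RintegralD// FT.
have -> : vavg 0 = - \int[mu]_(t in `[0, s + h]) K t by [].
by rewrite mulrN opprK -lerBlDl opprK addrC.
Qed.

Lemma momentum_ae : {ae mu, forall t, 0 < t < T ->
  sigma * vavg t - E t <= sigma * vavg 0 - E 0}.
Proof.
have [CE CE0 HCE] := @continuous_bounded_itv _ E 0 T (smooth_cont _ sE).
have [CV CV0 HCV] := @vavg_bound T (ltW T0).
(* The cutoff to [[0, T]] makes the function bounded, hence locally integrable on the whole line. *)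
pose B t := (E t - sigma * vavg t) * \1_(`[0, T]%classic) t.
have mB : measurable_fun setT (B : rT -> R).
  apply: measurable_funM; last by apply: measurable_indic; exact: measurable_itv.
  apply: measurable_funB; first exact: smooth_measurable.
  by apply: measurable_funM => //; exact: measurable_vavg.
have BE t : `[0, T]%classic t -> B t = E t - sigma * vavg t.
  by move=> tT; rewrite /B indicE mem_set// mulr1.
have BC t : `|B t| <= CE + `|sigma| * CV.
  have [tT|tT] := pselect (`[0, T]%classic t); last first.
    by rewrite /B indicE memNset// mulr0 normr0 addr_ge0// mulr_ge0.
  rewrite BE//; apply: le_trans (ler_normB _ _) _; apply: lerD; first exact: HCE.
  by rewrite normrM ler_wpM2l// HCV//; move: tT; rewrite /= in_itv/= => /andP[].
have lB := bounded_loc_integrable _ _ mB BC.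
have H : {ae mu, forall t, 0 < t < T -> E 0 - sigma * vavg 0 <= B t}.
  apply: ae_hump_avg => // s h s0 h01 shT; apply: le_trans (momentum_avg _ _ s0 h01 shT) _.
  rewrite le_eqVlt; apply/orP; left; apply/eqP; apply: eq_Rintegral => t _.
  have h0 : 0 < h by case/andP: h01.
  have [ts|ts] := pselect (`[s, s + h]%classic t); last by rewrite !hump_at_out// !mulr0.
  rewrite BE//; move: ts; rewrite /= !in_itv/= => /andP[t1 t2].
  by rewrite (le_trans s0 t1) (le_trans t2 shT).
apply: ae_imp H _ => t Ht tT; have := Ht tT; rewrite BE; last first.
  by case/andP: tT => t0 tT; rewrite /= in_itv/= !ltW.
by rewrite -[in X in _ -> X]lerN2 !opprB.
Qed.

End Momentum.

Lemma continuous_vext (p : R -> R) : continuous p -> continuous (fun t => vext t (p t)).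
Proof.
move=> cp t; apply/cvgrPdist_le => e e0.
have [d d0 Hd] := @sol_cont (Num.max t 0) (p t) e (max0_ge0 t) e0.
have /cvgrPdist_lt /(_ _ d0) Hp := cp t.
near=> s; rewrite distrC; apply: Hd; first exact: max0_ge0.
  apply: le_lt_trans (max0_lip _ _) _; rewrite distrC.
  by near: s; apply: cvgr_dist_lt => //; exact: cvg_id.
by rewrite distrC; near: s; exact: Hp.
Unshelve. all: by end_near. Qed.

(** * Every deviation from the characteristics can be halved *)

Section Core.
Hypothesis cF0 : continuous F0.
Variables (T L : R).
Hypothesis T0 : 0 < T.
Hypothesis L1 : 1 <= L.
Local Notation X := (char_x Finf u0 F0).
Local Notation V := (char_v Finf u0 F0).
(* HV and HG turn closeness along the characteristics into closeness everywhere.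
   They hold if (v, G) is Lipschitz in x, or if some Lipschitz solution with the
   same data is transported along the same characteristics. *)
Hypothesis HV : forall t d, 0 <= t <= T -> (forall y, `|v t (X t y) - V t y| <= d) ->
  forall z y, `|v t z - V t y| <= d + L * `|z - X t y|.
Hypothesis HG : forall t A, 0 <= t <= T -> 0 <= A ->
  (forall y, G t (X t y - A) <= F0 y <= G t (X t y + A)) ->
  forall y z, `|G t (X t y + z) - F0 y| <= L * (`|z| + A).

Let L0 : 0 < L. Proof. exact: lt_le_trans L1. Qed.

(** The quadratic term costs [B1^2 / 2] times the height [K / eps^2] of [dhump_at] times the width
    [eps]; the other term is an average of values within [B2] of [gg]. *)
Lemma flux_near t eps (c : R -> R) gg B1 B2 K : 0 <= t -> 0 < eps ->
  (forall e c x : R, 0 < e ->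
    `|hump_at e c x| <= K * e^-1 /\ `|dhump_at e c x| <= K * e^-1 * e^-1) ->
  (forall x, c t <= x <= c t + eps -> `|v t x - 'D_1 c t| <= B1) ->
  (forall x, c t <= x <= c t + eps -> `|2^-1 * G t x - 4^-1 * Finf - gg| <= B2) ->
  `|flux eps c t - gg| <= 2^-1 * B1 ^+ 2 * (K * eps^-1) + B2.
Proof.
move=> t0 e0 HK H1 H2.
have mvt : measurable_fun setT (v t) by apply: continuous_measurable; exact: inD_cont (vD _ t0).
have mGt : measurable_fun setT (G t : rT -> R).
  have := measurable_fun_pair2 (t : rT) (measurable_Gext).
  by rewrite (_ : (fun y => _) = G t)//; apply/funext => x; rewrite /Gext /= max0_id.
have mh := smooth_measurable _ (smooth_hump_at eps (c t)).
have mdh := smooth_measurable _ (smooth_dhump_at eps (c t)).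
have B10 : 0 <= B1 by apply: le_trans (normr_ge0 _) (H1 (c t) _); rewrite lexx lerDl ltW.
have K0 : 0 <= K * eps^-1 by have [h _] := HK eps 0 0 e0; exact: le_trans (normr_ge0 _) h.
pose f1 x := 2^-1 * (v t x - 'D_1 c t) ^+ 2 * dhump_at eps (c t) x.
pose f2 x := (2^-1 * G t x - 4^-1 * Finf) * hump_at eps (c t) x.
have F00 := inD_total_ge0 (vD 0 (lexx 0)).
have m1 : measurable_fun setT (f1 : rT -> R).
  apply: measurable_funM => //; apply: measurable_funM; first exact: measurable_cst.
  by apply: measurable_funX; apply: measurable_funB.
have s1 x : ~ `[c t, c t + eps]%classic x -> f1 x = 0.
  by move=> H; rewrite /f1 dhump_at_out// mulr0.
have b1 x : `|f1 x| <= 2^-1 * B1 ^+ 2 * (K * eps^-1 * eps^-1).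
  have [xc|xc] := pselect (`[c t, c t + eps]%classic x); last first.
    rewrite s1// normr0; apply: mulr_ge0; first by rewrite mulr_ge0// exprn_ge0.
    by rewrite (mulr_ge0 K0)// invr_ge0 ltW.
  rewrite normrM; apply: ler_pM => //; last by have [] := HK eps (c t) x e0.
  rewrite normrM normrX ger0_norm// ler_wpM2l// lerXn2r ?nnegrE//.
  by apply: H1; move: xc; rewrite /= in_itv.
have i1 := integrable_bounded_supp _ _ _ _ m1 b1 s1.
have i2 : mu.-integrable setT (EFin \o f2).
  apply: (@integrable_bounded_supp _ (c t) (c t + eps) (Finf * (K * eps^-1))).
  - apply: measurable_funM => //.
    by apply: measurable_funB => //; apply: measurable_funM => //.
  - move=> x; rewrite normrM; apply: ler_pM => //; last by have [] := HK eps (c t) x e0.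
    rewrite (_ : _ - _ = 2^-1 * (G t x - 2^-1 * Finf)); last by field.
    have D := vD _ t0.
    exact: (centered_bound _ _ 1 (inD_ge0 D x) (inD_le D x)).
  - by move=> x H; rewrite /f2 hump_at_out// mulr0.
rewrite /flux RintegralD// -addrA; apply: le_trans (ler_normD _ _) _; apply: lerD.
  have := @le_Rintegral_supp R (c t) (c t + eps) _ f1 _ m1 b1 s1.
  have -> : c t + eps - c t = eps by rewrite addrAC subrr add0r.
  by rewrite -!mulrA mulVf ?gt_eqF// mulr1; apply; rewrite lerDl ltW.
by apply: hump_avg => // x; rewrite /= in_itv/= => /H2.
Qed.

Lemma vavg_near t eps (c : R -> R) l e : 0 <= t -> 0 < eps ->
  (forall x, c t <= x <= c t + eps -> `|v t x - l| <= e) -> `|vavg eps c t - l| <= e.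
Proof.
move=> t0 e0 H; have [K K0 HK] := @hump_at_bound R.
have [B B0 HB] := @sol_bound t t0.
rewrite /vavg /vext max0_id//; apply: hump_avg => //.
apply: (@integrable_bounded_supp _ (c t) (c t + eps) (B * (K * eps^-1))).
- apply: measurable_funM; last exact: smooth_measurable (smooth_hump_at _ _).
  by apply: continuous_measurable; exact: inD_cont (vD _ t0).
- move=> x; rewrite normrM; apply: ler_pM => //; last by have [] := HK eps (c t) x e0.
  by apply: HB; rewrite t0 lexx.
- by move=> x xc; rewrite hump_at_out// mulr0.
Qed.

(* The deviation from the characteristics is measured with the weight
   expR (- lam t); for lam large the measure stays within a distance A of its
   transported position, A being smaller than the deviation by a factor 2 / lam. *)
Section Contraction.
Variables (D lam : R).
Hypothesis D0 : 0 < D.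
Hypothesis lamL : 2 * L <= lam.
Hypothesis HD : forall t y, 0 <= t <= T -> `|v t (X t y) - V t y| <= D * expR (lam * t).

Let lam0 : 0 < lam. Proof. by apply: lt_le_trans lamL; rewrite mulr_gt0. Qed.
Let A t := 2 / lam * D * expR (lam * t).
Let A0 t : 0 < A t. Proof. by rewrite /A !mulr_gt0 ?invr_gt0 ?expR_gt0. Qed.
Let AA t : 0 <= t -> A 0 <= A t.
Proof.
move=> t0; rewrite /A ler_wpM2l//.
  by rewrite !mulr_ge0 ?invr_ge0// ltW.
by rewrite mulr0 ler_expR mulr_ge0// ltW.
Qed.
Let LA t : L * A t <= D * expR (lam * t).
Proof.
rewrite /A -mulrA [L * _]mulrA -[leRHS]mul1r ler_wpM2r ?mulr_ge0 ?expR_ge0 ?(ltW D0)//.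
by rewrite mulrA ler_pdivrMr// mul1r mulrC.
Qed.
Let A_deriv t : 2 / lam * D * lam * expR (lam * t) = 2 * (D * expR (lam * t)).
Proof. by field; rewrite gt_eqF. Qed.

(** The bound is the derivative of [A], by [A_deriv], so the curves [X + A] and [X - A] recede at
    least as fast as the flow. This explains the factor [2 / lam] in [A] and the condition
    [2 * L <= lam], which gives [L * A t <= D exp(lam t)]. *)
Lemma core_near t y z : 0 <= t <= T -> `|z| <= A t ->
  `|v t (X t y + z) - V t y| <= 2 * (D * expR (lam * t)).
Proof.
move=> tT zA; apply: le_trans (HV t _ tT (fun y => HD t y tT) (X t y + z) y) _.
rewrite [X t y + z]addrC addrK mulr_natl mulr2n lerD2l.
by apply: le_trans (LA t); rewrite ler_wpM2l// ltW.
Qed.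

(** The ramp width is [A 0]. The barriers start at [y + A 0] and [y - A 0], so stepping back by one
    ramp lands on [y] and gives [F0 y] exactly; as [A] increases, the ramps stay within [A t] of the
    characteristic. *)
Lemma core_mono_ae y : {ae mu, forall t, 0 < t < T ->
  G t (X t y - A t) <= F0 y <= G t (X t y + A t)}.
Proof.
have x0 B : exp_poly y (u0 y) (4^-1 * (F0 y - 2^-1 * Finf)) B lam 0 0 0 = y + B.
  by rewrite char_xE char_x0 mulr0 expR0 mulr1.
have AE : A 0 = 2 / lam * D by rewrite /A mulr0 expR0 mulr1.
have U := @mono_up T (A 0)
  (exp_poly y (u0 y) (4^-1 * (F0 y - 2^-1 * Finf)) (2 / lam * D) lam 0 0)
  T0 (A0 0) (smooth_exp_poly _ _ _ _ _ _ _).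
have Dn := @mono_down T (A 0)
  (exp_poly y (u0 y) (4^-1 * (F0 y - 2^-1 * Finf)) (- (2 / lam * D)) lam 0 0)
  T0 (A0 0) (smooth_exp_poly _ _ _ _ _ _ _).
have {}U := U _; have {}Dn := Dn _.
apply: ae_imp2 (U _) (Dn _) _.
- move=> t x tT; rewrite char_xE -/(A t) derive_char_x A_deriv => /andP[x1 x2].
  have t0 : 0 <= t by case/andP: tT.
  have zA : `|x - X t y| <= A t.
    have := AA t t0; have := A0 0; move: x1 x2; move: (X t y) (A t) (A 0) => a b c.
    by move=> *; rewrite ler_norml; apply/andP; split; lra.
  have := core_near t y (x - X t y) tT zA; rewrite subrKC ler_norml => /andP[_].
  by rewrite lerBlDl.
- move=> t x tT; rewrite char_xE mulNr -/(A t) derive_char_x !mulNr A_deriv => /andP[x1 x2].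
  have t0 : 0 <= t by case/andP: tT.
  have zA : `|x - X t y| <= A t.
    have := AA t t0; have := A0 0; move: x1 x2; move: (X t y) (A t) (A 0) => a b c.
    by move=> *; rewrite ler_norml; apply/andP; split; lra.
  have := core_near t y (x - X t y) tT zA; rewrite subrKC ler_norml => /andP[+ _].
  by rewrite lerBrDr addrC.
- move=> t Hu Hd tT; apply/andP; split.
    have := Hd tT; by rewrite char_xE mulNr -/(A t) x0 AE subrK G0.
  have := Hu tT; by rewrite x0 AE addrK G0 char_xE.
Qed.

(** The null set of [core_mono_ae] depends on [y], so only rational [y] are taken. Continuity of
    [X t] and monotonicity of [F0] and [G t] then reach every [y], at the price of [2 * A t] in
    place of [A t]. *)
Lemma core_G_ae : {ae mu, forall t, 0 < t < T ->
  forall y, G t (X t y - 2 * A t) <= F0 y <= G t (X t y + 2 * A t)}.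
Proof.
pose P (n : nat) (t : R) := if @unpickle rat n is Some q then
  0 < t < T -> G t (X t (ratr q) - A t) <= F0 (ratr q) <= G t (X t (ratr q) + A t) else True.
have HP n : {ae mu, forall t, P n t}.
  rewrite /P; case: (@unpickle rat n) => [q|]; first exact: core_mono_ae.
  exact: aeW.
apply: ae_imp (ae_foralln HP) _ => t Ht tT y.
have {}Ht q : G t (X t (ratr q) - A t) <= F0 (ratr q) <= G t (X t (ratr q) + A t).
  by have := Ht (pickle q); rewrite /P pickleK; apply.
have t0 : 0 <= t by case/andP: tT => /ltW.
have DG := vD _ t0; have D0' := vD _ (lexx 0).
have cu0 : continuous u0 by rewrite (_ : u0 = v 0); [exact: inD_cont D0'|apply/funext => x; rewrite v0].
have cX : X t x @[x --> y] --> X t y.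
  apply: cvgD; first apply: cvgD; first exact: cvg_id.
    by apply: cvgM; [exact: cu0|exact: cvg_cst].
  apply: cvgM; last exact: cvg_cst.
  by apply: cvgM; [exact: cvg_cst|apply: cvgB; [exact: cF0|exact: cvg_cst]].
have /cvgrPdist_lt /(_ _ (A0 t)) /nbhs_ballP [d d0 Hd] := cX.
have {}d0 : 0 < d by [].
have Fh : {homo F0 : x y / x <= y} by move=> a b ab; rewrite -!G0; exact: (inD_homo D0').
apply/andP; split.
  have [q] : exists q, ratr q \in `]y - d, y[ by apply: rat_in_itvoo; rewrite ltrBlDr ltrDl.
  rewrite in_itv/= => /andP[q1 q2]; apply: le_trans (Fh _ _ (ltW q2)).
  have /andP[+ _] := Ht q; apply: le_trans; apply: (inD_homo DG).
  have := Hd (ratr q); rewrite /ball/= ger0_norm ?subr_ge0 ?(ltW q2)// ltrBlDr -ltrBlDl.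
  by move=> /(_ q1); rewrite ltr_norml; move: (X t y) (X t _) (A t) => a b c /andP[]; lra.
have [q] : exists q, ratr q \in `]y, y + d[ by apply: rat_in_itvoo; rewrite ltrDl.
rewrite in_itv/= => /andP[q1 q2]; apply: le_trans (Fh _ _ (ltW q1)) _.
have /andP[_] := Ht q; move=> /le_trans; apply; apply: (inD_homo DG).
have := Hd (ratr q); rewrite /ball/= distrC ger0_norm ?subr_ge0 ?(ltW q1)// ltrBlDl.
by move=> /(_ q2); rewrite ltr_norml; move: (X t y) (X t _) (A t) => a b c /andP[]; lra.
Qed.

(** [HG] turns the two-sided comparison into the bound on [G]. The one on [v] is [inD_energy] with
    parameters 1 and -1, [1 <= L] absorbing the length of the interval. *)
Lemma core_energy_ae : {ae mu, forall t, 0 < t < T -> forall y z, 0 <= z ->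
  `|G t (X t y + z) - F0 y| <= L * (z + 2 * A t) /\
  `|v t (X t y + z) - v t (X t y)| <= L * (z + 4 * A t)}.
Proof.
apply: ae_imp core_G_ae _ => t Ht tT y z z0.
have tT' : 0 <= t <= T by case/andP: tT => ? ?; rewrite !ltW.
have A2 : 0 <= 2 * A t by rewrite mulr_ge0// ltW.
have H := HG t _ tT' A2 (Ht tT); have Hz := H y z; have := H y 0.
rewrite normr0 add0r addr0; move: Hz; rewrite (ger0_norm z0) => Hz H0; split => //.
have t0 : 0 <= t by case/andP: tT'.
have ab : X t y <= X t y + z by rewrite lerDl.
have E1 := inD_energy (vD _ t0) 1 _ _ ab.
have E2 := inD_energy (vD _ t0) (-1) _ _ ab.
have Lz : z <= L * z by rewrite ler_peMl.
have LA4 : 0 <= L * A t by rewrite mulr_ge0// ltW.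
have e k : L * (z + k * A t) = L * z + k * (L * A t) by rewrite mulrDr mulrCA.
move: E1 E2 Hz H0 Lz LA4; rewrite expr1n sqrrN expr1n !e (mulrCA L 2) !ler_norml.
move: (L * z) (L * A t) (v t (X t y + z)) (v t (X t y)) (G t (X t y + z)) (G t (X t y)) (X t y) (F0 y).
move=> Lz LA4 v1 v2 g1 g2 x f E1 E2 /andP[h3 h4] /andP[h5 h6] h1 h2.
by apply/andP; split; lra.
Qed.

(** The terms [2 * (L * eps)] and [4 * (L * A t)] come from replacing point values by bump averages
    at times 0 and [t]. The others integrate the flux error in time: the part constant in time gives
    the factor [T], the squared deviation divided by [eps] gives the rate [2 * lam], and the
    displacement [L * A] gives the rate [lam]. *)
Definition core_bound K eps t :=
  2 * (L * eps) + (K * L ^+ 2 * eps + 2^-1 * (L * eps)) * T + 4 * (L * A t)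
  + K * D ^+ 2 / (2 * lam * eps) * expR (2 * lam * t) + 2 * L * D / lam ^+ 2 * expR (lam * t).

Lemma core_v_ae K eps y : 0 < K -> 0 < eps ->
  (forall e c x : R, 0 < e ->
    `|hump_at e c x| <= K * e^-1 /\ `|dhump_at e c x| <= K * e^-1 * e^-1) ->
  {ae mu, forall t, 0 < t < T -> `|v t (X t y) - V t y| <= core_bound K eps t}.
Proof.
move=> K0 e0 HK.
pose c := exp_poly y (u0 y) (4^-1 * (F0 y - 2^-1 * Finf)) 0 lam 0 0.
have cE t : c t = X t y by rewrite /c char_xE mul0r addr0.
have dc t : 'D_1 c t = V t y by rewrite /c derive_char_x !mul0r addr0.
pose g := 2^-1 * (F0 y - 2^-1 * Finf).
pose al := K * D ^+ 2 / (2 * lam * eps); pose ga := 2 * L * D / lam ^+ 2.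
pose be := K * L ^+ 2 * eps + 2^-1 * (L * eps).
have al0 : 0 <= al by rewrite /al divr_ge0// ?mulr_ge0 ?exprn_ge0// ?(ltW K0) ?(ltW lam0) ?(ltW e0) ?(ltW D0).
have ga0 : 0 <= ga by rewrite /ga divr_ge0// ?exprn_ge0// ?mulr_ge0// ?(ltW L0) ?(ltW D0)// ltW.
have be0 : 0 <= be by rewrite /be addr_ge0// !mulr_ge0// ?exprn_ge0// ltW.
(* The derivative of [E sigma] is [sigma * g] plus the bound on the distance from [flux] to the
   acceleration [g]; the signs 1 and -1 give the two sides of the estimate. *)
pose E sigma := exp_poly 0 (sigma * g + be) 0 al (2 * lam) ga lam.
have e2 t : expR (2 * lam * t) = expR (lam * t) ^+ 2 by rewrite expr2 -expRD; congr expR; ring.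
have flux_ae : {ae mu, forall t, 0 < t < T ->
    `|flux eps c t - g| <= be + al * (2 * lam) * expR (2 * lam * t) + ga * lam * expR (lam * t)}.
  apply: ae_imp core_energy_ae _ => t Ht tT.
  have tT' : 0 <= t <= T by case/andP: tT => ? ?; rewrite !ltW.
  have t0 : 0 <= t by case/andP: tT'.
  have H1 x : c t <= x <= c t + eps -> `|v t x - 'D_1 c t| <= D * expR (lam * t) + L * eps.
    rewrite cE dc => /andP[x1 x2]; apply: le_trans (HV t _ tT' (fun y => HD t y tT') x y) _.
    by rewrite lerD2l ler_wpM2l ?(ltW L0)// ger0_norm ?subr_ge0// lerBlDl.
  have H2 x : c t <= x <= c t + eps ->
      `|2^-1 * G t x - 4^-1 * Finf - g| <= 2^-1 * (L * (eps + 2 * A t)).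
    rewrite cE => /andP[x1 x2].
    rewrite (_ : _ - g = 2^-1 * (G t x - F0 y)); last by rewrite /g; field.
    rewrite normrM ger0_norm// ler_wpM2l//.
    have z0 : 0 <= x - X t y by rewrite subr_ge0.
    have [+ _] := Ht tT y _ z0; rewrite subrKC => /le_trans; apply.
    by rewrite ler_wpM2l ?(ltW L0)// lerD2r lerBlDl.
  apply: le_trans (@flux_near t eps c g _ _ K t0 e0 HK H1 H2) _.
  rewrite e2 /be /al /ga /A; move: (expR _) => q.
  have -> : K * D ^+ 2 / (2 * lam * eps) * (2 * lam) * q ^+ 2 = K / eps * (D * q) ^+ 2.
    by field; rewrite !gt_eqF.
  have -> : 2 * L * D / lam ^+ 2 * lam * q = 2^-1 * (L * (2 * (2 / lam * D * q))).
    by field; rewrite gt_eqF.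
  have -> : K * L ^+ 2 * eps = K / eps * (L * eps) ^+ 2 by field; rewrite gt_eqF.
  rewrite [L * (eps + _)]mulrDr mulrDr.
  have sq (a b : R) : 2^-1 * (a + b) ^+ 2 <= a ^+ 2 + b ^+ 2.
    by rewrite -subr_ge0 (_ : _ - _ = 2^-1 * (a - b) ^+ 2); [rewrite mulr_ge0// sqr_ge0|field].
  have Ke : 0 <= K / eps by rewrite divr_ge0// ltW.
  have := ler_wpM2r Ke (sq (D * q) (L * eps)).
  rewrite mulrDl; move: (D * q) (L * (2 * _)) (K / eps) => a b k; move: (L * eps) => h.
  rewrite (mulrC (a ^+ 2)) (mulrC (h ^+ 2)).
  move: (k * a ^+ 2) (k * h ^+ 2) (_ * k) => p1 p2 p3.
  lra.
have dE sigma t : 'D_1 (E sigma) t =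
    sigma * g + be + al * (2 * lam) * expR (2 * lam * t) + ga * lam * expR (lam * t).
  by rewrite /E derive_exp_poly mulr0 mul0r addr0.
have ME sigma : `|sigma| = 1 -> {ae mu, forall t, 0 < t < T ->
    sigma * vavg eps c t - E sigma t <= sigma * vavg eps c 0 - E sigma 0}.
  move=> s1; apply: (@momentum_ae T eps c T0 e0 (smooth_exp_poly _ _ _ _ _ _ _)
    sigma (E sigma) (smooth_exp_poly _ _ _ _ _ _ _)).
  apply: ae_imp flux_ae _ => t Ht tT; rewrite dE -!addrA -lerBlDl -mulrBr.
  apply: le_trans (ler_norm _) _; rewrite normrM s1 mul1r.
  by apply: le_trans (Ht tT) _; rewrite -!addrA.
have M1 := ME 1 (normr1 _); have M2 : {ae mu, forall t, 0 < t < T ->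
    -1 * vavg eps c t - E (-1) t <= -1 * vavg eps c 0 - E (-1) 0}.
  by apply: ME; rewrite normrN normr1.
(* At time 0 the deviation vanishes, so [HV] with [d = 0] says that [u0] is [L]-Lipschitz. *)
have V0b : `|vavg eps c 0 - u0 y| <= L * eps.
  apply: vavg_near => // x; rewrite cE char_x0 => /andP[x1 x2].
  have T00 : 0 <= (0 : R) <= T by rewrite lexx ltW.
  have H0 z : `|v 0 (X 0 z) - V 0 z| <= 0 by rewrite char_x0 char_v0 v0 subrr normr0.
  have := HV 0 0 T00 H0 x y; rewrite char_x0 char_v0 add0r => /le_trans; apply.
  by rewrite ler_wpM2l ?(ltW L0)// ger0_norm ?subr_ge0// lerBlDl.
have M12 : {ae mu, forall t, 0 < t < T ->
    1 * vavg eps c t - E 1 t <= 1 * vavg eps c 0 - E 1 0 /\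
    -1 * vavg eps c t - E (-1) t <= -1 * vavg eps c 0 - E (-1) 0}.
  by apply: ae_imp2 M1 M2 _ => t a b tT; split; [exact: a|exact: b].
apply: ae_imp2 M12 core_energy_ae _ => t H12 Ht tT; have [Ht1 Ht2] := H12 tT.
have tT' : 0 <= t <= T by case/andP: tT => ? ?; rewrite !ltW.
have t0 : 0 <= t by case/andP: tT'.
have Vtb : `|vavg eps c t - v t (X t y)| <= L * (eps + 4 * A t).
  apply: vavg_near => // x; rewrite cE => /andP[x1 x2].
  have z0 : 0 <= x - X t y by rewrite subr_ge0.
  have [_ +] := Ht tT y _ z0; rewrite subrKC => /le_trans; apply.
  by rewrite ler_wpM2l ?(ltW L0)// lerD2r lerBlDl.
have bT : be * t <= be * T by rewrite ler_wpM2l//; case/andP: tT'.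
move: Ht1 Ht2; rewrite /E /exp_poly !mul0r !mulr0 expR0 !mulr1 !add0r !addr0.
rewrite /core_bound -/al -/ga -/be /char_v -/g.
have B1 : 0 <= al * expR (2 * lam * t) by rewrite mulr_ge0// expR_ge0.
have B2 : 0 <= ga * expR (lam * t) by rewrite mulr_ge0// expR_ge0.
exact: core_balance B1 B2 bT al0 ga0 Vtb V0b.
Qed.

Lemma core_v K eps y t : 0 < K -> 0 < eps ->
  (forall e c x : R, 0 < e ->
    `|hump_at e c x| <= K * e^-1 /\ `|dhump_at e c x| <= K * e^-1 * e^-1) ->
  0 <= t <= T -> `|v t (X t y) - V t y| <= core_bound K eps t.
Proof.
move=> K0 e0 HK tT.
have cb s : core_bound K eps s = exp_poly (2 * (L * eps) +
    (K * L ^+ 2 * eps + 2^-1 * (L * eps)) * T) 0 0 (K * D ^+ 2 / (2 * lam * eps)) (2 * lam)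
    (4 * (L * (2 / lam * D)) + 2 * L * D / lam ^+ 2) lam s.
  by rewrite /core_bound /exp_poly /A; ring.
have ccb : continuous (core_bound K eps).
  by rewrite (funext cb); apply: smooth_cont; exact: smooth_exp_poly.
have cX : continuous (fun s => X s y).
  rewrite (_ : (fun s => _) = exp_poly y (u0 y) (4^-1 * (F0 y - 2^-1 * Finf)) 0 0 0 0).
    by apply: smooth_cont; exact: smooth_exp_poly.
  by apply/funext => s; rewrite char_xE mul0r addr0.
have cV : continuous (fun s => V s y).
  rewrite (_ : (fun s => _) = exp_poly (u0 y) (2^-1 * (F0 y - 2^-1 * Finf)) 0 0 0 0 0).
    by apply: smooth_cont; exact: smooth_exp_poly.
  by apply/funext => s; rewrite /exp_poly !mul0r !addr0.
pose f s := `|vext s (X s y) - V s y| - core_bound K eps s.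
have cf : continuous f.
  move=> s; apply: cvgB; last exact: ccb.
  by apply: cvg_norm; apply: cvgB; [exact: continuous_vext|exact: cV].
have := @ae_le0_cont R f T T0 cf _ t tT; rewrite /f /vext max0_id ?subr_le0; last by case/andP: tT.
apply; apply: ae_imp (core_v_ae K eps y K0 e0 HK) _ => s Hs sT.
by rewrite max0_id ?subr_le0 ?Hs//; case/andP: sT => /ltW.
Qed.

End Contraction.

(** [lam] is chosen before [D] so that the improvement can be iterated. With [lam = k^2] every term
    of [core_bound] is [D exp(lam t) / k] times a coefficient, and the coefficients sum to at most
    [B]; [k = 2 * B] gives the factor 1/2. The bump width may depend on [t], as [core_v] is applied
    separately at each [t]. *)
Lemma core_halve : exists2 lam, 2 * L <= lam & forall D, 0 < D ->
  (forall t y, 0 <= t <= T -> `|v t (X t y) - V t y| <= D * expR (lam * t)) ->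
  (forall t y, 0 <= t <= T -> `|v t (X t y) - V t y| <= D / 2 * expR (lam * t)).
Proof.
have [K K0 HK] := @hump_at_bound R.
pose B := 2 * L + (K * L ^+ 2 + 2^-1 * L) * T + 8 * L + 2^-1 * K + 2 * L.
have B0 : 0 <= B by rewrite /B !addr_ge0// ?mulr_ge0 ?addr_ge0 ?mulr_ge0 ?exprn_ge0// ltW.
have B2 : 4 * L <= B.
  have : 0 <= (K * L ^+ 2 + 2^-1 * L) * T + 8 * L + 2^-1 * K.
    by rewrite !addr_ge0// ?mulr_ge0 ?addr_ge0 ?mulr_ge0 ?exprn_ge0// ltW.
  by rewrite /B; move: (_ * T) (_ * K) => a b; lra.
pose k := 2 * B; have k1 : 1 <= k by have := L1; rewrite /k; lra.
have k0 : 0 < k by exact: lt_le_trans k1.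
have lamL : 2 * L <= k * k.
  apply: (@le_trans _ _ k); last by rewrite ler_peMl// ltW.
  by have := L1; rewrite /k; lra.
exists (k * k) => // D D0 HD t y tT.
(* With lam = k^2, this width balances the two error terms of order eps and D^2 / (lam eps). *)
pose eps := D * expR (k * k * t) / k.
have e0 : 0 < eps by rewrite divr_gt0// mulr_gt0// expR_gt0.
apply: le_trans (@core_v D (k * k) D0 lamL HD K eps y t K0 e0 HK tT) _.
rewrite /core_bound.
have -> : expR (2 * (k * k) * t) = expR (k * k * t) ^+ 2 by rewrite expr2 -expRD; congr expR; ring.
rewrite /eps; have q0 := @expR_gt0 R (k * k * t); move: (expR _) q0 => q q0.
have -> : K * D ^+ 2 / (2 * (k * k) * (D * q / k)) * q ^+ 2 = D * q / k * (2^-1 * K).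
  by field; rewrite !gt_eqF.
have -> : D / 2 * q = D * q / k * B by rewrite /k; field; rewrite gt_eqF//; have := B2; have := L0; lra.
have p0 : 0 <= D * q / k by rewrite divr_ge0// ?mulr_ge0// ltW.
have kL : L <= k * L by rewrite ler_peMl// ltW.
have -> : 4 * (L * (2 / (k * k) * D * q)) = D * q / k * (8 * L / k) by field; rewrite gt_eqF.
have -> : 2 * L * D / (k * k) ^+ 2 * q = D * q / k * (2 * L / k ^+ 3) by field; rewrite gt_eqF.
move: (D * q / k) p0 => p p0.
rewrite (_ : 2 * (L * p) = p * (2 * L)); last by ring.
rewrite (_ : (K * L ^+ 2 * p + 2^-1 * (L * p)) * T = p * ((K * L ^+ 2 + 2^-1 * L) * T)); last by ring.
rewrite -!mulrDr ler_wpM2l// /B; apply: lerD; last first.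
  rewrite ler_pdivrMr ?exprn_gt0// ler_peMr ?mulr_ge0 ?(ltW L0)//.
  by rewrite exprn_ege1.
by rewrite lerD2r lerD2l ler_pdivrMr// ler_peMr ?mulr_ge0 ?(ltW L0).
Qed.

Lemma core_bound_init : exists2 D, 0 < D &
  forall t y, 0 <= t <= T -> `|v t (X t y) - V t y| <= D.
Proof.
have [B B0 HB] := @sol_bound T (ltW T0).
have T00 : 0 <= (0 : R) <= T by rewrite lexx ltW.
have D0' := vD _ (lexx 0).
have F00 := inD_total_ge0 D0'.
exists (B + (B + Finf * T)); first by rewrite addr_gt0// (lt_le_trans B0)// lerDl mulr_ge0// ltW.
move=> t y tT; apply: le_trans (ler_normB _ _) _; apply: lerD; first exact: HB.
apply: le_trans (ler_normD _ _) _; apply: lerD; first by rewrite -v0; exact: HB.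
rewrite normrM; apply: ler_pM => //; last by case/andP: tT => t0 ?; rewrite ger0_norm.
by rewrite -G0; exact: (centered_bound _ _ 1 (inD_ge0 D0' y) (inD_le D0' y)).
Qed.

Lemma core_v_eq t y : 0 <= t <= T -> v t (X t y) = V t y.
Proof.
move=> tT; have [lam lamL Hh] := core_halve; have [D D0 HD] := core_bound_init.
have lam0 : 0 <= lam by apply: le_trans lamL; rewrite mulr_ge0// ltW.
have H n : forall t y, 0 <= t <= T -> `|v t (X t y) - V t y| <= D / 2 ^+ n * expR (lam * t).
  elim: n => [|n IH].
    move=> s z sT; rewrite expr0 divr1; apply: le_trans (HD s z sT) _.
    by rewrite ler_peMr ?(ltW D0)// -expR0 ler_expR mulr_ge0//; case/andP: sT.
  by rewrite exprSr invfM mulrA; apply: Hh IH; rewrite divr_gt0// exprn_gt0.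
apply/eqP; rewrite -subr_eq0 -normr_le0; apply/ler_addgt0Pr => e e0; rewrite add0r.
pose n := Num.bound (D * expR (lam * t) / e).
apply: le_trans (H n t y tT) _; rewrite mulrAC ler_pdivrMr ?exprn_gt0// [e * _]mulrC -ler_pdivrMr//.
apply: le_trans (ltW (archi_boundP _)) _; first by rewrite divr_ge0 ?mulr_ge0 ?expR_ge0// ltW.
by rewrite -natrX ler_nat ltnW// ltn_expl.
Qed.

(** Once the deviation is 0, [core_G_ae] holds with [D = 1 / (n + 1)] for every [n], and its margin
    [2 * A t] becomes smaller than any [e]. *)
Lemma core_G_eq : {ae mu, forall t, 0 < t < T -> forall y e, 0 < e ->
  G t (X t y - e) <= F0 y <= G t (X t y + e)}.
Proof.
have [lam lamL _] := core_halve.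
have lam0 : 0 < lam by apply: lt_le_trans lamL; rewrite mulr_gt0.
have HD n t y : 0 <= t <= T -> `|v t (X t y) - V t y| <= n.+1%:R^-1 * expR (lam * t).
  by move=> tT; rewrite core_v_eq// subrr normr0 mulr_ge0// expR_ge0.
have n0 n : 0 < n.+1%:R^-1 :> R by rewrite invr_gt0.
have H n := @core_G_ae _ lam (n0 n) lamL (HD n).
apply: ae_imp (ae_foralln H) _ => t Ht tT y e e0.
pose c := 2 * (2 / lam * expR (lam * t)).
have c0 : 0 < c by rewrite !mulr_gt0 ?invr_gt0 ?expR_gt0.
pose n := Num.bound (c / e).
have cn : c * n.+1%:R^-1 <= e.
  rewrite ler_pdivrMr// [e * _]mulrC -ler_pdivrMr//.
  have := archi_boundP (divr_ge0 (ltW c0) (ltW e0)); rewrite -/n => /ltW/le_trans; apply.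
  by rewrite ler_nat.
have DG : inD Finf (v t) (G t) by apply: vD; case/andP: tT => /ltW.
have /andP[h1 h2] := Ht n tT y.
have cE : 2 * (2 / lam * n.+1%:R^-1 * expR (lam * t)) = c * n.+1%:R^-1 by rewrite /c; ring.
move: h1 h2; rewrite cE => h1 h2; apply/andP; split.
  by apply: le_trans h1; apply: (inD_homo DG); rewrite lerD2l lerN2.
by apply: le_trans h2 _; apply: (inD_homo DG); rewrite lerD2l.
Qed.

End Core.

End Solution.

(** * Uniqueness and semigroup property *)

Section Uniqueness.
Context {R : realType}.
Local Notation mu := (@lebesgue_measure R).
Variables (Finf : R) (u0 F0 : R -> R) (T L : R).
Hypothesis T0 : 0 < T.
Hypothesis L1 : 1 <= L.
Local Notation X := (char_x Finf u0 F0).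
Local Notation V := (char_v Finf u0 F0).

Lemma sol_char v G : conservative_solution Finf u0 F0 v G -> continuous F0 ->
  (forall t d, 0 <= t <= T -> (forall y, `|v t (X t y) - V t y| <= d) ->
    forall z y, `|v t z - V t y| <= d + L * `|z - X t y|) ->
  (forall t A, 0 <= t <= T -> 0 <= A ->
    (forall y, G t (X t y - A) <= F0 y <= G t (X t y + A)) ->
    forall y z, `|G t (X t y + z) - F0 y| <= L * (`|z| + A)) ->
  (forall t y, 0 <= t <= T -> v t (X t y) = V t y) /\
  {ae mu, forall t, 0 < t < T -> forall y e, 0 < e ->
    G t (X t y - e) <= F0 y <= G t (X t y + e)}.
Proof.
move=> [[v0 G0] vH vD mG [m [mE wk]]] cF0 HV HG.
have wm phi : test_function setT phi -> _ := fun tp => (wk phi tp).2.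
have wv phi : test_function setT phi -> _ := fun tp => (wk phi tp).1.
split.
  move=> t y tT.
  exact: (@core_v_eq R Finf u0 F0 v G m v0 G0 vH vD mG mE wm wv cF0 T L T0 L1 HV HG).
exact: (@core_G_eq R Finf u0 F0 v G m v0 G0 vH vD mG mE wm wv cF0 T L T0 L1 HV HG).
Qed.

Variables u F : R -> R -> R.
Hypothesis uF : conservative_solution Finf u0 F0 u F.
Hypothesis WF : W1infty T F.
Hypothesis uL : forall t x y, 0 <= t <= T -> `|u t x - u t y| <= L * `|x - y|.
Hypothesis FL : forall t x y, 0 <= t <= T -> `|F t x - F t y| <= L * `|x - y|.

Let L0 : 0 <= L. Proof. exact: le_trans L1. Qed.

Let uD t : 0 <= t -> inD Finf (u t) (F t). Proof. by case: uF => _ _ D _ _; exact: D. Qed.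

Let FLz t x z : 0 <= t <= T -> `|F t (x + z) - F t x| <= L * `|z|.
Proof. by move=> tT; apply: le_trans (FL t _ _ tT) _; rewrite addrAC subrr add0r. Qed.

Let F_cont t : 0 <= t <= T -> continuous (F t).
Proof. by move=> tT; apply: (lip_continuous _ _ L0) => x y; exact: FL. Qed.

Let T00 : 0 <= (0 : R) <= T. Proof. by rewrite lexx ltW. Qed.

Let cF0 : continuous F0.
Proof. by have [[_ E] _ _ _ _] := uF; rewrite -(funext E); exact: F_cont. Qed.

Let cu0 : continuous u0.
Proof. by have [[E _] _ D _ _] := uF; rewrite -(funext E); exact: inD_cont (D 0 _). Qed.

(** Here [HV] and [HG] follow from the Lipschitz bounds of the solution itself. The transport of [F]
    is first known at almost every time; the joint continuity contained in [W1infty] extends it to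
    all of [[0, T]]. *)
Lemma lip_sol_char :
  (forall t y, 0 <= t <= T -> u t (X t y) = V t y) /\
  (forall t y, 0 <= t <= T -> F t (X t y) = F0 y).
Proof.
have [] := @sol_char u F uF cF0.
- move=> t d tT H z y; rewrite -(subrK (u t (X t y)) (u t z)) -addrA addrC.
  apply: le_trans (ler_normD _ _) _; apply: lerD; [exact: H|exact: uL].
- move=> t A tT A0 H y z; have D := uD t; have {}D := D (proj1 (andP tT)).
  have B : `|F t (X t y) - F0 y| <= L * A.
    have /andP[h1 h2] := H y.
    have := FLz t (X t y) (- A) tT; have := FLz t (X t y) A tT.
    rewrite normrN (ger0_norm A0) !ler_norml.
    move: h1 h2; move: (F t _) (F t _) (F t _) (L * A) (F0 y) => a b c e f h1 h2 /andP[? ?] /andP[? ?].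
    by apply/andP; split; lra.
  rewrite -(subrK (F t (X t y)) (F t _)) -addrA mulrDr.
  apply: le_trans (ler_normD _ _) _; apply: lerD => //.
  exact: FLz.
move=> uX HF; split => // t y tT.
(* [F] is continuous on the closed strip only; clamping time to [[0, T]] gives a function continuous
   on the whole line. *)
pose cl s := Num.min (Num.max s 0) T.
have clT s : 0 <= cl s <= T by rewrite /cl le_min max0_ge0 (ltW T0) ge_min lexx orbT.
have clE s : 0 <= s <= T -> cl s = s.
  by move=> /andP[s0 sT]; rewrite /cl max0_id//; apply/min_idPl.
pose f s := `|F (cl s) (X s y) - F0 y|.
have cX : continuous (fun s => X s y).
  rewrite (_ : (fun s => _) = exp_poly y (u0 y) (4^-1 * (F0 y - 2^-1 * Finf)) 0 0 0 0).
    by apply: smooth_cont; exact: smooth_exp_poly.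
  by apply/funext => s; rewrite char_xE mul0r addr0.
have ccl : continuous cl.
  apply: (@lip_continuous R cl 1) => // a b; rewrite mul1r; apply: le_trans (max0_lip a b); rewrite /cl.
  move: (Num.max a 0) (Num.max b 0) => c d; have : - `|c - d| <= c - d <= `|c - d| by rewrite -ler_norml.
  rewrite ler_norml; move: `|c - d| (normr_ge0 (c - d)) => q q0 /andP[? ?].
  by rewrite /Num.min; case: ltP => ?; case: ltP => ?; apply/andP; split; lra.
have cf : continuous f.
  move=> s; apply: cvg_norm; apply: cvgB; last exact: cvg_cst.
  apply/cvgrPdist_le => e e0.
  have [d d0 Hd] := @W1infty_cont R T F WF (cl s) (X s y) e (clT s) e0.
  near=> r; rewrite distrC; apply: Hd; first exact: clT.
    by rewrite distrC; near: r; apply: cvgr_dist_lt => //; exact: ccl.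
  by rewrite distrC; near: r; apply: cvgr_dist_lt => //; exact: cX.
have H : {ae mu, forall s, 0 < s < T -> f s <= 0}.
  apply: ae_imp HF _ => s Hs sT; have sT' : 0 <= s <= T by case/andP: sT => ? ?; rewrite !ltW.
  rewrite /f clE// normr_le0 subr_eq0 eq_le; apply/andP; split; apply/ler_addgt0Pr => e e0.
    have e1 : 0 < e / L by rewrite divr_gt0// (lt_le_trans _ L1).
    have /andP[h _] := Hs sT y _ e1.
    have := FLz s (X s y) (- (e / L)) sT'; rewrite normrN (ger0_norm (ltW e1)).
    rewrite [L * _]mulrC divfK ?gt_eqF ?(lt_le_trans _ L1)// ler_norml => /andP[+ _].
    by move: (F s _) (F s _) h => a b; lra.
  have e1 : 0 < e / L by rewrite divr_gt0// (lt_le_trans _ L1).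
  have /andP[_ h] := Hs sT y _ e1.
  have := FLz s (X s y) (e / L) sT'; rewrite (ger0_norm (ltW e1)).
  rewrite [L * _]mulrC divfK ?gt_eqF ?(lt_le_trans _ L1)// ler_norml => /andP[_].
  by move: (F s _) (F s _) h => a b; lra.
apply/eqP; rewrite -subr_eq0 -normr_le0.
by have := ae_le0_cont _ _ T0 cf H t tT; rewrite /f clE.
Unshelve. all: by end_near. Qed.

(** [X t] is continuous and moves points by a bounded amount, so the intermediate value theorem
    applies. Surjectivity lets identities along characteristics be read at every point. *)
Lemma char_x_surj t z : 0 <= t <= T -> exists y, X t y = z.
Proof.
move=> tT; have [B B0 HB] : exists2 B, 0 <= B & forall y, `|X t y - y| <= B.
  have [[u0E F0E] uH _ _ _] := uF; have [B B0 HB] := @sol_bound R u uH T (ltW T0).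
  have D := uD 0 (lexx 0).
  have Fi := inD_total_ge0 D.
  exists (B * T + Finf * T ^+ 2).
    by rewrite addr_ge0// mulr_ge0 ?exprn_ge0// ltW.
  move=> y.
  have -> : X t y - y = u0 y * t + 4^-1 * (F0 y - 2^-1 * Finf) * t ^+ 2 by rewrite /char_x; ring.
  have tT2 : `|t| <= T by case/andP: tT => t0 ?; rewrite ger0_norm.
  apply: le_trans (ler_normD _ _) _; apply: lerD; rewrite normrM; apply: ler_pM => //.
  - by rewrite -u0E; exact: HB.
  - by rewrite -F0E; exact: (centered_bound _ _ 3 (inD_ge0 D y) (inD_le D y)).
  - by rewrite normrX lerXn2r// nnegrE// ltW.
have cX : continuous (X t).
  move=> y; apply: cvgD; first apply: cvgD; first exact: cvg_id.
    by apply: cvgM; [exact: cu0|exact: cvg_cst].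
  apply: cvgM; last exact: cvg_cst.
  by apply: cvgM; [exact: cvg_cst|apply: cvgB; [exact: cF0|exact: cvg_cst]].
have ab : z - B <= z + B by lra.
have [] := @IVT R (X t) (z - B) (z + B) z ab; last by move=> y _ <-; exists y.
  exact: continuous_subspaceT.
rewrite ge_min le_max; have := HB (z - B); have := HB (z + B).
rewrite !ler_norml; move: (X t (z - B)) (X t (z + B)) => p q /andP[? ?] /andP[? ?].
by apply/andP; split; apply/orP; [left|right]; lra.
Qed.

(** For the competitor, [HV] and [HG] are borrowed from [(u, F)]: [V t y] is the value of the
    Lipschitz [u t] at [X t y], and the comparison taken at characteristics passing at distance [A]
    on either side of a point squeezes [G] there between two values of [F]. *)
Lemma sol_unique v G : conservative_solution Finf u0 F0 v G ->
  (forall t, 0 <= t <= T -> v t =1 u t) /\ {ae mu, forall t, 0 <= t <= T -> G t =1 F t}.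
Proof.
move=> vG; have [uX FX] := lip_sol_char.
have GD t : 0 <= t -> inD Finf (v t) (G t) by case: vG => _ _ D _ _; exact: D.
have [] := @sol_char v G vG cF0.
- move=> t d tT H z y; have [y' <-] := char_x_surj t z tT.
  rewrite -(subrK (V t y') (v t _)) -addrA.
  apply: le_trans (ler_normD _ _) _; apply: lerD; first exact: H.
  by rewrite -!uX//; exact: uL.
- move=> t A tT A0 H y z; rewrite -(FX t y tT).
  have [y1 Ey1] := char_x_surj t (X t y + z + A) tT.
  have [y2 Ey2] := char_x_surj t (X t y + z - A) tT.
  have /andP[+ _] := H y1; rewrite Ey1 addrK -(FX t y1 tT) Ey1 => h1.
  have /andP[_] := H y2; rewrite Ey2 subrK -(FX t y2 tT) Ey2 => h2.
  have := FLz t (X t y) (z + A) tT; have := FLz t (X t y) (z - A) tT; rewrite !addrA.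
  have e1 : L * `|z + A| <= L * (`|z| + A).
    by rewrite ler_wpM2l// (le_trans (ler_normD _ _))// (ger0_norm A0).
  have e2 : L * `|z - A| <= L * (`|z| + A).
    by rewrite ler_wpM2l// (le_trans (ler_normB _ _))// (ger0_norm A0).
  move=> /le_trans/(_ e2) + /le_trans/(_ e1); rewrite !ler_norml.
  move: (F t _) (F t _) (F t _) (G t _) (L * _) h1 h2 => a b c e f h1 h2 /andP[? ?] /andP[? ?].
  by apply/andP; split; lra.
move=> vX HG; split.
  by move=> t tT z; have [y <-] := char_x_surj t z tT; rewrite vX// uX.
have N (a : R) : {ae mu, forall t : R, t != a}.
  exists [set a]; split => //; first exact: lebesgue_measure_set1.
  by move=> t /= /negP; rewrite negbK => /eqP.
(* The time [T] is discarded with the null set; at time 0 the initial data agree. *)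
have N0T : {ae mu, forall t, 0 <= t <= T -> 0 < t < T \/ t = 0}.
  apply: ae_imp (N T) _ => t tT' /andP[t0 tT].
  have [->|tn] := eqVneq t 0; [by right|left].
  by rewrite lt0r tn t0 lt_neqAle tT' tT.
apply: ae_imp2 HG N0T _ => t Ht Hn tT z.
have [tT'|->] := Hn tT; last first.
  by case: vG uF => -[_ GE] _ _ _ _ [[_ FE] _ _ _ _]; rewrite GE FE.
have cF : F t y @[y --> z] --> F t z by exact: F_cont.
apply/eqP; rewrite eq_le; apply/andP; split; apply/ler_addgt0Pr => e e0.
  have e1 : 0 < e / L by rewrite divr_gt0// (lt_le_trans _ L1).
  have [y Ey] := char_x_surj t (z + e / L) tT.
  have /andP[h _] := Ht tT' y _ e1; move: h; rewrite Ey addrK -(FX t y tT) Ey.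
  have := FLz t z (e / L) tT; rewrite (ger0_norm (ltW e1)) [L * _]mulrC divfK ?gt_eqF ?(lt_le_trans _ L1)//.
  by rewrite ler_norml => /andP[_]; move: (F t _) (F t _) (G t z) => a b c; lra.
have e1 : 0 < e / L by rewrite divr_gt0// (lt_le_trans _ L1).
have [y Ey] := char_x_surj t (z - e / L) tT.
have /andP[_ h] := Ht tT' y _ e1; move: h; rewrite Ey subrK -(FX t y tT) Ey.
have := FLz t z (- (e / L)) tT; rewrite normrN (ger0_norm (ltW e1)) [L * _]mulrC divfK ?gt_eqF ?(lt_le_trans _ L1)//.
by rewrite ler_norml => /andP[+ _]; move: (F t _) (F t _) (G t z) => a b c; lra.
Qed.

(** Along a characteristic [F] is constant and so is the acceleration [(F - Finf/2) / 2]; restarting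
    at time [t] continues the same parabola. *)
Lemma lip_sol_semigroup t s x : 0 <= t -> 0 <= s -> t + s <= T ->
  u (t + s) (char_x Finf (u t) (F t) s x) = char_v Finf (u t) (F t) s x /\
  F (t + s) (char_x Finf (u t) (F t) s x) = F t x.
Proof.
move=> t0 s0 tsT; have [uX FX] := lip_sol_char.
have tT : 0 <= t <= T by rewrite t0 (le_trans _ tsT)// lerDl.
have tsT' : 0 <= t + s <= T by rewrite addr_ge0.
have [y <-] := char_x_surj t x tT.
have -> : char_x Finf (u t) (F t) s (X t y) = X (t + s) y.
  by rewrite {1}/char_x uX// FX// /char_x /char_v; field.
by rewrite uX// FX// FX//; split => //; rewrite /char_v uX// FX// /char_v; field.
Qed.

End Uniqueness.

(** * From the slope bound to Lipschitz constants *)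

Section Slope.
Context {R : realType}.
Variables (Finf T : R) (u0 F0 : R -> R) (u F : R -> R -> R).
Hypothesis T0 : 0 < T.
Hypothesis uF : conservative_solution Finf u0 F0 u F.
Hypothesis Wu : W1infty T u.
Hypothesis WF : W1infty T F.

Lemma wderivP (f g : R -> R) : weak_derivative f g -> weak_derivative f (wderiv f).
Proof.
move=> fg; rewrite /wderiv.
exact: (@xgetPex _ (cst 0) [set g | weak_derivative f g] (ex_intro _ g fg)).
Qed.

(** The constants [K] and [K'] of [W1infty_lip] are uncontrolled. They make [slope_bound] finite, so
    that [fine] loses nothing, and give [F t] a weak derivative; the bound itself is then obtained
    from the essential bounds of the weak derivatives. *)
Lemma slope_bound_lip : 0 <= fine (slope_bound T u F) /\
  forall t x y, 0 <= t <= T ->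
    `|u t x - u t y| <= fine (slope_bound T u F) * `|x - y| /\
    `|F t x - F t y| <= fine (slope_bound T u F) * `|x - y|.
Proof.
have [_ _ uD _ [m [mE _]]] := uF.
have [K K0 HK] := @W1infty_lip R T u T0 Wu.
have [K' K'0 HK'] := @W1infty_lip R T F T0 WF.
have du t : 0 <= t <= T -> weak_derivative (u t) (wderiv (u t)).
  move=> /andP[t0 _]; have [_ _ _ _ [g [gu _ _]]] := uD t t0; exact: wderivP gu.
have dF t : 0 <= t <= T -> weak_derivative (F t) (wderiv (F t)).
  move=> tT; have t0 : 0 <= t by case/andP: tT.
  have [g gF] := @cdf_weak_derivative R (m t) (F t) (fun x => mE t x t0) K' K'0
    (fun x y => HK' t x y tT); exact: wderivP gF.
pose S t := (Linfty_norm (wderiv (u t)) + Linfty_norm (wderiv (F t)))%E.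
have SK t : 0 <= t <= T -> (S t <= ((4 * K + 1) + (4 * K' + 1))%:E)%E.
  move=> tT; rewrite EFinD; apply: leeD.
    apply: (@weak_derivative_bound _ (u t)) => //; [by move=> x y; exact: HK|exact: du].
  apply: (@weak_derivative_bound _ (F t)) => //; [by move=> x y; exact: HK'|exact: dF].
have S0 t : (0 <= S t)%E by rewrite adde_ge0// Linfty_norm_ge0.
have Sle t : 0 <= t <= T -> (S t <= slope_bound T u F)%E.
  by move=> tT; apply: ereal_sup_ubound; exists t => //=; rewrite in_itv.
have sb : (slope_bound T u F <= ((4 * K + 1) + (4 * K' + 1))%:E)%E.
  by apply: ge_ereal_sup => _ [t + <-]; rewrite /= in_itv/=; exact: SK.
have sb0 : (0 <= slope_bound T u F)%E.
  by apply: le_trans (S0 0) (Sle 0 _); rewrite lexx ltW.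
have sbf : slope_bound T u F \is a fin_num.
  by rewrite ge0_fin_numE//; apply: le_lt_trans sb _; exact: ltry.
have M0 : 0 <= fine (slope_bound T u F) by exact: fine_ge0.
split => // t x y tT; have t0 : 0 <= t by case/andP: tT.
have ME : (S t <= (fine (slope_bound T u F))%:E)%E by rewrite fineK//; exact: Sle.
split.
  apply: (@weak_derivative_lip R (u t) (wderiv (u t))) => //.
  - exact: inD_cont (uD t t0).
  - exact: du.
  - by apply: le_trans ME; rewrite leeDl// Linfty_norm_ge0.
apply: (@weak_derivative_lip R (F t) (wderiv (F t))) => //.
- by apply: (lip_continuous _ K') => // a b; exact: HK'.
- exact: dF.
- by apply: le_trans ME; rewrite leeDr// Linfty_norm_ge0.
Qed.

End Slope.

(** * The numerical scheme *)

Lemma le_sub_trans {R : realType} (a b c d : R) : b - a = d - c -> a <= b -> c <= d.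
Proof. by move=> e; rewrite -subr_ge0 e subr_ge0. Qed.

Section Interpolation.
Context {R : realType}.
Implicit Types (X Y : int -> R).

Lemma int_homo Y : (forall j, Y j <= Y (j + 1)) -> {homo Y : j k / j <= k}.
Proof.
move=> HY j k jk; have -> : k = j + (`|k - j|%N)%:Z by rewrite gez0_abs ?subr_ge0// subrKC.
elim: `|k - j|%N => [|n IH]; first by rewrite addr0.
by rewrite intS (addrC 1) addrA; apply: le_trans IH (HY _).
Qed.

Definition cells X := (forall j, X j < X (j + 1)) /\ forall x, exists j, X j <= x < X (j + 1).

(** The cell and the weight [th] are common to all [Y], and [x] is itself the interpolant of [X]:
    linear relations between nodal values and positions therefore pass to interpolants. *)
Lemma interp_cell X x : cells X -> exists j (th : R),
  [/\ X j <= x < X (j + 1), 0 <= th <= 1, x = X j + th * (X (j + 1) - X j) &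
    forall Y, interp X Y x = Y j + th * (Y (j + 1) - Y j)].
Proof.
move=> [X1 X2]; have [j0 j0x] := X2 x.
have := @xgetPex _ 0 [set j : int | X j <= x < X (j + 1)] (ex_intro _ j0 j0x).
rewrite /interp; move: (xget _ _) => j /= jx; exists j, ((x - X j) / (X (j + 1) - X j)).
have g0 : 0 < X (j + 1) - X j by rewrite subr_gt0.
have /andP[x1 x2] := jx; split => //.
- rewrite divr_ge0 ?subr_ge0 ?(ltW (X1 j))//= ler_pdivrMr// mul1r lerD2r.
  exact: ltW.
- by rewrite divfK ?gt_eqF// subrKC.
Qed.

Lemma interp_homo X Y : cells X -> (forall j, Y j <= Y (j + 1)) ->
  {homo interp X Y : x y / x <= y}.
Proof.
move=> cX HY x y xy; have [j [a [/andP[jx xj] /andP[a0 a1] xE ->]]] := interp_cell X x cX.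
have [k [b [/andP[ky yk] /andP[b0 b1] yE ->]]] := interp_cell X y cX.
have X1 := cX.1; have jk : j <= k.
  rewrite leNgt; apply/negP => kj.
  have : X (k + 1) <= X j by apply: int_homo => [i|]; [exact: ltW|rewrite -ltzD1 ltrD2r].
  by move=> H; have := le_lt_trans (le_trans (le_trans H jx) xy) yk; rewrite ltxx.
have Hj : 0 <= Y (j + 1) - Y j by rewrite subr_ge0.
have [jk'|jk'] := eqVneq j k.
  subst k; rewrite lerD2l ler_wpM2r//.
  have g0 : 0 < X (j + 1) - X j by rewrite subr_gt0.
  by rewrite -(ler_pM2r g0) -(lerD2l (X j)) -xE -yE.
apply: (@le_trans _ _ (Y (j + 1))).
  by rewrite -lerBrDl ler_piMl.
apply: (@le_trans _ _ (Y k)).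
  by apply: int_homo => //; rewrite -ltzD1 ltrD2r lt_neqAle jk' jk.
by rewrite lerDl mulr_ge0// subr_ge0.
Qed.

Lemma interp_bound X Y a b x : cells X -> (forall j, a <= Y j <= b) -> a <= interp X Y x <= b.
Proof.
move=> cX HY; have [j [th [_ /andP[t0 t1] _ ->]]] := interp_cell X x cX.
have /andP[a1 b1] := HY j; have /andP[a2 b2] := HY (j + 1).
have -> : Y j + th * (Y (j + 1) - Y j) = (1 - th) * Y j + th * Y (j + 1) by ring.
have t1' : 0 <= 1 - th by rewrite subr_ge0.
have ea : a = (1 - th) * a + th * a by ring.
have eb : b = (1 - th) * b + th * b by ring.
by apply/andP; split; [rewrite [leLHS]ea|rewrite [leRHS]eb]; apply: lerD; exact: ler_wpM2l.
Qed.

Lemma interp_error X Y (f : R -> R) e M g x : cells X ->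
  (forall j, `|Y j - f (X j)| <= e) -> (forall x y, `|f x - f y| <= M * `|x - y|) -> 0 <= M ->
  (forall j, X (j + 1) - X j <= g) -> `|interp X Y x - f x| <= e + M * g.
Proof.
move=> cX He fM M0 Hg; have [j [th [/andP[jx xj] /andP[t0 t1] xE ->]]] := interp_cell X x cX.
have n1 : `|f (X j) - f x| <= M * g.
  apply: le_trans (fM _ _) _; rewrite ler_wpM2l// distrC ger0_norm ?subr_ge0//.
  by apply: le_trans (Hg j); rewrite lerD2r ltW.
have n2 : `|f (X (j + 1)) - f x| <= M * g.
  apply: le_trans (fM _ _) _; rewrite ler_wpM2l// ger0_norm ?subr_ge0 ?(ltW xj)//.
  by apply: le_trans (Hg j); rewrite lerD2l lerN2.
have B k : `|f (X k) - f x| <= M * g -> `|Y k - f x| <= e + M * g.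
  move=> H; rewrite -(subrK (f (X k)) (Y k)) -addrA.
  by apply: le_trans (ler_normD _ _) _; exact: lerD.
have := B _ n1; have := B _ n2.
rewrite (_ : Y j + th * (Y (j + 1) - Y j) - f x = (1 - th) * (Y j - f x) + th * (Y (j + 1) - f x)); last by ring.
move=> h2 h1; apply: le_trans (ler_normD _ _) _; rewrite !normrM (ger0_norm t0) ger0_norm ?subr_ge0//.
have -> : e + M * g = (1 - th) * (e + M * g) + th * (e + M * g) by ring.
by apply: lerD; apply: ler_wpM2l => //; rewrite subr_ge0.
Qed.

Lemma cells_node dx : 0 < dx -> cells (node dx).
Proof.
move=> d0; split; first by move=> j; rewrite /node ltr_pM2r// ltr_int ltzD1.
move=> x; exists (Num.floor (x / dx)); rewrite /node -ler_pdivlMr// -ltr_pdivrMr//.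
exact: floor_itv.
Qed.

Lemma interp_node dx Y k : 0 < dx -> interp (node dx) Y (node dx k) = Y k.
Proof.
move=> d0; have [j [th [/andP[h1 h2] _ E ->]]] := interp_cell (node dx) (node dx k) (cells_node _ d0).
move: h1 h2; rewrite /node ler_pM2r// ltr_pM2r// ler_int ltr_int ltzD1 => h1 h2.
have jk : j = k by apply/eqP; rewrite eq_le h1.
subst j; suff -> : th = 0 by rewrite mul0r addr0.
have : th * (node dx (k + 1) - node dx k) = 0.
  by apply/eqP; rewrite -(inj_eq (addrI (node dx k))) addr0 -E.
have g0 : node dx (k + 1) - node dx k != 0 by rewrite gt_eqF// subr_gt0 (cells_node _ d0).1.
by move=> /eqP; rewrite mulf_eq0 (negPf g0) orbF => /eqP.
Qed.

Lemma cells_near X dx B : 0 < dx -> (forall j, X j < X (j + 1)) ->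
  (forall j, `|X j - node dx j| <= B) -> cells X.
Proof.
move=> d0 X1 XB; split => // x.
have [_ N2] := cells_node _ d0.
have [a /andP[a1 _]] := N2 (x - B).
have [b /andP[_ b2]] := N2 (x + B).
have ax : X a <= x.
  have := XB a; rewrite ler_norml => /andP[_ h].
  by move: a1 h; move: (X a) (node dx a) => p q; lra.
have bx : x < X (b + 1).
  have := XB (b + 1); rewrite ler_norml => /andP[h _].
  by move: b2 h; move: (X (b + 1)) (node dx (b + 1)) => p q; lra.
have ab : a <= b + 1.
  rewrite leNgt; apply/negP => /ltW ba.
  have : X (b + 1) <= X a by apply: int_homo => // j; exact: ltW.
  by move=> /(lt_le_trans bx) /lt_le_trans /(_ ax); rewrite ltxx.
have exn : exists n : nat, x < X (a + n%:Z).
  by exists (absz (b + 1 - a)%R); rewrite gez0_abs ?subr_ge0// subrKC.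
case: (ex_minnP exn) => -[|n]; first by rewrite addr0 ltNge ax.
move=> xn Hn; exists (a + n%:Z); rewrite -addrA (addrC n%:Z) -intS xn andbT leNgt.
by apply/negP => /Hn; rewrite ltnn.
Qed.

End Interpolation.

Section Scheme.
Context {R : realType}.
Variables (Finf dx : R).
Hypothesis Finf0 : 0 < Finf.
Hypothesis dx0 : 0 < dx.
Local Notation dt := (time_step Finf dx).
Local Notation x_ := (node dx).
Implicit Types p : (R -> R) * (R -> R).

(* The last condition is the energy inequality (u_x)^2 <= F_x: for every lam,
   x - 2 lam u + lam^2 F is nondecreasing.  Being linear in (u, F), it survives
   interpolation, and evolution merely shifts lam to lam - tau / 2. *)
Definition admissible p := [/\ exists B, forall j, `|p.1 (x_ j)| <= B,
  forall j, 0 <= p.2 (x_ j) <= Finf,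
  forall j, p.2 (x_ j) <= p.2 (x_ (j + 1)) &
  forall lam j, x_ j - 2 * lam * p.1 (x_ j) + lam ^+ 2 * p.2 (x_ j) <=
    x_ (j + 1) - 2 * lam * p.1 (x_ (j + 1)) + lam ^+ 2 * p.2 (x_ (j + 1))].

Lemma time_step_gt0 : 0 < dt.
Proof. by rewrite /time_step mulr_gt0 ?invr_gt0 ?mulr_gt0 ?sqrtr_gt0. Qed.

Lemma time_step_sqr : Finf * dt ^+ 2 = dx / 4.
Proof.
rewrite /time_step exprMn exprVn exprMn !sqr_sqrtr ?(ltW Finf0) ?(ltW dx0)//.
by field; rewrite gt_eqF.
Qed.

Lemma node_succ j : x_ (j + 1) = x_ j + dx.
Proof. by rewrite /node intrD mulrDl mul1r. Qed.

(** Admissibility with [lam] equal to [2 * tau] and to its opposite bounds [tau] times the jump of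
    velocity by [dx / 4] plus [tau^2] times the jump of energy, the latter at most [dx / 4] by
    [time_step_sqr]. This puts the gap between [9/16 dx] and [25/16 dx]; the lower bound is relaxed
    to [dx / 4]. *)
Lemma moved_gap tau p j : admissible p -> 0 <= tau <= dt ->
  dx / 4 <= moved_node Finf dx tau p (j + 1) - moved_node Finf dx tau p j <= 25 / 16 * dx.
Proof.
move=> [_ H2 H3 H4] /andP[t0 tdt].
have h1 := H4 (2 * tau) j; have h2 := H4 (- (2 * tau)) j.
have F1 := H3 j; have /andP[F2 _] := H2 j; have /andP[_ F3] := H2 (j + 1).
have tq : Finf * tau ^+ 2 <= dx / 4.
  by rewrite -time_step_sqr ler_wpM2l ?(ltW Finf0)// lerXn2r ?nnegrE// (le_trans t0).
have Fq : (p.2 (x_ (j + 1)) - p.2 (x_ j)) * tau ^+ 2 <= dx / 4.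
  by apply: le_trans tq; rewrite ler_wpM2r ?exprn_ge0//; lra.
have Fq0 : 0 <= (p.2 (x_ (j + 1)) - p.2 (x_ j)) * tau ^+ 2 by rewrite mulr_ge0 ?exprn_ge0// subr_ge0.
move: h1 h2 Fq Fq0; rewrite /moved_node node_succ sqrrN exprMn.
move: (x_ j) (p.1 (x_ j)) (p.1 (x_ j + dx)) (p.2 (x_ j)) (p.2 (x_ j + dx)) => x v w f g h1 h2 Fq Fq0.
have {}h1 : 4 * (tau * (w - v)) <= dx + 4 * ((g - f) * tau ^+ 2).
  by apply: le_sub_trans h1; ring.
have {}h2 : - 4 * (tau * (w - v)) <= dx + 4 * ((g - f) * tau ^+ 2).
  by apply: le_sub_trans h2; ring.
rewrite (_ : _ - _ = dx + tau * (w - v) + 4^-1 * ((g - f) * tau ^+ 2)); last by ring.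
move: (tau * _) (_ * tau ^+ 2) h1 h2 Fq Fq0 => a b h1 h2 Fq Fq0; have := dx0 => d0.
by apply/andP; split; lra.
Qed.

Lemma moved_cells tau p : admissible p -> 0 <= tau <= dt -> cells (moved_node Finf dx tau p).
Proof.
move=> Hp Ht; have [[B HB] H2 _ _] := Hp; have /andP[t0 _] := Ht.
apply: (@cells_near _ _ dx (B * tau + Finf * tau ^+ 2)) => // j.
  have /andP[h _] := moved_gap tau p j Hp Ht.
  by rewrite -subr_gt0; apply: lt_le_trans h; rewrite divr_gt0.
have -> : moved_node Finf dx tau p j - x_ j =
    p.1 (x_ j) * tau + 4^-1 * (p.2 (x_ j) - 2^-1 * Finf) * tau ^+ 2 by rewrite /moved_node; ring.
apply: le_trans (ler_normD _ _) _; apply: lerD; rewrite normrM.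
  by rewrite (ger0_norm t0) ler_wpM2r.
rewrite (ger0_norm (exprn_ge0 2 t0)) ler_wpM2r ?exprn_ge0//.
by have /andP[h1 h2] := H2 j; exact: (centered_bound _ _ 3 h1 h2).
Qed.

Lemma proj_nodeE p j : (Defs.proj dx p).1 (x_ j) = p.1 (x_ j) /\ (Defs.proj dx p).2 (x_ j) = p.2 (x_ j).
Proof. by rewrite /Defs.proj /= !interp_node. Qed.

Lemma admissible_step tau p : admissible p -> 0 <= tau <= dt ->
  admissible (Defs.proj dx (evolve Finf dx tau p)).
Proof.
move=> Hp Ht; have cX := moved_cells tau p Hp Ht; have [[B HB] H2 H3 H4] := Hp.
pose Y := moved_node Finf dx tau p.
pose V (j : int) := p.1 (x_ j) + 2^-1 * (p.2 (x_ j) - 2^-1 * Finf) * tau.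
have t0 : 0 <= tau by case/andP: Ht.
have E1 j : (Defs.proj dx (evolve Finf dx tau p)).1 (x_ j) = interp Y V (x_ j) by have [-> _] := proj_nodeE (evolve Finf dx tau p) j.
have E2 j : (Defs.proj dx (evolve Finf dx tau p)).2 (x_ j) = interp Y (p.2 \o x_) (x_ j) by have [_ ->] := proj_nodeE (evolve Finf dx tau p) j.
have xx j : x_ j <= x_ (j + 1) by rewrite node_succ lerDl ltW.
split.
- exists (B + Finf * tau) => j; rewrite E1 ler_norml; apply: interp_bound => // k.
  rewrite -ler_norml; apply: le_trans (ler_normD _ _) _; apply: lerD => //.
  rewrite normrM (ger0_norm t0) ler_wpM2r//.
  by have /andP[h1 h2] := H2 k; exact: (centered_bound _ _ 1 h1 h2).
- by move=> j; rewrite E2; apply: interp_bound => // k; exact: H2.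
- by move=> j; rewrite !E2; apply: interp_homo => // k; exact: H3.
- move=> lam j; rewrite !E1 !E2.
  (* Since [x] is the interpolant of [Y] at [x], the whole combination is the single interpolant of
     [H], and monotone nodal values have a monotone interpolant. *)
  pose H (k : int) := Y k - 2 * lam * V k + lam ^+ 2 * p.2 (x_ k).
  have HE x : x - 2 * lam * interp Y V x + lam ^+ 2 * interp Y (p.2 \o x_) x = interp Y H x.
    have [k [th [_ _ xE IE]]] := interp_cell Y x cX.
    by rewrite !IE {1}xE /H /=; ring.
  rewrite !HE; apply: interp_homo => // k.
  have := H4 (lam - tau / 2) k; rewrite /H /Y /V /moved_node.
  move: (x_ k) (x_ (k + 1)) (p.1 (x_ k)) (p.1 (x_ (k + 1))) (p.2 (x_ k)) (p.2 (x_ (k + 1))) => x y v w f g.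
  by move=> h; apply: le_sub_trans h; field.
Qed.

End Scheme.

(** * Error of the scheme against a Lipschitz semigroup *)

Section Convergence.
Context {R : realType}.
Variables (Finf dx T M : R) (u F : R -> R -> R).
Hypothesis Finf0 : 0 < Finf.
Hypothesis dx0 : 0 < dx.
Hypothesis T0 : 0 < T.
Hypothesis M0 : 0 <= M.
Hypothesis uM : forall t x y, 0 <= t <= T -> `|u t x - u t y| <= M * `|x - y|.
Hypothesis FM : forall t x y, 0 <= t <= T -> `|F t x - F t y| <= M * `|x - y|.
Hypothesis semigroup : forall t s x, 0 <= t -> 0 <= s -> t + s <= T ->
  u (t + s) (char_x Finf (u t) (F t) s x) = char_v Finf (u t) (F t) s x /\
  F (t + s) (char_x Finf (u t) (F t) s x) = F t x.
Local Notation dt := (time_step Finf dx).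
Local Notation x_ := (node dx).
Implicit Types p : (R -> R) * (R -> R).

Definition nodal_error p t e :=
  forall j, `|p.1 (x_ j) - u t (x_ j)| <= e /\ `|p.2 (x_ j) - F t (x_ j)| <= e.

(** The rate at which a nodal error grows: [2^-1] from the acceleration in the velocity update,
    [M + M * T] from evaluating a Lipschitz function at a displaced node. [defect] is [M] times the
    largest gap between moved nodes. *)
Definition growth := 2^-1 + M + M * T.
Definition defect := M * (25 / 16 * dx).

(** Restarted from a grid node at time [t], the exact solution follows the same formulas as the
    scheme, so at the moved nodes only the error of the data and the displacement of the node count.
    Interpolation back to the grid adds [defect]. [s] is any fraction of a step because the
    numerical solution is also evaluated between grid times. *)
Lemma nodal_error_step p t s e : admissible Finf dx p -> nodal_error p t e -> 0 <= e ->
  0 <= t -> 0 <= s <= dt -> t + s <= T ->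
  nodal_error (Defs.proj dx (evolve Finf dx s p)) (t + s) ((1 + growth * s) * e + defect).
Proof.
move=> Hp He e0 t0 Hs tsT; have /andP[s0 sdt] := Hs.
have tT : 0 <= t <= T by rewrite t0 (le_trans _ tsT)// lerDl.
have tsT' : 0 <= t + s <= T by rewrite addr_ge0.
have sT : s <= T by apply: le_trans tsT; rewrite lerDr.
have cX := @moved_cells R Finf dx Finf0 dx0 s p Hp Hs.
have gap j : moved_node Finf dx s p (j + 1) - moved_node Finf dx s p j <= 25 / 16 * dx.
  by have /andP[] := @moved_gap R Finf dx Finf0 dx0 s p j Hp Hs.
have Xe j : `|moved_node Finf dx s p j - char_x Finf (u t) (F t) s (x_ j)| <= (s + T * s) * e.
  have [h1 h2] := He j.
  rewrite (_ : _ - _ = (p.1 (x_ j) - u t (x_ j)) * s + 4^-1 * s ^+ 2 * (p.2 (x_ j) - F t (x_ j))); last first.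
    by rewrite /moved_node /char_x; ring.
  apply: le_trans (ler_normD _ _) _; rewrite [leRHS]mulrDl; apply: lerD; rewrite normrM.
    by rewrite mulrC (ger0_norm s0) ler_wpM2l.
  rewrite ger0_norm; last by rewrite mulr_ge0// exprn_ge0.
  apply: ler_pM => //; first by rewrite mulr_ge0// exprn_ge0.
  have : s * s <= T * s by rewrite ler_wpM2r.
  have : 0 <= s * s by rewrite mulr_ge0.
  by rewrite expr2; move: (s * s) (T * s) => a b; lra.
have L (f : R -> R) j : (forall x y, `|f x - f y| <= M * `|x - y|) ->
    `|f (char_x Finf (u t) (F t) s (x_ j)) - f (moved_node Finf dx s p j)| <= (M + M * T) * s * e.
  move=> fM; apply: le_trans (fM _ _) _; rewrite distrC.
  by apply: le_trans (ler_wpM2l M0 (Xe j)) _; rewrite le_eqVlt; apply/orP; left; apply/eqP; ring.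
have E1 j : `|p.1 (x_ j) + 2^-1 * (p.2 (x_ j) - 2^-1 * Finf) * s - u (t + s) (moved_node Finf dx s p j)|
    <= (1 + growth * s) * e.
  have [h1 h2] := He j; have [S1 _] := semigroup t s (x_ j) t0 s0 tsT.
  rewrite -(subrK (u (t + s) (char_x Finf (u t) (F t) s (x_ j))) (p.1 _ + _ * s)) -addrA.
  apply: le_trans (ler_normD _ _) _.
  have -> : (1 + growth * s) * e = (e + 2^-1 * s * e) + (M + M * T) * s * e by rewrite /growth; ring.
  apply: lerD; last by apply: L => x y; exact: uM.
  rewrite S1 /char_v (_ : _ - _ = (p.1 (x_ j) - u t (x_ j)) + 2^-1 * s * (p.2 (x_ j) - F t (x_ j))); last by ring.
  apply: le_trans (ler_normD _ _) _; apply: lerD => //.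
  by rewrite normrM ger0_norm ?mulr_ge0// ler_wpM2l// mulr_ge0.
have E2 j : `|p.2 (x_ j) - F (t + s) (moved_node Finf dx s p j)| <= (1 + growth * s) * e.
  have [h1 h2] := He j; have [_ S2] := semigroup t s (x_ j) t0 s0 tsT.
  rewrite -(subrK (F (t + s) (char_x Finf (u t) (F t) s (x_ j))) (p.2 _)) -addrA.
  apply: le_trans (ler_normD _ _) _.
  apply: (@le_trans _ _ (e + (M + M * T) * s * e)).
    by apply: lerD; [rewrite S2|apply: L => x y; exact: FM].
  have -> : (1 + growth * s) * e = e + (M + M * T) * s * e + 2^-1 * s * e by rewrite /growth; ring.
  by rewrite lerDl !mulr_ge0.
move=> j; have [-> ->] := @proj_nodeE R dx dx0 (evolve Finf dx s p) j; split.
  exact: (interp_error _ _ _ _ _ _ _ cX E1 (fun x y => uM (t + s) x y tsT') M0 gap).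
exact: (interp_error _ _ _ _ _ _ _ cX E2 (fun x y => FM (t + s) x y tsT') M0 gap).
Qed.

Variables u0 F0 : R -> R.
Hypothesis u0E : u 0 =1 u0.
Hypothesis F0E : F 0 =1 F0.
Hypothesis uD : inD Finf u0 F0.
Hypothesis u0B : exists B, forall x, `|u0 x| <= B.
Local Notation grid := (grid_solution Finf dx u0 F0).

Lemma grid_solutionS n : grid n.+1 = Defs.proj dx (evolve Finf dx dt (grid n)).
Proof. by []. Qed.

Lemma admissible_grid n : admissible Finf dx (grid n).
Proof.
have d0 := @time_step_gt0 R Finf dx Finf0 dx0.
elim: n => [|n IH]; last first.
  by rewrite grid_solutionS; apply: admissible_step => //; rewrite lexx ltW.
have E j := @proj_nodeE R dx dx0 (u0, F0) j.
split.
- by have [B HB] := u0B; exists B => j; have [-> _] := E j; exact: HB.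
- by move=> j; have [_ ->] := E j; rewrite (inD_ge0 uD) (inD_le uD).
- move=> j; have [_ ->] := E j; have [_ ->] := E (j + 1); apply: (inD_homo uD).
  by rewrite node_succ lerDl ltW.
(* For the projected data the last condition is the linear form of the energy inequality, taken
   between neighbouring nodes. *)
- move=> lam j; have [-> ->] := E j; have [-> ->] := E (j + 1).
  have xx : x_ j <= x_ (j + 1) by rewrite node_succ lerDl ltW.
  by apply: le_sub_trans (inD_energy uD lam _ _ xx); rewrite /=; ring.
Qed.

Let g0 : 0 <= growth. Proof. by rewrite /growth !addr_ge0// mulr_ge0// ltW. Qed.
Let c0 : 0 <= defect. Proof. by rewrite /defect !mulr_ge0// ltW. Qed.

(** Discrete Gronwall step: [1 + growth * s] is at most the exponential, and the new [defect] is
    absorbed because the exponential factor is at least 1. *)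
Lemma error_growth (a s : R) n : 0 <= a -> 0 <= s ->
  (1 + growth * s) * (n%:R * defect * expR (growth * a)) + defect <=
  n.+1%:R * defect * expR (growth * (a + s)).
Proof.
move=> a0 s0; rewrite mulrDr expRD -natr1 [(n%:R + 1) * _]mulrDl mul1r [leRHS]mulrDl.
apply: lerD.
  rewrite [leLHS]mulrC [leRHS]mulrA ler_wpM2l//; last exact: expR_ge1Dx.
  by rewrite mulr_ge0 ?expR_ge0// mulr_ge0.
by rewrite ler_peMr// -expRD -expR0 ler_expR addr_ge0// mulr_ge0.
Qed.

Lemma grid_error n : n%:R * dt <= T ->
  nodal_error (grid n) (n%:R * dt) (n%:R * defect * expR (growth * (n%:R * dt))).
Proof.
have d0 := @time_step_gt0 R Finf dx Finf0 dx0.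
elim: n => [|n IH] nT.
  rewrite !mul0r => j; have [E1 E2] := @proj_nodeE R dx dx0 (u0, F0) j.
  by rewrite -[grid 0]/(Defs.proj dx (u0, F0)) E1 E2 /= u0E F0E !subrr normr0.
have nS : n.+1%:R * dt = n%:R * dt + dt by rewrite -natr1 mulrDl mul1r.
have n0 : 0 <= n%:R * dt by rewrite mulr_ge0// ltW.
have nT' : n%:R * dt + dt <= T by rewrite -nS.
have nT0 : n%:R * dt <= T by apply: le_trans nT'; rewrite lerDl ltW.
have e0 : 0 <= n%:R * defect * expR (growth * (n%:R * dt)).
  by apply: mulr_ge0; [exact: mulr_ge0|exact: expR_ge0].
have dd : 0 <= dt <= dt by rewrite lexx ltW.
have H := @nodal_error_step _ _ dt _ (admissible_grid n) (IH nT0) e0 n0 dd nT'.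
rewrite grid_solutionS nS => j; have [h1 h2] := H j.
have B := @error_growth (n%:R * dt) dt n n0 (ltW d0).
by split; [apply: le_trans h1 B|apply: le_trans h2 B].
Qed.

Lemma numerical_error t x : 0 <= t <= T ->
  let B := 2 * M * expR (growth * T) * (2 * T * Num.sqrt Finf + 1) + M in
  `|(numerical_solution Finf dx u0 F0 t).1 x - u t x| <= B * (Num.sqrt dx + dx) /\
  `|(numerical_solution Finf dx u0 F0 t).2 x - F t x| <= B * (Num.sqrt dx + dx).
Proof.
move=> tT; have /andP[t0 tT'] := tT.
have d0 := @time_step_gt0 R Finf dx Finf0 dx0.
rewrite /numerical_solution; set n := Num.truncn (t / dt).
have td0 : 0 <= t / dt by rewrite divr_ge0// ltW.
have /andP[n1 n2] : n%:R <= t / dt < n.+1%:R by rewrite truncn_itv.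
have nt : n%:R * dt <= t by rewrite -ler_pdivlMr.
have tn : t < n%:R * dt + dt by move: n2; rewrite ltr_pdivrMr// -natr1 mulrDl mul1r.
have n0 : 0 <= n%:R * dt by rewrite mulr_ge0// ltW.
pose s := t - n%:R * dt.
have s0 : 0 <= s <= dt by rewrite subr_ge0 nt/= lerBlDl ltW.
have ts : n%:R * dt + s = t by rewrite subrKC.
have e0 : 0 <= n%:R * defect * expR (growth * (n%:R * dt)).
  by apply: mulr_ge0; [exact: mulr_ge0|exact: expR_ge0].
have tsT : n%:R * dt + s <= T by rewrite ts.
have H := @nodal_error_step _ _ s _ (admissible_grid n) (grid_error n (le_trans nt tT')) e0 n0 s0 tsT.
rewrite ts in H.
have s00 : 0 <= s by case/andP: s0.
have B1 := @error_growth (n%:R * dt) s n n0 s00; rewrite ts in B1.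
pose e := n.+1%:R * defect * expR (growth * t).
have {}H j := conj (le_trans (H j).1 B1) (le_trans (H j).2 B1).
(* [e] bounds the nodal error after [n] full steps and a partial one, [M * dx] is the interpolation
   error on the fixed grid, and the factor 2 majorises the [25/16] of [defect]. *)
have eB : e + M * dx <= (2 * M * expR (growth * T) * (2 * T * Num.sqrt Finf + 1) + M) * (Num.sqrt dx + dx).
  have q0 : 0 <= Num.sqrt dx by exact: sqrtr_ge0.
  have f0 : 0 < Num.sqrt Finf by rewrite sqrtr_gt0.
  have E1 : expR (growth * t) <= expR (growth * T) by rewrite ler_expR ler_wpM2l.
  (* Here the rate appears: [dx / dt = 2 sqrt(Finf dx)], so defects of order [dx] accumulated over
     [n <= T / dt] steps are of order [sqrt(dx)]. *)
  have ndx : n%:R * dx <= 2 * T * Num.sqrt Finf * Num.sqrt dx.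
    have -> : n%:R * dx = n%:R * dt * (2 * Num.sqrt Finf * Num.sqrt dx).
      rewrite /time_step -{1}(sqr_sqrtr (ltW dx0)); field; by rewrite gt_eqF.
    rewrite [leRHS](_ : _ = T * (2 * Num.sqrt Finf * Num.sqrt dx)); last by ring.
    by rewrite ler_wpM2r ?(le_trans nt)// !mulr_ge0// ltW.
  rewrite mulrDl; apply: lerD; last by rewrite ler_wpM2l// lerDr.
  have K0 : 0 <= 2 * M * expR (growth * T) by rewrite !mulr_ge0 ?expR_ge0.
  have A0 : 0 <= 2 * T * Num.sqrt Finf by rewrite !mulr_ge0// ltW.
  apply: (@le_trans _ _ (2 * M * expR (growth * T) * (n%:R * dx + dx))); last first.
    rewrite -[leRHS]mulrA ler_wpM2l// mulrDl mul1r; apply: lerD; last by rewrite lerDr.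
    by apply: le_trans ndx _; rewrite ler_wpM2l// lerDl ltW.
  rewrite /e /defect [leRHS](_ : _ = (n.+1%:R * (2 * (M * dx))) * expR (growth * T)); last by rewrite -natr1; ring.
  apply: ler_pM => //; rewrite ?expR_ge0 ?mulr_ge0 ?(ltW dx0)//.
  rewrite ler_wpM2l// [leLHS](_ : _ = 25 / 16 * (M * dx)); last by ring.
  by rewrite ler_wpM2r ?mulr_ge0 ?(ltW dx0)//; lra.
have gap j : x_ (j + 1) - x_ j <= dx by rewrite node_succ addrAC subrr add0r.
have cn := cells_node dx dx0.
have PE j := @proj_nodeE R dx dx0 (evolve Finf dx s (grid n)) j.
split; apply: le_trans eB.
  apply: (interp_error _ _ _ _ _ _ _ cn _ (fun x y => uM t x y tT) M0 gap) => j.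
  by have [h _] := H j; have [E _] := PE j; move: h; rewrite E.
apply: (interp_error _ _ _ _ _ _ _ cn _ (fun x y => FM t x y tT) M0 gap) => j.
by have [_ h] := H j; have [_ E] := PE j; move: h; rewrite E.
Qed.

End Convergence.

Theorem theorem2p21 (R : realType) :
  exists C : R -> R -> \bar R -> R,
    (forall T Finf M, 0 < C T Finf M) /\
    forall (T Finf : R) (u0 F0 : R -> R) (u F : R -> R -> R),
      0 < T -> 0 < Finf ->
      inD Finf u0 F0 ->
      conservative_solution Finf u0 F0 u F ->
      W1infty T u -> W1infty T F ->
      (forall v G : R -> R -> R, conservative_solution Finf u0 F0 v G ->
         (forall t, t \in `[0, T] -> v t =1 u t) /\
         {ae (@lebesgue_measure R), forall t, t \in `[0, T] -> G t =1 F t}) /\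
      (forall dx : R, 0 < dx ->
         (ereal_sup
            [set (Linfty_norm
                    ((numerical_solution Finf dx u0 F0 t).1 \- u t)%R
                  + Linfty_norm
                      ((numerical_solution Finf dx u0 F0 t).2 \- F t)%R)%E
            | t in `[0%R, T]]
          <= (C T Finf (slope_bound T u F) * (Num.sqrt dx + dx))%:E)%E).
Proof.
pose B (T Finf M : R) := 2 * M * expR (growth T M * T) * (2 * T * Num.sqrt Finf + 1) + M.
have B0 T Finf M : 0 <= T -> 0 <= M -> 0 <= B T Finf M.
  by move=> T0 M0; rewrite addr_ge0// !mulr_ge0 ?expR_ge0// addr_ge0// !mulr_ge0// sqrtr_ge0.
(* The absolute values and the added 1 make the constant positive for all arguments, even
   meaningless ones; the factor 2 accounts for the sum of two norms. *)
exists (fun T Finf M => 2 * B `|T| Finf `|fine M| + 1); split.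
  by move=> T Finf M; rewrite ltr_wpDl// mulr_ge0// B0.
move=> T Finf u0 F0 u F T0 Finf0 uD uF Wu WF.
have [M0 ML] := @slope_bound_lip R Finf T u0 F0 u F T0 uF Wu WF.
move: (fine _) M0 ML => M M0 ML.
(* Uniqueness and the semigroup property require a Lipschitz constant at least 1; the error estimate
   keeps [M] itself. *)
pose L := M + 1; have L1 : 1 <= L by rewrite lerDr.
have ML' (x y : R) : M * `|x - y| <= L * `|x - y| by rewrite ler_wpM2r// lerDl.
have uL t x y (tT : 0 <= t <= T) := le_trans (ML t x y tT).1 (ML' x y).
have FL t x y (tT : 0 <= t <= T) := le_trans (ML t x y tT).2 (ML' x y).
split.
  move=> v G vG; have [U1 U2] := @sol_unique R Finf u0 F0 T L T0 L1 u F uF WF uL FL v G vG.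
  split; first by move=> t; rewrite in_itv/=; exact: U1.
  by apply: ae_imp U2 _ => t H; rewrite in_itv/=; exact: H.
move=> dx dx0; apply: ge_ereal_sup => _ [t + <-]; rewrite /= in_itv/= => tT.
have [[u0E F0E] uH _ _ _] := uF.
have u0B : exists B, forall x, `|u0 x| <= B.
  have [b b0 Hb] := @sol_bound R u uH T (ltW T0); exists b => x; rewrite -u0E.
  by apply: Hb; rewrite lexx ltW.
have N x := @numerical_error R Finf dx T M u F Finf0 dx0 T0 M0
  (fun t x y tT => (ML t x y tT).1) (fun t x y tT => (ML t x y tT).2)
  (@lip_sol_semigroup R Finf u0 F0 T L T0 L1 u F uF WF uL FL) u0 F0 u0E F0E uD u0B t x tT.
have d0 : 0 <= Num.sqrt dx + dx by rewrite addr_ge0 ?sqrtr_ge0// ltW.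
rewrite (gtr0_norm T0) (ger0_norm M0).
apply: (@le_trans _ _ (B T Finf M * (Num.sqrt dx + dx) + B T Finf M * (Num.sqrt dx + dx))%:E).
  rewrite EFinD; apply: leeD; apply/Linfty_normP; apply: aeW => x; have [h1 h2] := N x.
    exact: h1.
  exact: h2.
by rewrite lee_fin -mulrDl ler_wpM2r// mulr_natl mulr2n lerDl.
Qed.
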